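(* Let $k_1,k_2\in\mathbb{N}=\{1,2,\dots\}$ and $1\le p\le\infty$. For $i=1,2$ let $\Omega_i\subset\mathbb{R}$ be a bounded open interval with fixed base point $x_i\in\Omega_i$, and let $W^{k_i,p}(\Omega_i)$ be the anchored ordered Sobolev space with base point $x_i$. The following statements are equivalent: (1) $k_1=k_2$. (2) There exists a complex-linear isometric order isomorphism $\widetilde{\Delta}:W^{k_1,p}(\Omega_1)\to W^{k_2,p}(\Omega_2)$. (3) There exists a surjective isometry $\Delta:S(W^{k_1,p}(\Omega_1))^+\to S(W^{k_2,p}(\Omega_2))^+$. (4) There exists a surjective phase-isometry $T:S(W^{k_1,p}(\Omega_1))^+\to S(W^{k_2,p}(\Omega_2))^+$. Additionally, if $1<p<\infty$, these are also equivalent to: (5) There exists a surjective norm-additive map $\varphi:S(W^{k_1,p}(\Omega_1))^+\to S(W^{k_2,p}(\Omega_2))^+$. In particular, every map as in (3) or (4) (and, if $1<p<\infty$, every map as in (5)) extends uniquely to a complex-linear isometric order isomorphism $\widetilde{\Delta}:W^{k_1,p}(\Omega_1)\to W^{k_2,p}(\Omega_2)$, and, with $k:=k_1=k_2$, this extension has the form $$(\widetilde{\Delta}f)(x)=\sum_{j=0}^{k-1}f^{(\pi(j))}(x_1)\frac{(x-x_2)^j}{j!}+\frac{1}{(k-1)!}\int_{x_2}^{x}(x-t)^{k-1}\Lambda(f^{(k)})(t)\,dt,\qquad x\in\Omega_2,\ f\in W^{k,p}(\Omega_1),$$ for a unique permutation $\pi$ of $\{0,\ldots,k-1\}$ and a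 unique complex-linear isometric order isomorphism $\Lambda:L^p(\Omega_1)\to L^p(\Omega_2)$ determined by the given map.
   Context: Let $\Omega\subset\mathbb{R}$ be a bounded open interval with Lebesgue measure, $x_0\in\Omega$ a fixed base point, $k\in\mathbb{N}$. All function spaces are complex. $W^{k,p}_{\mathbb{C}}(\Omega)$ is the complex vector space of $f\in L^p(\Omega)$ having weak derivatives $f^{(j)}\in L^p(\Omega)$ for $j=1,\ldots,k$; $f^{(0)}=f$; for $0\le j\le k-1$, $f^{(j)}$ is identified with its absolutely continuous representative, so $f^{(j)}(x_0)$ is well defined. $W^{k,p}_{\mathbb{R}}(\Omega)$ is the real subspace of real-valued functions. The anchored norm is $\|f\|_{k,p}=\big(\sum_{j=0}^{k-1}|f^{(j)}(x_0)|^p+\|f^{(k)}\|_p^p\big)^{1/p}$ for $1\le p<\infty$ and $\|f\|_{k,\infty}=\max\{\max_{0\le j<k}|f^{(j)}(x_0)|,\ \|f^{(k)}\|_\infty\}$ for $p=\infty$. The positive cone is $W^{k,p}(\Omega)^+=\{f\in W^{k,p}_{\mathbb{R}}(\Omega): f^{(k)}\ge0\text{ a.e.},\ f^{(j)}(x_0)\ge0\ \text{for } j=0,\ldots,k-1\}$, inducing the order $\ge_{k,p}$. $W^{k,p}(\Omega)$ denotes $W^{k,p}_{\mathbb{C}}(\Omega)$ with this norm and order (an ordered Banach space). The positive unit sphere is $S(W^{k,p}(\Omega))^+=\{f\in W^{k,p}(\Omega)^+:\|f\|_{k,p}=1\}$. $L^p(\Omega)$ is the complex $L^p$-space with its usual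 norm and positive cone $\{u: u\ge0\text{ a.e.}\}$. Let $A,B$ be non-empty subsets of normed spaces $E,F$ and $T:A\to B$. $T$ is an isometry if $\|T(x)-T(y)\|_F=\|x-y\|_E$ for all $x,y\in A$. $T$ is a phase-isometry if $\{\|x-\alpha y\|_E:\alpha\in\mathbb{T}\}=\{\|T(x)-\alpha T(y)\|_F:\alpha\in\mathbb{T}\}$ for all $x,y\in A$, where $\mathbb{T}=\{z\in\mathbb{C}:|z|=1\}$. $T$ is norm-additive if $\|x+y\|_E=\|T(x)+T(y)\|_F$ for all $x,y\in A$. A complex-linear isometric order isomorphism $\Phi:E\to F$ between ordered Banach spaces with positive cones $E^+,F^+$ is a complex-linear surjective isometry with $\Phi(E^+)=F^+$ and $\Phi^{-1}(F^+)=E^+$. *)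

(* Defs.v *)
From HB Require Import structures.
From mathcomp Require Import all_boot all_order all_algebra.
From mathcomp Require Import perm ring_quotient complex.
From mathcomp Require Import all_classical all_reals all_analysis.
From mathcomp Require Import measurable_realfun ess_sup_inf.

Set Implicit Arguments.
Unset Strict Implicit.
Unset Printing Implicit Defensive.
Import Order.TTheory GRing.Theory Num.Theory.
Import numFieldNormedType.Exports.
Import ComplexField.Normc.

Local Open Scope classical_set_scope.
Local Open Scope ring_scope.
Local Open Scope complex_scope.

Arguments normc {R} x.

Section complex_aux.
Context {R : realType}.
Implicit Types z w : R[i].

Lemma ReD z w : complex.Re (z + w) = complex.Re z + complex.Re w.
Proof. by case: z w => [a b] [c d]. Qed.

Lemma ImD z w : complex.Im (z + w) = complex.Im z + complex.Im w.
Proof. by case: z w => [a b] [c d]. Qed.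

Lemma ReM z w : complex.Re (z * w) =
  complex.Re z * complex.Re w - complex.Im z * complex.Im w.
Proof. by case: z w => [a b] [c d]. Qed.

Lemma ImM z w : complex.Im (z * w) =
  complex.Re z * complex.Im w + complex.Im z * complex.Re w.
Proof. by case: z w => [a b] [c d]. Qed.

Lemma normcE2 z :
  normc z = Num.sqrt (complex.Re z ^+ 2 + complex.Im z ^+ 2).
Proof. by case: z. Qed.

Lemma normc_ge0 z : 0 <= normc z.
Proof. by rewrite normcE2 sqrtr_ge0. Qed.

Lemma normr_Re_le z : `|complex.Re z| <= normc z.
Proof.
by rewrite normcE2 -sqrtr_sqr ler_wsqrtr// lerDl sqr_ge0.
Qed.

Lemma normr_Im_le z : `|complex.Im z| <= normc z.
Proof.
by rewrite normcE2 -sqrtr_sqr ler_wsqrtr// lerDr sqr_ge0.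
Qed.

End complex_aux.

Section le_Lnorm.
Context d (T : measurableType d) (R : realType).
Variable mu : {measure set T -> \bar R}.

Lemma le_Lnorm (p : \bar R) (f g : T -> R) : (1 <= p)%E ->
  measurable_fun setT f -> measurable_fun setT g ->
  (forall x, `|f x| <= `|g x|) ->
  ('N[mu]_p[EFin \o f] <= 'N[mu]_p[EFin \o g])%E.
Proof.
move=> p1 mf mg fg; rewrite unlock /Lnorm.
case: p p1 => [r|_|//].
  rewrite lee_fin => r1; have r0 : 0 < r by exact: lt_le_trans r1.
  rewrite gt0_ler_poweR ?invr_ge0 ?(ltW r0)//.
  - by rewrite in_itv/= leey integral_ge0.
  - by rewrite in_itv/= leey integral_ge0.
  apply: ge0_le_integral => //=.
  - apply/measurable_EFinP.
    apply: (@measurableT_comp _ _ _ _ _ _ (@powR R ^~ r)) => //.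
    exact: measurableT_comp.
  - apply/measurable_EFinP.
    apply: (@measurableT_comp _ _ _ _ _ _ (@powR R ^~ r)) => //.
    exact: measurableT_comp.
  - by move=> x _; rewrite lee_fin ge0_ler_powR ?(ltW r0)// nnegrE.
case: ifPn => // _; apply: le_ess_sup; apply: nearW => x /=.
by rewrite lee_fin.
Qed.

End le_Lnorm.

Section complex_Lp.
Context d (T : measurableType d) (R : realType).
Variable mu : {measure set T -> \bar R}.
Variables (p : \bar R) (p1 : (1 <= p)%E).
Implicit Types f g : T -> R[i].

(* Borel measurability of a complex-valued function, componentwise *)
Definition cmeasurable f :=
  measurable_fun setT (fun x => complex.Re (f x)) /\
  measurable_fun setT (fun x => complex.Im (f x)).

(* [normc] is the modulus of R[i] with values in R (whereas [`|z|] is in R[i]) *)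
Definition cLfun : {pred T -> R[i]} :=
  mem [set f | cmeasurable f /\ finite_norm mu p (normc \o f)].

Lemma measurable_normc f : cmeasurable f -> measurable_fun setT (normc \o f).
Proof.
move=> [mr mi].
rewrite (_ : _ \o _ = Num.sqrt \o
  (fun x => complex.Re (f x) ^+ 2 + complex.Im (f x) ^+ 2)); last first.
  by apply/funext => x; rewrite /= normcE2.
apply: (@measurableT_comp _ _ _ _ _ _ (@Num.sqrt R)).
  exact: continuous_measurable_fun (@sqrt_continuous R).
by apply: measurable_funD; exact: measurable_funX.
Qed.

Lemma cmeasurableD f g : cmeasurable f -> cmeasurable g -> cmeasurable (f + g).
Proof.
move=> [fr fi] [gr gi]; split.
- by under eq_fun do rewrite ReD; exact: measurable_funD.
- by under eq_fun do rewrite ImD; exact: measurable_funD.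
Qed.

Lemma cmeasurableZ (a : R[i]) f : cmeasurable f -> cmeasurable (a *: f).
Proof.
move=> [fr fi]; split.
- under eq_fun do rewrite ReM.
  by apply: measurable_funB; exact: measurable_funM.
- under eq_fun do rewrite ImM.
  by apply: measurable_funD; exact: measurable_funM.
Qed.

Lemma cLfun_submod_closed : submod_closed cLfun.
Proof.
split.
  apply: mem_set; split; first by split; exact: measurable_cst.
  rewrite (_ : _ \o _ = cst 0).
    by rewrite /finite_norm; have := finite_norm_cst0 mu p1.
  by apply/funext => x; exact: normc0.
move=> a f g; rewrite !inE => -[mf nf] [mg ng].
split; first by apply: cmeasurableD => //; exact: cmeasurableZ.
have mnf := measurable_normc mf; have mng := measurable_normc mg.
have mh : measurable_fun setT ((normc a \*: (normc \o f)) \+ (normc \o g)).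
  by apply: measurable_funD => //; exact: measurable_funM.
rewrite /finite_norm; apply: (@le_lt_trans _ _
  'N[mu]_p[EFin \o ((normc a \*: (normc \o f)) \+ (normc \o g))%R]%E).
  apply: le_Lnorm => //.
    by apply: measurable_normc; apply: cmeasurableD => //; exact: cmeasurableZ.
  move=> x /=; rewrite !ger0_norm ?normc_ge0//.
    by rewrite (le_trans (le_normcD _ _))// normcM.
  by rewrite addr_ge0 ?mulr_ge0 ?normc_ge0.
have [f' f'E] : exists f' : LfunType mu p1, normc \o f = f'.
  have h : normc \o f \in Lfun mu p by apply/andP; split; rewrite inE.
  by exists (Lfun_Sub p1 h).
apply: (le_lt_trans (eminkowski _ _ _ _)) => //.
- by rewrite f'E; exact: measurable_funM.
rewrite lte_add_pinfty// f'E LnormZ.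
by rewrite lte_mul_pinfty// ?lee_fin//; exact: Lfunction_finite.
Qed.

HB.instance Definition _ :=
  GRing.isSubmodClosed.Build _ _ cLfun cLfun_submod_closed.

Record cLfunType := CLfun {
  cLfun_val :> T -> R[i];
  cLfun_valP : cLfun_val \in cLfun }.

HB.instance Definition _ := [isSub for cLfun_val].
HB.instance Definition _ := [Choice of cLfunType by <:].
HB.instance Definition _ := [SubChoice_isSubLmodule of cLfunType by <:].

Definition null_cLfun : {pred cLfunType} :=
  mem [set f : cLfunType | {ae mu, forall x, f x = 0}].

Lemma null_cLfun_zmod_closed : zmod_closed null_cLfun.
Proof.
split; first by apply: mem_set; exact: aeW.
move=> f g; rewrite !inE => f0 g0; rewrite /null_cLfun/=.
apply: filterS2 f0 g0 => x fx gx.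
by change (f x - g x = 0); rewrite fx gx subr0.
Qed.

HB.instance Definition _ :=
  GRing.isZmodClosed.Build _ null_cLfun null_cLfun_zmod_closed.

(* L^p(mu): p-integrable functions modulo null functions; [cLp_fun], declared as
   a coercion below, picks a representative *)
Definition cLp : Type := Quotient.quot null_cLfun.

HB.instance Definition _ := GRing.Zmodule.on cLp.
HB.instance Definition _ := Choice.on cLp.
HB.instance Definition _ := EqQuotient.on cLp.

Lemma null_cLfunE (f g : cLfunType) :
  (f == g %[mod cLp])%qT = `[< {ae mu, forall x, f x = g x} >].
Proof.
rewrite -Quotient.idealrBE; apply/idP/asboolP.
  rewrite inE; apply: filterS => x.
  by change (f x - g x = 0 -> f x = g x) => /subr0_eq.
move=> fg; apply: mem_set; apply: filterS fg => x.
by change (f x = g x -> f x - g x = 0) => ->; rewrite subrr.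
Qed.

Definition cLp_scale (a : R[i]) (u : cLp) : cLp := (\pi_cLp (a *: repr u))%qT.

Lemma cLp_scale_pi a (f : cLfunType) : 
  cLp_scale a (\pi_cLp f)%qT = (\pi_cLp (a *: f))%qT.
Proof.
apply/eqP; rewrite null_cLfunE; apply/asboolP.
have /eqP := reprK (\pi_cLp f)%qT; rewrite null_cLfunE => /asboolP.
by apply: filterS => x /= fx; congr (a * _).
Qed.

Lemma cLp_scalerA a b u :
  cLp_scale a (cLp_scale b u) = cLp_scale (a * b) u.
Proof.
elim/quotW: u => f.
by rewrite (cLp_scale_pi b f) (cLp_scale_pi a) (cLp_scale_pi _ f) scalerA.
Qed.

Lemma cLp_scale1r : left_id 1 cLp_scale.
Proof. by elim/quotW => f; rewrite cLp_scale_pi scale1r. Qed.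

Lemma cLp_scalerDr : right_distributive cLp_scale +%R.
Proof.
move=> a; elim/quotW => f; elim/quotW => g.
rewrite -pi_addr (cLp_scale_pi _ f) (cLp_scale_pi _ g) cLp_scale_pi scalerDr.
by rewrite pi_addr.
Qed.

Lemma cLp_scalerDl u : {morph cLp_scale^~ u : a b / a + b}.
Proof.
by move=> a b; elim/quotW: u => f; rewrite 3!cLp_scale_pi scalerDl pi_addr.
Qed.

HB.instance Definition _ := GRing.Zmodule_isLmodule.Build R[i] cLp
  cLp_scalerA cLp_scale1r cLp_scalerDr cLp_scalerDl.

Definition cLp_fun (u : cLp) : T -> R[i] := cLfun_val (repr u).

Definition cLp_norm (u : cLp) : R :=
  fine 'N[mu]_p[EFin \o (normc \o cLp_fun u)]%E.

(* the order of R[i] is partial: [0 <= z] says that z is real and nonnegative *)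
Definition cLp_pos : set cLp := [set u | {ae mu, forall x, 0 <= cLp_fun u x}].

Lemma cLp_fun_pi (f : cLfunType) :
  {ae mu, forall x, cLp_fun (\pi_cLp f)%qT x = f x}.
Proof.
by have /eqP := reprK (\pi_cLp f)%qT; rewrite null_cLfunE => /asboolP.
Qed.

Lemma cLp_funD u v :
  {ae mu, forall x, cLp_fun (u + v) x = cLp_fun u x + cLp_fun v x}.
Proof.
rewrite -[u]reprK -[v]reprK -pi_addr.
apply: filterS3 (cLp_fun_pi (repr u + repr v)) (cLp_fun_pi (repr u))
  (cLp_fun_pi (repr v)) => x.
by move=> -> -> ->.
Qed.

Lemma cLp_funZ a u :
  {ae mu, forall x, cLp_fun (a *: u) x = a * cLp_fun u x}.
Proof. exact: cLp_fun_pi. Qed.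

Lemma cLp_fun0 : {ae mu, forall x, cLp_fun 0 x = 0}.
Proof.
have -> : (0 : cLp) = 0 *: 0 by rewrite scale0r.
by apply: filterS (cLp_funZ 0 0) => x ->; rewrite mul0r.
Qed.

Lemma cLp_cmeasurable u : cmeasurable (cLp_fun u).
Proof. by have := cLfun_valP (repr u); rewrite inE => -[]. Qed.

Lemma cLp_finite_norm u : finite_norm mu p (normc \o cLp_fun u).
Proof. by have := cLfun_valP (repr u); rewrite inE => -[]. Qed.

End complex_Lp.

Coercion cLp_fun : cLp >-> Funclass.

Section cintegral.
Context d (T : measurableType d) (R : realType).
Variable mu : {measure set T -> \bar R}.
Implicit Types f g : T -> R[i].

Definition cintegral (D : set T) f : R[i] :=
  (\int[mu]_(x in D) complex.Re (f x)) +i* (\int[mu]_(x in D) complex.Im (f x)).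

Definition cintegrable (D : set T) f :=
  mu.-integrable D (fun x => (complex.Re (f x))%:E) /\
  mu.-integrable D (fun x => (complex.Im (f x))%:E).

Lemma cintegralD f g : cintegrable setT f -> cintegrable setT g ->
  cintegral setT (fun x => f x + g x) = cintegral setT f + cintegral setT g.
Proof.
move=> [fr fi] [gr gi]; rewrite /cintegral.
under eq_Rintegral do rewrite ReD.
under [in X in _ +i* X]eq_Rintegral do rewrite ImD.
by rewrite !RintegralD.
Qed.

Lemma integrableZl_EFin (k : R) (g : T -> R) :
  mu.-integrable setT (fun x => (g x)%:E) ->
  mu.-integrable setT (fun x => (k * g x)%:E).
Proof. by move=> /(integrableZl measurableT k). Qed.

Lemma integrableD_EFin (g h : T -> R) :
  mu.-integrable setT (fun x => (g x)%:E) ->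
  mu.-integrable setT (fun x => (h x)%:E) ->
  mu.-integrable setT (fun x => (g x + h x)%:E).
Proof. by move=> gi hi; have := integrableD measurableT gi hi. Qed.

Lemma integrableB_EFin (g h : T -> R) :
  mu.-integrable setT (fun x => (g x)%:E) ->
  mu.-integrable setT (fun x => (h x)%:E) ->
  mu.-integrable setT (fun x => (g x - h x)%:E).
Proof. by move=> gi hi; have := integrableB measurableT gi hi. Qed.

Lemma integrableMr_EFin (g h : T -> R) : measurable_fun setT h ->
  [bounded h x | x in setT] -> mu.-integrable setT (fun x => (g x)%:E) ->
  mu.-integrable setT (fun x => (h x * g x)%:E).
Proof. by move=> mh bh gi; have := integrableMr measurableT mh bh gi. Qed.

Lemma cintegralZ (c : R[i]) f : cintegrable setT f ->
  cintegral setT (fun x => c * f x) = c * cintegral setT f.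
Proof.
case: c => cr ci [fr fi]; rewrite /cintegral.
under eq_Rintegral do rewrite ReM/=.
under [in X in _ +i* X]eq_Rintegral do rewrite ImM/=.
by rewrite RintegralB ?RintegralD ?RintegralZl//; exact: integrableZl_EFin.
Qed.

Lemma cintegrableZ (c : R[i]) f : cintegrable setT f ->
  cintegrable setT (fun x => c * f x).
Proof.
case: c => cr ci [fr fi]; split.
- under eq_fun do rewrite ReM/=.
  by apply: integrableB_EFin; exact: integrableZl_EFin.
- under eq_fun do rewrite ImM/=.
  by apply: integrableD_EFin; exact: integrableZl_EFin.
Qed.

Lemma ae_eq_cintegral f g : cmeasurable f -> cmeasurable g ->
  {ae mu, forall x, f x = g x} -> cintegral setT f = cintegral setT g.
Proof.
move=> [fr fi] [gr gi] fg; rewrite /cintegral /Rintegral.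
congr (fine _ +i* fine _); apply: ae_eq_integral => //.
- exact/measurable_EFinP.
- exact/measurable_EFinP.
- by apply: filterS fg => x -> _.
- exact/measurable_EFinP.
- exact/measurable_EFinP.
- by apply: filterS fg => x -> _.
Qed.

Lemma cintegrableM (h : T -> R) f : measurable_fun setT h ->
  [bounded h x | x in setT] -> cintegrable setT f ->
  cintegrable setT (fun x => (h x)%:C * f x).
Proof.
move=> mh bh [fr fi]; split.
- under eq_fun do rewrite ReM/= mul0r subr0.
  exact: integrableMr_EFin.
- under eq_fun do rewrite ImM/= mul0r addr0.
  exact: integrableMr_EFin.
Qed.

Lemma cmeasurableM (h : T -> R) f : measurable_fun setT h ->
  cmeasurable f -> cmeasurable (fun x => (h x)%:C * f x).
Proof.
move=> mh [fr fi]; split.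
- under eq_fun do rewrite ReM/= mul0r subr0.
  exact: measurable_funM.
- under eq_fun do rewrite ImM/= mul0r addr0.
  exact: measurable_funM.
Qed.

Lemma cLp_cintegrable (p : \bar R) (p1 : (1 <= p)%E) (u : cLp mu p1) :
  mu setT \is a fin_num -> cintegrable setT u.
Proof.
move=> mufin.
have mu_u := cLp_cmeasurable u; have mn := measurable_normc mu_u.
have nu : mu.-integrable setT (EFin \o (normc \o u)).
  apply/Lfun1_integrable; apply: (Lfun_subset _ p1 mufin p1) => //.
  by apply/andP; split; rewrite inE//=; exact: cLp_finite_norm.
case: mu_u => mr mi; split; apply: le_integrable nu => //.
- exact/measurable_EFinP.
- by move=> x _ /=; rewrite lee_fin (ger0_norm (normc_ge0 _)) normr_Re_le.
- exact/measurable_EFinP.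
- by move=> x _ /=; rewrite lee_fin (ger0_norm (normc_ge0 _)) normr_Im_le.
Qed.

End cintegral.

Section interval_measure.
Context {R : realType}.
Variables a b : R.

Definition leb_itv : set (measurableTypeR R) -> \bar R :=
  mrestr (@lebesgue_measure R) (measurable_itv `]a, b[).

HB.instance Definition _ := Measure.copy leb_itv
  (mrestr (@lebesgue_measure R) (measurable_itv `]a, b[)).

Lemma leb_itv_fin : leb_itv setT \is a fin_num.
Proof.
rewrite /leb_itv /mrestr setTI lebesgue_measure_itv.
by case: ifPn.
Qed.

End interval_measure.

Section test_functions.
Context {R : realType}.

(* real-valued C^oo functions with compact support in ]a, b[ *)
Definition test_function (a b : R) (phi : R -> R) :=
  [/\ forall n x, derivable (derive1n n phi) x 1,
      compact (closure [set x | phi x != 0]) &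
      closure [set x | phi x != 0] `<=` `]a, b[ ].

Variables (a b : R) (phi : R -> R).
Hypothesis tphi : test_function a b phi.

Lemma test_function_continuous n : continuous (derive1n n phi).
Proof.
move=> x; case: tphi => /(_ n x) d _ _.
exact/differentiable_continuous/derivable1_diffP.
Qed.

Lemma test_function_measurable n : measurable_fun setT (derive1n n phi).
Proof. exact: continuous_measurable_fun (@test_function_continuous n). Qed.

Lemma test_function_out n x :
  ~ closure [set x | phi x != 0] x -> (derive1n n phi) x = 0.
Proof.
pose U := ~` closure [set x | phi x != 0].
have oU : open U by exact/closed_openC/closed_closure.
rewrite -/(U x); elim: n x => [x Ux|n IH x Ux].
  apply: contrapT => /eqP px; apply: Ux.
  exact: subset_closure.
rewrite derive1nS derive1E (@near_eq_derive _ _ _ _ (cst 0)).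
  by rewrite -derive1E derive1_cst.
have := open_nbhs_nbhs (conj oU Ux).
by apply: filterS => y /IH.
Qed.

Lemma test_function_bounded n : [bounded (derive1n n phi) x | x in setT].
Proof.
case: (tphi) => _ cK _.
have /compact_bounded [M [Mr HM]] :
    compact (derive1n n phi @` closure [set x | phi x != 0]).
  apply: continuous_compact => //; apply: continuous_subspaceT.
  exact: test_function_continuous.
exists (Num.max 0 M); split; first by rewrite num_real.
move=> y; rewrite gt_max => /andP[y0 My] x _ /=.
have [Kx|/test_function_out ->] :=
    pselect (closure [set x | phi x != 0] x).
  by apply: (HM y My); exists x.
by rewrite normr0 ltW.
Qed.

End test_functions.

(* L^p(]a, b[): since [leb_itv a b] is concentrated on ]a, b[, an element is a
   class of functions on the whole line modulo equality a.e. on ]a, b[ *)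
Notation Lp p1 a b := (cLp (leb_itv a b) p1).

Section sobolev.
Context {R : realType} {p : \bar R} (p1 : (1 <= p)%E).

Variables (k : nat) (a b : R).
Implicit Types f g : Lp p1 a b.

Definition weak_derivative (j : nat) f g := forall phi : R -> R,
  test_function a b phi ->
  cintegral (leb_itv a b) setT (fun x => (derive1n j phi x)%:C * f x) =
  (-1) ^+ j * cintegral (leb_itv a b) setT (fun x => (phi x)%:C * g x).

Lemma Lp_cintegrableM f phi n : test_function a b phi ->
  cintegrable (leb_itv a b) setT (fun x => (derive1n n phi x)%:C * f x).
Proof.
move=> tphi; apply: cintegrableM.
- exact: test_function_measurable tphi n.
- exact: test_function_bounded tphi n.
- exact: cLp_cintegrable (leb_itv_fin a b).
Qed.

Lemma cintegral_Lp_linear f g (c : R[i]) phi n : test_function a b phi ->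
  cintegral (leb_itv a b) setT
    (fun x => (derive1n n phi x)%:C * (c *: f + g : Lp p1 a b) x) =
  c * cintegral (leb_itv a b) setT (fun x => (derive1n n phi x)%:C * f x) +
  cintegral (leb_itv a b) setT (fun x => (derive1n n phi x)%:C * g x).
Proof.
move=> tphi; have fi := Lp_cintegrableM f n tphi.
have gi := Lp_cintegrableM g n tphi.
have cm (u : Lp p1 a b) : cmeasurable (fun x => (derive1n n phi x)%:C * u x).
  apply: cmeasurableM; first exact: test_function_measurable tphi n.
  exact: cLp_cmeasurable u.
rewrite -cintegralZ// -cintegralD//; last exact: cintegrableZ.
apply: ae_eq_cintegral; first exact: cm.
  exact: cmeasurableD (cmeasurableZ c (cm f)) (cm g).
apply: filterS2 (cLp_funD (c *: f) g) (cLp_funZ c f) => x -> ->.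
by rewrite mulrDr mulrCA.
Qed.

Definition sobolev_pred : {pred Lp p1 a b} :=
  mem [set f | forall j, (1 <= j <= k)%N -> exists g, weak_derivative j f g].

Lemma sobolev_submod_closed : submod_closed sobolev_pred.
Proof.
have lin (c : R[i]) j f f' g g' : weak_derivative j f f' ->
    weak_derivative j g g' -> weak_derivative j (c *: f + g) (c *: f' + g').
  move=> ff' gg' phi tphi; rewrite cintegral_Lp_linear// ff'// gg'//.
  rewrite (@cintegral_Lp_linear _ _ c phi 0%N tphi).
  by rewrite mulrDr mulrCA.
split.
  apply: mem_set => j _; exists 0 => phi tphi.
  have := @cintegral_Lp_linear 0 0 (-1) phi j tphi.
  have := @cintegral_Lp_linear 0 0 (-1) phi 0%N tphi.
  by rewrite scaler0 add0r !mulN1r !addNr => -> ->; rewrite mulr0.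
move=> c f g; rewrite !inE => hf hg j jk.
have [f' ff'] := hf _ jk; have [g' gg'] := hg _ jk.
by exists (c *: f' + g'); exact: lin.
Qed.

HB.instance Definition _ :=
  GRing.isSubmodClosed.Build _ _ sobolev_pred sobolev_submod_closed.

Record sobolev := Sobolev {
  sobolev_val :> Lp p1 a b;
  sobolev_valP : sobolev_val \in sobolev_pred }.

HB.instance Definition _ := [isSub for sobolev_val].
HB.instance Definition _ := [Choice of sobolev by <:].
HB.instance Definition _ := [SubChoice_isSubLmodule of sobolev by <:].

(* by uniqueness of weak derivatives, [wderiv j f] is the j-th weak derivative
   of f whenever f has one *)
Definition wderiv (j : nat) f : Lp p1 a b :=
  if j is 0 then f else xget 0 [set g | weak_derivative j f g].

(* the usual epsilon-delta definition on ]a, b[ *)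
Definition absolutely_continuous_itv (g : R -> R[i]) :=
  forall e : R, 0 < e -> exists2 d : R, 0 < d &
    forall (n : nat) (u v : 'I_n -> R),
      (forall i, [/\ a < u i, u i <= v i & v i < b]) ->
      trivIset setT (fun i => `]u i, v i[%classic) ->
      \sum_(i < n) (v i - u i) < d ->
      \sum_(i < n) normc (g (v i) - g (u i)) < e.

(* determined on ]a, b[ when it exists; its values elsewhere are irrelevant *)
Definition ac_repr f : R -> R[i] := xget (fun=> 0)
  [set g | absolutely_continuous_itv g /\
           {ae leb_itv a b, forall x, f x = g x}].

Variable x0 : R.

(* f^(j)(x0), for j < k *)
Definition anchor (j : nat) (f : sobolev) : R[i] := ac_repr (wderiv j f) x0.

(* p = -oo is ruled out by p1, so the default case is p = +oo *)
Definition anchored_norm (f : sobolev) : R :=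
  match p with
  | r%:E => (\sum_(j < k) normc (anchor j f) `^ r +
             cLp_norm (wderiv k f) `^ r) `^ r^-1
  | _ => Num.max (\big[Num.max/0]_(j < k) normc (anchor j f))
                 (cLp_norm (wderiv k f))
  end.

Definition sobolev_pos : set sobolev := [set f : sobolev |
  [/\ {ae leb_itv a b, forall x, complex.Im (f x) = 0},
      cLp_pos (wderiv k f) &
      forall j, (j < k)%N -> 0 <= anchor j f]].

Definition pos_sphere : set sobolev :=
  [set f : sobolev | sobolev_pos f /\ anchored_norm f = 1].

End sobolev.

(* A map between subsets A of E and B of F is given by a total function E -> F of
   which only the restriction to A matters. The norms of E and F are explicit. *)
Section maps_between_ordered_normed_spaces.
Context {R : realType} {E F : lmodType R[i]}.
Variables (nE : E -> R) (nF : F -> R).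

Definition isometry_on (A : set E) (T : E -> F) :=
  forall x y, A x -> A y -> nF (T x - T y) = nE (x - y).

Definition phase_isometry_on (A : set E) (T : E -> F) :=
  forall x y, A x -> A y ->
    [set nE (x - alpha *: y) | alpha in [set z : R[i] | `|z| = 1]] =
    [set nF (T x - alpha *: T y) | alpha in [set z : R[i] | `|z| = 1]].

Definition norm_additive_on (A : set E) (T : E -> F) :=
  forall x y, A x -> A y -> nE (x + y) = nF (T x + T y).

Definition surjection_between (A : set E) (B : set F) (T : E -> F) :=
  set_fun A B T /\ set_surj A B T.

Definition isometric_order_iso (posE : set E) (posF : set F) (Phi : E -> F) :=
  [/\ linear Phi, set_surj setT setT Phi, isometry_on setT Phi,
      Phi @` posE = posF & Phi @^-1` posF = posE].

End maps_between_ordered_normed_spaces.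

(* the integral of g from c to x, with a minus sign when x < c *)
Definition oriented_cintegral {R : realType} (c x : R) (g : R -> R[i]) : R[i] :=
  if c <= x then cintegral lebesgue_measure `[c, x] g
  else - cintegral lebesgue_measure `[x, c] g.

(* [ac_repr (D f) x] is the value at x of the continuous function D f *)
Definition has_canonical_form {R : realType} {p : \bar R} (p1 : (1 <= p)%E)
    (k k' : nat) (a b x0 a' b' x0' : R)
    (pi : 'S_k) (Lam : Lp p1 a b -> Lp p1 a' b')
    (D : sobolev p1 k a b -> sobolev p1 k' a' b') :=
  forall (f : sobolev p1 k a b) (x : R), x \in `]a', b'[ ->
  ac_repr (D f) x =
    \sum_(j < k) anchor x0 (pi j) f * ((x - x0') ^+ j / j`!%:R)%:C +
    ((k.-1)`!%:R^-1)%:C *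
      oriented_cintegral x0' x
        (fun t => ((x - t) ^+ k.-1)%:C * Lam (wderiv k f) t).

(* Main.v *)
Require Import Defs.
From HB Require Import structures.
From mathcomp Require Import all_boot all_order all_algebra.
From mathcomp Require Import perm ring_quotient complex.
From mathcomp Require Import all_classical all_reals all_analysis.
From mathcomp Require Import measurable_realfun ess_sup_inf.
From mathcomp Require Import ring lra.

(** Why the theorem holds.

Taylor's formula at the base point identifies a function [f] of W^{k,p} with
its jet, the [k] numbers f(x0), ..., f^(k-1)(x0) together with the function
f^(k).  The anchored norm is the l^p sum of the norms of these data and the
cone asks for all of them to be nonnegative, so that W^{k,p} is, as an ordered
normed space, the L^p space of ONE finite measure: Lebesgue measure on the
interval plus [k] point masses ([amu], [jet], [jet_norm], [jet_pos],
[unjetK]).  The theorem thus becomes a statement on the spaces L^p(mu), where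
[k] is the number of atoms of [mu].

Extension of sphere maps ([sphere_map_extension]).  Let [D] be a surjection
between the positive unit spheres of two such spaces which preserves the norm
of [x + e y], with e = -1, or e = 1 and 1 < p < oo.  The point is that [D]
preserves order relations, set by set: to every measurable [B] corresponds an
[A] such that a f <= g holds on [A] iff a (D f) <= D g holds on [B]
([order_match]).
- For p < oo, disjointness of supports is the equation |x + e y|^p = 2
  ([ortho_norm]), so [D] matches supports; comparing [f] with its own
  normalized restriction to a support shows that [D] also preserves the mass
  of |f|^p over matching supports ([corr_mass]), and masses over all small
  supports detect the order ([order_match_finite]).
- For p = oo, indicator functions are the elements of the sphere whose set of
  points at distance 1 is maximal ([maximal_charLp], [charLp_maximal]), so [D]
  permutes them; the distances of [f] to indicator functions know the level
  sets of [f], hence the order ([order_match_sup]).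
Given the set-wise order relations, the homogeneous extension of [D] to the
cone is additive: a strict inequality between the extension of a sum and the
sum of the extensions could be separated by rational multiples on a non-null
set and pulled back to a contradiction ([cone_mapD]).  The complexification
is a positive operator, hence satisfies |Phi f| <= Phi |f|
([positive_operator_modulus]) and is a contraction; so is its inverse, built
from the inverse correspondence, and both are isometries.

Atoms.  An order isomorphism preserves the minimal elements of the cone.  They
are the multiples of the indicators of the [k] point masses
([minimal_is_delta]), because Lebesgue measure has no atom.  Counting them
gives k1 = k2, matching them gives the permutation, and the remaining part of
the operator is the isomorphism [Lambda] of the L^p spaces
([sobolev_iso_structure]); Taylor's formula turns this into the canonical form
([canonical_formP], [sobolev_iso_canonical]).  Conversely, if k1 = k2, an
affine change of variables is an isomorphism of the L^p spaces
([transfer_iso]), which lifts to the Sobolev spaces.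

Phases.  For x, y >= 0 and |alpha| = 1 one has |x - alpha y| >= |x - y|
pointwise, so the norm of x - y is the least element of the set that a
phase-isometry preserves ([phase_isometry_sphere]); a phase-isometry between
the spheres is therefore an isometry, and a linear isometry is a
phase-isometry.

The Sobolev side rests on the lemma of du Bois-Reymond ([du_bois_reymond],
proved with smooth plateaus built from exp(-1/x)): a weak derivative of [g] is
[u] iff [g] is a.e. a constant plus a primitive of [u]
([weak_derivative_primP]).  Taylor's formula ([taylor]) follows by repeated
integration by parts, itself Fubini's theorem on a triangle
([fubini_triangle]). *)

Set Implicit Arguments.
Unset Strict Implicit.
Unset Printing Implicit Defensive.
Import Order.TTheory GRing.Theory Num.Theory.
Import numFieldNormedType.Exports.
Import ComplexField.Normc.

Local Open Scope classical_set_scope.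
Local Open Scope ring_scope.
Local Open Scope complex_scope.

(** * Elements of complex L^p spaces *)

Section complex_facts.
Context {R : realType}.
Implicit Types z w : R[i].

(** The order of R[i] is partial; a complex inequality 0 <= z is a real
    inequality together with the reality of z. *)
Lemma cge0P z : (0 <= z) = (complex.Im z == 0) && (0 <= complex.Re z).
Proof. by case: z => a b; rewrite lecE/= eq_sym. Qed.

Lemma cge0E z : 0 <= z -> z = (complex.Re z)%:C.
Proof. by rewrite cge0P => /andP[/eqP]; case: z => a b /= -> _. Qed.

Lemma normcN z : normc (- z) = normc z.
Proof. by case: z => a b /=; rewrite !sqrrN. Qed.

Lemma normc_real (x : R) : normc x%:C = `|x|.
Proof. by rewrite normcE2/= expr0n/= addr0 sqrtr_sqr. Qed.

Lemma normc_ge0E z : 0 <= z -> normc z = complex.Re z.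
Proof.
move=> z0; rewrite {1}(cge0E z0) normc_real ger0_norm//.
by move: z0; rewrite cge0P => /andP[].
Qed.

Lemma normrE z : `|z| = (normc z)%:C.
Proof. by case: z. Qed.

Lemma normc_eq1 z : `|z| = 1 -> normc z = 1.
Proof. by rewrite normrE => -[]. Qed.

End complex_facts.

Section linear_maps.
Context {R : realType} {V W : lmodType R[i]}.

Lemma linD (F : V -> W) : linear F -> forall x y, F (x + y) = F x + F y.
Proof. by move=> l x y; have := l 1 x y; rewrite !scale1r. Qed.

Lemma lin0 (F : V -> W) : linear F -> F 0 = 0.
Proof. by move=> l; apply: (addrI (F 0)); rewrite -linD// !addr0. Qed.

Lemma linZ (F : V -> W) : linear F -> forall c x, F (c *: x) = c *: F x.
Proof. by move=> l c x; have := l c x 0; rewrite !addr0 lin0// addr0. Qed.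

Lemma linB (F : V -> W) : linear F -> forall x y, F (x - y) = F x - F y.
Proof. by move=> l x y; rewrite linD// -scaleN1r linZ// scaleN1r. Qed.

End linear_maps.

Section Lp_elements.
Context d (T : measurableType d) (R : realType).
Variable mu : {measure set T -> \bar R}.
Variables (p : \bar R) (p1 : (1 <= p)%E).
Local Notation E := (cLp mu p1).
Implicit Types (f g : T -> R[i]) (u v : E).

Definition inLp f := cmeasurable f /\ finite_norm mu p (normc \o f).

Lemma inLp_mem f : inLp f <-> f \in cLfun mu p.
Proof. by rewrite inE; split. Qed.

Lemma inLp_fun u : inLp u.
Proof. by split; [exact: cLp_cmeasurable|exact: cLp_finite_norm]. Qed.

Lemma inLp_lin (c : R[i]) f g : inLp f -> inLp g ->
  inLp (fun x => c * f x + g x).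
Proof.
move=> /inLp_mem Lf /inLp_mem Lg; apply/inLp_mem.
by have [_ /(_ c f g Lf Lg)] := cLfun_submod_closed mu p1.
Qed.

Lemma inLp0 : inLp (fun=> 0).
Proof. by apply/inLp_mem; have [+ _] := cLfun_submod_closed mu p1. Qed.

Lemma inLpD f g : inLp f -> inLp g -> inLp (fun x => f x + g x).
Proof.
by move=> Lf Lg; have := inLp_lin 1 Lf Lg; under eq_fun do rewrite mul1r.
Qed.

Lemma inLpZ c f : inLp f -> inLp (fun x => c * f x).
Proof.
by move=> Lf; have := inLp_lin c Lf inLp0; under eq_fun do rewrite addr0.
Qed.

Lemma inLp_le f g : cmeasurable f -> inLp g ->
  (forall x, normc (f x) <= normc (g x)) -> inLp f.
Proof.
move=> mf [mg ng] fg; split=> //; apply: le_lt_trans ng.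
apply: le_Lnorm => //; try exact: measurable_normc.
by move=> x /=; rewrite !ger0_norm ?normc_ge0.
Qed.

(** The value 0 outside L^p makes the class of a function a total operation,
    which avoids carrying integrability proofs in terms. *)
Definition toLp f : E :=
  if pselect (f \in cLfun mu p) is left h then (\pi_E (CLfun h))%qT else 0.

Lemma toLpE f : inLp f -> {ae mu, forall x, toLp f x = f x}.
Proof.
move=> /inLp_mem Lf; rewrite /toLp; case: pselect => // h.
by apply: filterS (cLp_fun_pi p1 (CLfun h)) => x.
Qed.

Lemma cLp_eqP u v : u = v <-> {ae mu, forall x, u x = v x}.
Proof.
split=> [-> | uv]; first exact: aeW.
rewrite -[u]reprK -[v]reprK; apply/eqP; rewrite null_cLfunE; exact/asboolP.
Qed.

Lemma cLp_funN u : {ae mu, forall x, (- u : E) x = - u x}.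
Proof.
by rewrite -scaleN1r; apply: filterS (cLp_funZ (-1) u) => x ->; rewrite mulN1r.
Qed.

Lemma cLp_funB u v : {ae mu, forall x, (u - v : E) x = u x - v x}.
Proof. by apply: filterS2 (cLp_funD u (- v)) (cLp_funN v) => x -> ->. Qed.

Lemma cLp_fun_lin (z : R[i]) u v :
  {ae mu, forall x, (z *: u + v : E) x = z * u x + v x}.
Proof.
apply: filterS2 (cLp_funD (z *: u) v) (cLp_funZ z u) => x E1 E2.
by rewrite E1 E2.
Qed.

Lemma measurable_Re u : measurable_fun setT (fun x => complex.Re (u x)).
Proof. by have [] := cLp_cmeasurable u. Qed.

Lemma measurable_Im u : measurable_fun setT (fun x => complex.Im (u x)).
Proof. by have [] := cLp_cmeasurable u. Qed.

Lemma measurable_normu u : measurable_fun setT (fun x => normc (u x)).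
Proof. exact: measurable_normc (cLp_cmeasurable u). Qed.

Lemma cmeasurable_real (g : T -> R) :
  measurable_fun setT g -> cmeasurable (fun x => (g x)%:C).
Proof. by move=> mg; split => //=; exact: measurable_cst. Qed.

Lemma inLp_real_le (g : T -> R) u : measurable_fun setT g ->
  (forall x, `|g x| <= normc (u x)) -> inLp (fun x => (g x)%:C).
Proof.
move=> mg gu; apply: inLp_le (inLp_fun u) _; first exact: cmeasurable_real.
by move=> x; rewrite normc_real.
Qed.

(** The norm only sees functions up to null sets, so pointwise domination may
    fail on a null set. *)
Lemma ae_le_Lnorm (f g : T -> R) : measurable_fun setT f ->
  measurable_fun setT g -> {ae mu, forall x, `|f x| <= `|g x|} ->
  ('N[mu]_p[EFin \o f] <= 'N[mu]_p[EFin \o g])%E.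
Proof.
move=> mf mg fg; rewrite unlock /Lnorm.
case: p p1 => [r|_|//].
  rewrite lee_fin => r1; have r0 : 0 < r by exact: lt_le_trans r1.
  rewrite gt0_ler_poweR ?invr_ge0 ?(ltW r0)//.
  - by rewrite in_itv/= leey integral_ge0.
  - by rewrite in_itv/= leey integral_ge0.
  apply: ae_ge0_le_integral => //=.
  - apply/measurable_EFinP.
    apply: (@measurableT_comp _ _ _ _ _ _ (@powR R ^~ r)) => //.
    exact: measurableT_comp.
  - apply/measurable_EFinP.
    apply: (@measurableT_comp _ _ _ _ _ _ (@powR R ^~ r)) => //.
    exact: measurableT_comp.
  - by apply: filterS fg => x fgx _; rewrite lee_fin ge0_ler_powR ?(ltW r0)// nnegrE.
case: ifPn => // _; apply: le_ess_sup; apply: filterS fg => x /=.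
by rewrite lee_fin.
Qed.

Lemma cLp_norm_fin u :
  'N[mu]_p[EFin \o (normc \o u)]%E = (cLp_norm u)%:E.
Proof.
rewrite /cLp_norm fineK// ge0_fin_numE ?Lnorm_ge0//; exact: cLp_finite_norm.
Qed.

Lemma cLp_norm_ge0 u : 0 <= cLp_norm u.
Proof. by rewrite -lee_fin -cLp_norm_fin Lnorm_ge0. Qed.

Lemma le_cLp_norm u v : {ae mu, forall x, normc (u x) <= normc (v x)} ->
  cLp_norm u <= cLp_norm v.
Proof.
move=> uv; rewrite -lee_fin -!cLp_norm_fin; apply: ae_le_Lnorm.
- exact: measurable_normu.
- exact: measurable_normu.
- by apply: filterS uv => x /=; rewrite !ger0_norm ?normc_ge0.
Qed.

Lemma eq_cLp_norm u v : {ae mu, forall x, normc (u x) = normc (v x)} ->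
  cLp_norm u = cLp_norm v.
Proof.
move=> uv; apply/eqP; rewrite eq_le !le_cLp_norm//;
  by apply: filterS uv => x ->.
Qed.

Lemma ler_cLp_normD u v : cLp_norm (u + v) <= cLp_norm u + cLp_norm v.
Proof.
rewrite -lee_fin EFinD -!cLp_norm_fin.
apply: le_trans (eminkowski _ _ _ _) => //; try exact: measurable_normu.
apply: ae_le_Lnorm.
- exact: measurable_normu.
- by apply: measurable_funD; exact: measurable_normu.
apply: filterS (cLp_funD u v) => x /= ->.
rewrite !ger0_norm ?addr_ge0 ?normc_ge0//; exact: le_normcD.
Qed.

Lemma cLp_normZ c u : cLp_norm (c *: u) = normc c * cLp_norm u.
Proof.
apply: EFin_inj; rewrite EFinM -!cLp_norm_fin.
have h : normc \o u \in Lfun mu p.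
  by apply/andP; split; rewrite inE; [exact: measurable_normu|exact: cLp_finite_norm].
have := LnormZ (Lfun_Sub p1 h) (normc c).
rewrite ger0_norm ?normc_ge0// => <-.
apply/eqP; rewrite eq_le; apply/andP; split; apply: ae_le_Lnorm => //.
- exact: measurable_normu.
- by apply: measurable_funM => //; exact: measurable_normu.
- by apply: filterS (cLp_funZ c u) => x /= ->; rewrite normcM.
- by apply: measurable_funM => //; exact: measurable_normu.
- exact: measurable_normu.
- by apply: filterS (cLp_funZ c u) => x /= ->; rewrite normcM.
Qed.

Lemma cLp_normN u : cLp_norm (- u) = cLp_norm u.
Proof. by rewrite -scaleN1r cLp_normZ normcN normc1 mul1r. Qed.

Lemma cLp_norm_eq0 u : cLp_norm u = 0 -> u = 0.
Proof.
move=> u0; apply/cLp_eqP.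
have : 'N[mu]_p[EFin \o (normc \o u)]%E = 0%E by rewrite cLp_norm_fin u0.
move=> /Lnorm_eq0_eq0; case.
- by apply/measurable_EFinP; exact: measurable_normu.
- exact: lt_le_trans p1.
- move=> N [mN N0 sN].
apply: filterS2 (cLp_fun0 mu p1) (ex_intro _ N (And3 mN N0 sN)) => x -> /= /(_ Logic.I) [].
exact: eq0_normc.
Qed.

Lemma cLp_norm0 : cLp_norm (0 : E) = 0.
Proof. by rewrite -(scale0r (0 : E)) cLp_normZ normc0 mul0r. Qed.

End Lp_elements.

(** The definition is locked: conversion would otherwise unfold the integral
    whenever two masses are compared. *)
HB.lock Definition mass d (T : measurableType d) (R : realType)
    (mu : {measure set T -> \bar R}) (r : R) (f : T -> R[i]) (A : set T) : R :=
  fine (\int[mu]_(x in A) (normc (f x) `^ r)%:E)%E.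
Canonical mass_unlockable := Unlockable mass.unlock.

(** * Restrictions to measurable sets *)

Section restriction.
Context d (T : measurableType d) (R : realType).
Variable mu : {measure set T -> \bar R}.
Variables (p : \bar R) (p1 : (1 <= p)%E).
Local Notation E := (cLp mu p1).
Implicit Types (u v : E) (A : set T).

Definition restr A u : E := toLp mu p1 (fun x => (\1_A x)%:C * u x).

Lemma normc_indicM A (z : R[i]) x : normc ((\1_A x)%:C * z) <= normc z.
Proof.
rewrite normcM normc_real indicE.
by case: (x \in A); rewrite ?normr1 ?mul1r ?normr0 ?mul0r ?normc_ge0.
Qed.

Lemma restrE A u : measurable A ->
  {ae mu, forall x, restr A u x = (\1_A x)%:C * u x}.
Proof.
move=> mA; apply: toLpE; apply: inLp_le (inLp_fun u) _ => //.
  apply: cmeasurableM; last exact: cLp_cmeasurable.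
  exact: measurable_indic.
by move=> x; exact: normc_indicM.
Qed.

Lemma restr_in A u : measurable A ->
  {ae mu, forall x, A x -> restr A u x = u x}.
Proof.
move=> mA; apply: filterS (restrE u mA) => x -> Ax.
by rewrite indicE mem_set//= mul1r.
Qed.

Lemma restr_out A u : measurable A ->
  {ae mu, forall x, ~ A x -> restr A u x = 0}.
Proof.
move=> mA; apply: filterS (restrE u mA) => x -> Ax.
by rewrite indicE memNset//= mul0r.
Qed.

Lemma restr_ge0 A u : measurable A -> cLp_pos u -> cLp_pos (restr A u).
Proof.
move=> mA u0; apply: filterS2 (restrE u mA) u0 => x -> ux.
by rewrite mulr_ge0// lecR indicE.
Qed.

Lemma restrD A u : measurable A -> u = restr A u + restr (~` A) u.
Proof.
move=> mA; have mA' := measurableC mA.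
apply/cLp_eqP; apply: filterS3 (cLp_funD (restr A u) (restr (~` A) u))
  (restrE u mA) (restrE u mA') => x -> -> ->.
by rewrite -mulrDl -raddfD/= !indicE in_setC; case: (x \in A) => /=;
  rewrite ?addr0 ?add0r mul1r.
Qed.

Lemma cLp_posD u v : cLp_pos u -> cLp_pos v -> cLp_pos (u + v).
Proof.
by move=> u0 v0; apply: filterS3 (cLp_funD u v) u0 v0 => x ->; exact: addr_ge0.
Qed.

Lemma cLp_posZ (a : R) u : 0 <= a -> cLp_pos u -> cLp_pos (a%:C *: u).
Proof.
move=> a0 u0; apply: filterS2 (cLp_funZ a%:C u) u0 => x -> ?.
by rewrite mulr_ge0// lecR.
Qed.

Lemma cLp_pos0 : cLp_pos (0 : E).
Proof. by apply: filterS (cLp_fun0 mu p1) => x ->. Qed.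

End restriction.

(** * Power inequalities *)

Section power_inequalities.
Context {R : realType}.
Implicit Types (r s t e : R).

(** Strict superadditivity, from u^r = u u^(r-1) and monotonicity of the second
    factor. *)
Lemma ltr_powRD r s t : 1 < r -> 0 < s -> 0 < t ->
  s `^ r + t `^ r < (s + t) `^ r.
Proof.
move=> r1 s0 t0; have r0 : 0 < r by exact: lt_trans r1.
rewrite -(mulr_powRB1 (ltW s0) r0) -(mulr_powRB1 (ltW t0) r0).
rewrite -(mulr_powRB1 (ltW (addr_gt0 s0 t0)) r0) mulrDl.
apply: ltrD; rewrite ltr_pM2l// gt0_ltr_powR ?subr_gt0 ?nnegrE//;
  rewrite ?ltrDl ?ltrDr ?addr_ge0 ?ltW//.
Qed.

(** Strict convexity of the r-th power: the derivative
    r (x+1)^(r-1) - r x^(r-1) of the difference is positive. *)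
Lemma ltr_powR_diff r s t : 1 < r -> 0 <= s -> s < t ->
  (s + 1) `^ r - s `^ r < (t + 1) `^ r - t `^ r.
Proof.
move=> r1; have r0 : 0 < r by exact: lt_trans r1.
rewrite le_eqVlt => /predU1P[<- t0|s0 st].
  rewrite add0r powR1 powR0 ?gt_eqF// subr0.
  by have := ltr_powRD r1 t0 ltr01; rewrite powR1; lra.
pose f (x : R) := (x + 1) `^ r - x `^ r.
pose f' (x : R) := r * (x + 1) `^ (r - 1) - r * x `^ (r - 1).
have df (x : R) : 0 < x -> is_derive x 1 f (f' x).
  move=> x0; rewrite /f /f'.
  apply: is_deriveB.
  have x10 : 0 < x + 1 by rewrite addr_gt0.
  have h : is_derive x 1 (fun y : R => y + 1) 1.
    by apply: is_derive_eq; rewrite addr0.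
  have := @is_derive1_comp R (fun y => y `^ r) _ x _ _ (is_derive1_powR r x10) h.
  by rewrite mulr1.
  exact: is_derive1_powR.
apply: (@gtr0_derive1_lt_cc _ f s t) => //.
- move=> x; rewrite in_itv/= => /andP[sx _].
  by have [] := df x (lt_trans s0 sx).
- move=> x; rewrite in_itv/= => /andP[sx _].
  have x0 := lt_trans s0 sx.
  rewrite derive1E; have [_ ->] := df x x0.
  rewrite /f' subr_gt0 ltr_pM2l// gt0_ltr_powR ?subr_gt0 ?nnegrE ?ltrDl//.
  + exact: ltW.
  + by rewrite addr_ge0// ltW.
- apply: derivable_within_continuous => x; rewrite in_itv/= => /andP[sx _].
  by have [] := df x (lt_le_trans s0 sx).
- by rewrite in_itv/= lexx ltW.
- by rewrite in_itv/= lexx ltW.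
Qed.

(** The two ways of combining vectors whose norms determine the order: differences
    for every exponent, sums for exponents greater than 1.  For e = 1 and r = 1
    the norm is additive on the cone and carries no information. *)
Definition good_sign r e := (e = -1 /\ 1 <= r) \/ (e = 1 /\ 1 < r).

Lemma good_sign_facts r e : good_sign r e -> 1 <= r /\ e * e = 1 /\ (`|e| = 1).
Proof.
by move=> [[-> r1]|[-> r1]]; split; rewrite ?(ltW r1)// ?normrN1 ?normr1; split => //; ring.
Qed.

(** The sign e is chosen so that |s + e t|^r lies strictly on one fixed side of
    s^r + t^r unless one of the two numbers vanishes; integrated, this
    recognizes disjoint supports from norms. *)
Lemma sign_power_gap r e s t : good_sign r e -> 0 <= s -> 0 <= t ->
  0 <= e * (`|s + e * t| `^ r - (s `^ r + t `^ r)) ?= iff ((s == 0) || (t == 0)).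
Proof.
move=> er; have [r1 [ee ne]] := good_sign_facts er.
have r0 : 0 < r by exact: lt_le_trans r1.
rewrite le_eqVlt => /predU1P[<- t0|s0].
  rewrite eqxx [0 + e * t]add0r normrM ne mul1r ger0_norm// powR0 ?(gt_eqF r0)//.
  by rewrite [0 + _]add0r subrr mulr0; exact/leif_refl.
rewrite le_eqVlt => /predU1P[<-|t0].
  rewrite eqxx orbT mulr0 addr0 ger0_norm ?(ltW s0)// powR0 ?(gt_eqF r0)// addr0 subrr.
  by rewrite mulr0; exact/leif_refl.
rewrite !gt_eqF//=.
suff h : 0 < e * (`|s + e * t| `^ r - (s `^ r + t `^ r)).
  by split; [exact: ltW|rewrite lt_eqF].
case: er => [[-> _]|[-> {}r1]]; last first.
  rewrite !mul1r ger0_norm ?addr_ge0 ?ltW// subr_gt0; exact: ltr_powRD.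
rewrite !mulN1r opprB subr_gt0.
wlog st : s t s0 t0 / t <= s.
  move=> H; have [ts|st] := leP t s; first exact: H.
  by rewrite distrC [X in _ < X]addrC; apply: H => //; exact: ltW.
rewrite ger0_norm ?subr_ge0//.
apply: (@lt_trans _ _ (s `^ r)); last by rewrite ltrDl powR_gt0.
apply: gt0_ltr_powR => //; rewrite ?nnegrE ?subr_ge0// ?ltW//.
by rewrite gtrDl oppr_lt0.
Qed.

(** The gap |s + e|^r - s^r is strictly monotone in s, increasing for e = 1
    (convexity) and decreasing for e = -1; multiplying by e makes both cases
    increasing, so that s can be recovered from its gap. *)
Lemma sign_power_mono r e s t : good_sign r e -> 0 <= s <= 1 -> 0 <= t <= 1 ->
  e * (`|s + e| `^ r - s `^ r) <= e * (`|t + e| `^ r - t `^ r) -> s <= t.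
Proof.
move=> er /andP[s0 s1] /andP[t0 t1]; apply: contraTT; rewrite -!ltNge => ts.
case: er => [[-> r1]|[-> r1]]; last first.
  rewrite !mul1r !ger0_norm ?addr_ge0//; exact: ltr_powR_diff.
have r0 : 0 < r by exact: lt_le_trans r1.
have h (x : R) : x <= 1 -> `|x - 1| = 1 - x.
  by move=> x1; rewrite distrC ger0_norm// subr_ge0.
rewrite !mulN1r ltrN2 !h//; apply: ler_ltD.
  by rewrite ge0_ler_powR ?(ltW r0)// ?nnegrE ?subr_ge0// lerB// ltW.
by rewrite ltrN2; apply: gt0_ltr_powR.
Qed.

End power_inequalities.

(** * The p-th power mass of a function over a set *)

Section mass.
Context d (T : measurableType d) (R : realType).
Variable mu : {measure set T -> \bar R}.
Variables (r : R) (p1 : (1 <= r%:E)%E).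
Local Notation E := (cLp mu p1).
Implicit Types (u v : E) (A B : set T).

Local Notation mass := (mass mu r).

Let r1 : 1 <= r. Proof. by rewrite -lee_fin. Qed.
Let r0 : 0 < r. Proof. exact: lt_le_trans r1. Qed.

Lemma measurable_npow u A : measurable_fun A (fun x => (normc (u x) `^ r)%:E).
Proof.
apply: measurable_funTS.
apply/measurable_EFinP.
apply: (@measurableT_comp _ _ _ _ _ _ (@powR R ^~ r)) => //.
exact: measurable_normu.
Qed.

Lemma int_npow u :
  (\int[mu]_x (normc (u x) `^ r)%:E = (cLp_norm u `^ r)%:E)%E.
Proof.
rewrite -poweR_EFin -(cLp_norm_fin u) poweR_Lnorm; last by rewrite gt_eqF.
apply: eq_integral => x _ /=.
by rewrite ger0_norm ?normc_ge0.
Qed.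

Lemma massE u A : measurable A ->
  (\int[mu]_(x in A) (normc (u x) `^ r)%:E)%E = (mass u A)%:E.
Proof.
move=> mA; rewrite mass.unlock fineK//.
have i0 : (0 <= \int[mu]_(x in A) (normc (u x) `^ r)%:E)%E.
  by apply: integral_ge0 => x _; rewrite lee_fin powR_ge0.
rewrite ge0_fin_numE//; apply: (@le_lt_trans _ _ (\int[mu]_x (normc (u x) `^ r)%:E)%E).
  apply: ge0_subset_integral => //; first exact: measurable_npow.
  by move=> x _; rewrite lee_fin powR_ge0.
by rewrite int_npow ltry.
Qed.

Lemma massT u : mass u setT = cLp_norm u `^ r.
Proof. by apply: EFin_inj; rewrite -(massE u measurableT) int_npow. Qed.

Lemma mass_ge0 u A : 0 <= mass u A.
Proof.
by rewrite unlock; apply: fine_ge0; apply: integral_ge0 => x _; rewrite lee_fin powR_ge0.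
Qed.

Lemma mass_setC u A : measurable A -> mass u A + mass u (~` A) = mass u setT.
Proof.
move=> mA; apply: EFin_inj; rewrite EFinD -(massE u mA) -(massE u (measurableC mA)) -(massE u measurableT).
rewrite -ge0_integral_setU//; first by rewrite setUv.
- exact: measurableC.
- by rewrite setUv; exact: measurable_npow.
- by move=> x _; rewrite lee_fin powR_ge0.
- exact/disj_setPCl.
Qed.

Lemma le_mass u v A : measurable A ->
  {ae mu, forall x, A x -> normc (u x) <= normc (v x)} -> mass u A <= mass v A.
Proof.
move=> mA uv; rewrite -lee_fin -(massE u mA) -(massE v mA); apply: ae_ge0_le_integral => //.
- by move=> x _; rewrite lee_fin powR_ge0.
- exact: measurable_npow.
- by move=> x _; rewrite lee_fin powR_ge0.
- exact: measurable_npow.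
- apply: filterS uv => x h /h ?.
  by rewrite lee_fin ge0_ler_powR ?(ltW r0)// nnegrE normc_ge0.
Qed.

(** Homogeneity, in the form needed later: only the moduli matter, only on the
    set, and only almost everywhere. *)
Lemma mass_scale (c : R) u v A : measurable A -> 0 <= c ->
  {ae mu, forall x, A x -> normc (v x) = c * normc (u x)} ->
  mass v A = c `^ r * mass u A.
Proof.
move=> mA c0 uv; apply: EFin_inj; rewrite EFinM -(massE u mA) -(massE v mA).
rewrite -ge0_integralZl//; last 3 first.
- exact: measurable_npow.
- by move=> x _; rewrite lee_fin powR_ge0.
- by rewrite lee_fin powR_ge0.
apply: ge0_ae_eq_integral => //.
- exact: measurable_npow.
- by apply: measurable_funeM; exact: measurable_npow.
- by move=> x _; rewrite lee_fin powR_ge0.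
- by move=> x _; rewrite mule_ge0// lee_fin powR_ge0.
- apply: filterS uv => x h /h ->.
  by rewrite powRM ?normc_ge0.
Qed.

Lemma eq_mass u v A : measurable A ->
  {ae mu, forall x, A x -> normc (v x) = normc (u x)} -> mass v A = mass u A.
Proof.
move=> mA uv; rewrite (@mass_scale 1 u v)// ?powR1 ?mul1r//.
by apply: filterS uv => x h /h ->; rewrite mul1r.
Qed.

Lemma mass_eq0 u A : measurable A ->
  mass u A = 0 <-> {ae mu, forall x, A x -> u x = 0}.
Proof.
move=> mA; have mn : measurable_fun A (fun x => (normc (u x) `^ r)%:E).
  exact: measurable_npow.
split=> [u0|u0].
  have : (\int[mu]_(x in A) `|(normc (u x) `^ r)%:E|)%E = 0%E.
    under eq_integral do rewrite gee0_abs ?lee_fin ?powR_ge0//.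
    by rewrite massE// u0.
  move/(ae_eq_integral_abs mu mA mn); apply: filterS => x h /h [] /powR_eq0_eq0.
  exact: eq0_normc.
rewrite (@mass_scale 0 u u)// ?powR0 ?gt_eqF ?mul0r//.
by apply: filterS u0 => x h /h ->; rewrite normc0 mulr0.
Qed.

Lemma mass_restr u A : measurable A -> mass (restr A u) setT = mass u A.
Proof.
move=> mA; rewrite -(mass_setC _ mA).
have -> : mass (restr A u) (~` A) = 0.
  by apply/mass_eq0; [exact: measurableC|exact: restr_out].
rewrite addr0; apply: eq_mass => //.
by apply: filterS (restr_in u mA) => x h /h ->.
Qed.

End mass.

Lemma realC_eq0 (R : realType) (x : R) : (x%:C == 0 :> R[i]) = (x == 0).
Proof. by rewrite eq_complex/= eqxx andbT. Qed.

Section measurable_sets.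
Context d (T : measurableType d) (R : realType).

Lemma measurable_ltset (g h : T -> R) : measurable_fun setT g ->
  measurable_fun setT h -> measurable [set x | g x < h x].
Proof.
move=> mg mh.
have -> : [set x | g x < h x] = setT `&` (h \- g) @^-1` `]0, +oo[.
  by apply/seteqP; split=> x /=; rewrite in_itv/= andbT subr_gt0; [move=>?; split|case].
by apply: (measurable_funB mh mg) => //; exact: measurable_itv.
Qed.

Lemma measurable_neset (g h : T -> R) : measurable_fun setT g ->
  measurable_fun setT h -> measurable [set x | g x != h x].
Proof.
move=> mg mh.
have -> : [set x | g x != h x] = [set x | g x < h x] `|` [set x | h x < g x].
  by apply/seteqP; split=> x /=; rewrite neq_lt => /orP.
by apply: measurableU; exact: measurable_ltset.
Qed.

End measurable_sets.

(** * Positive unit sphere and supports *)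

Section positive_unit_sphere.
Context d (T : measurableType d) (R : realType).
Variable mu : {measure set T -> \bar R}.
Hypothesis mu_fin : mu setT \is a fin_num.
Variables (p : \bar R) (p1 : (1 <= p)%E).
Local Notation E := (cLp mu p1).
Implicit Types (u v : E) (A : set T).

Definition pos_unit u := cLp_pos u /\ cLp_norm u = 1.

Definition supp u : set T := [set x | normc (u x) != 0].

Lemma suppP u x : supp u x <-> u x <> 0.
Proof.
rewrite /supp/=; split => [/eqP n0 u0|u0]; first by apply: n0; rewrite u0 normc0.
by apply/eqP => /eq0_normc.
Qed.

Lemma suppNP u x : ~ supp u x <-> u x = 0.
Proof.
split; first by move=> h; apply: contrapT => /suppP.
by move=> u0 /suppP.
Qed.

Lemma measurable_supp u : measurable (supp u).
Proof. by apply: measurable_neset => //; exact: measurable_normu. Qed.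

Lemma pos_unit_scale u : cLp_pos u -> u <> 0 ->
  pos_unit ((cLp_norm u)^-1%:C *: u).
Proof.
move=> u0 un0; have n0 : 0 <= cLp_norm u := cLp_norm_ge0 u.
split; first by apply: cLp_posZ => //; rewrite invr_ge0.
rewrite cLp_normZ normc_real ger0_norm ?invr_ge0// mulVf//.
by apply/eqP => /cLp_norm_eq0.
Qed.

Lemma inLp_bounded (f : T -> R[i]) (C : R) : cmeasurable f ->
  (forall x, normc (f x) <= C) -> inLp mu p f.
Proof.
move=> mf fC; split => //.
have mn := measurable_normc mf.
have : normc \o f \in Lfun mu p.
  apply: (Lfun_subset p1 _ mu_fin _); first exact: leey.
    exact: leey.
  apply/andP; split; rewrite inE//= /finite_norm unlock.
  case: ifPn => // mu0; apply: (@le_lt_trans _ _ C%:E); last exact: ltry.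
  apply/ess_supP; apply: aeW => x /=.
  by rewrite lee_fin ger0_norm ?normc_ge0.
by rewrite inE => /andP[_]; rewrite inE.
Qed.

Definition charLp A : E := toLp mu p1 (fun x => (\1_A x)%:C).

Lemma charLpE A : measurable A -> {ae mu, forall x, charLp A x = (\1_A x)%:C}.
Proof.
move=> mA; apply: toLpE; apply: (@inLp_bounded _ 1).
  by apply: cmeasurable_real; exact: measurable_indic.
by move=> x; rewrite normc_real indicE; case: (_ \in _); rewrite ?normr1 ?normr0.
Qed.

Lemma charLp_pos A : measurable A -> cLp_pos (charLp A).
Proof.
move=> mA; apply: filterS (charLpE mA) => x ->.
by rewrite lecR indicE.
Qed.

Lemma charLp_neq0 A : measurable A -> ~ {ae mu, forall x, ~ A x} ->
  charLp A <> 0.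
Proof.
move=> mA A0 /cLp_eqP c0; apply: A0.
apply: filterS3 c0 (charLpE mA) (cLp_fun0 mu p1) => x -> -> /eqP.
by rewrite indicE; case: (boolP (x \in A)) => [_|]; [rewrite oner_eq0|rewrite notin_setE].
Qed.

(** Every non-null set is the support of some element of the sphere, namely its
    normalized indicator; finiteness of the measure makes the indicator
    integrable. *)
Lemma unit_with_supp A : measurable A -> ~ {ae mu, forall x, ~ A x} ->
  exists2 u, pos_unit u & {ae mu, forall x, u x = 0 <-> ~ A x}.
Proof.
move=> mA A0; have c0 := charLp_neq0 mA A0.
exists ((cLp_norm (charLp A))^-1%:C *: charLp A).
  by apply: pos_unit_scale => //; exact: charLp_pos.
apply: filterS2 (cLp_funZ (cLp_norm (charLp A))^-1%:C (charLp A))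
  (charLpE mA) => x -> ->.
rewrite indicE; case: (boolP (x \in A)); rewrite ?notin_setE ?inE => Ax.
  rewrite mulr1; split => // /eqP.
  rewrite realC_eq0 invr_eq0 => /eqP /cLp_norm_eq0.
  by move/c0.
by rewrite mulr0.
Qed.

End positive_unit_sphere.

Section orthogonality.
Context d (T : measurableType d) (R : realType).
Variable mu : {measure set T -> \bar R}.
Variables (r : R) (p1 : (1 <= r%:E)%E).
Local Notation E := (cLp mu p1).
Implicit Types (u v : E) (A : set T).

Let r1 : 1 <= r. Proof. by rewrite -lee_fin. Qed.
Let r0 : 0 < r. Proof. exact: lt_le_trans r1. Qed.

Definition orthoLp u v := {ae mu, forall x, u x = 0 \/ v x = 0}.

Lemma integrable_npow u A : measurable A ->
  mu.-integrable A (fun x => (normc (u x) `^ r)%:E).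
Proof.
move=> mA; apply/integrableP; split; first exact: measurable_npow.
under eq_integral do rewrite gee0_abs ?lee_fin ?powR_ge0//.
by rewrite massE// ltry.
Qed.

(** Disjointness of supports is visible in the norm: the integrand
    e (|u + e v|^r - |u|^r - |v|^r) has constant sign and vanishes exactly
    where u or v does, and its integral is e (|u + e v|^r - 2). *)
Lemma ortho_norm e u v : good_sign r e -> pos_unit u -> pos_unit v ->
  cLp_norm (u + e%:C *: v) `^ r = 2 <-> orthoLp u v.
Proof.
move=> er [u0 nu] [v0 nv].
pose w : E := u + e%:C *: v.
pose h x := e * (normc (w x) `^ r - (normc (u x) `^ r + normc (v x) `^ r)).
have hP : {ae mu, forall x, 0 <= h x ?= iff ((u x == 0) || (v x == 0))}.
  apply: filterS3 (cLp_funD u (e%:C *: v)) (cLp_funZ e%:C v)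
    (filterI u0 v0) => x ew ev [ux vx].
  rewrite /h /w ew ev.
  have Eu := cge0E ux; have Ev := cge0E vx.
  set a := complex.Re (u x) in Eu *; set b := complex.Re (v x) in Ev *.
  have a0 : 0 <= a by move: ux; rewrite cge0P => /andP[].
  have b0 : 0 <= b by move: vx; rewrite cge0P => /andP[].
  rewrite Eu Ev -rmorphM -rmorphD !normc_real (ger0_norm a0) (ger0_norm b0).
  rewrite !realC_eq0.
  exact: sign_power_gap.
have mh : measurable_fun setT (fun x => (h x)%:E).
  have mm z : measurable_fun setT (fun x => normc ((z : E) x) `^ r).
    by apply/measurable_EFinP; exact: measurable_npow.
  apply/measurable_EFinP; apply: measurable_funM => //.
  by apply: measurable_funB => //; apply: measurable_funD.
have ih : (\int[mu]_x (h x)%:E = (e * (cLp_norm w `^ r - 2))%:E)%E.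
  have i1 := integrable_npow u measurableT.
  have i2 := integrable_npow v measurableT.
  have i3 := integrable_npow w measurableT.
  have i4 : mu.-integrable setT (fun x => (normc (u x) `^ r + normc (v x) `^ r)%:E).
    exact: integrableD_EFin i1 i2.
  have i5 := integrableB_EFin i3 i4.
  under eq_integral do rewrite EFinM.
  rewrite (integralZl measurableT i5).
  under eq_integral do rewrite EFinB.
  rewrite integralB_EFin//.
  under [X in (_ * (_ - X))%E]eq_integral do rewrite EFinD.
  rewrite integralD_EFin//.
  by rewrite !int_npow nu nv powR1.
have hle0 : {ae mu, forall x, 0 <= h x} by apply: filterS hP => x [].
have h0 : (\int[mu]_x `|(h x)%:E| = 0)%E <-> cLp_norm w `^ r = 2.
  have -> : (\int[mu]_x `|(h x)%:E| = \int[mu]_x (h x)%:E)%E.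
    apply: ae_eq_integral => //; first exact: measurableT_comp.
    by apply: filterS hle0 => x hx _ /=; rewrite ger0_norm.
  rewrite ih; have [_ [ee _]] := good_sign_facts er.
  split; last by move=> ->; rewrite subrr mulr0.
  move=> []/(congr1 (fun z => e * z)); rewrite mulrA ee mul1r mulr0 => /eqP.
  by rewrite subr_eq0 => /eqP.
rewrite -/w -h0 (ae_eq_integral_abs mu measurableT mh); split.
  move=> hh; apply: filterS2 hP hh => x [_ e1] /(_ Logic.I) [] e2.
  by move: e1; rewrite e2 eqxx => /esym/orP[/eqP|/eqP]; [left|right].
move=> uv; apply: filterS2 hP uv => x [_ e1] uv _.
congr EFin; apply/esym/eqP; rewrite e1.
by case: uv => ->; rewrite eqxx// orbT.
Qed.

(** The difference of the r-th powers is nonnegative with integral zero. *)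
Lemma le_mass_eq u v A : measurable A ->
  {ae mu, forall x, A x -> normc (u x) <= normc (v x)} ->
  mass mu r v A <= mass mu r u A ->
  {ae mu, forall x, A x -> normc (u x) = normc (v x)}.
Proof.
move=> mA uv vu.
have i1 := integrable_npow u mA; have i2 := integrable_npow v mA.
pose h x := normc (v x) `^ r - normc (u x) `^ r.
have mh : measurable_fun A (fun x => (h x)%:E).
  apply/measurable_EFinP; apply: measurable_funB; apply/measurable_EFinP;
    exact: measurable_npow.
have h0 : {ae mu, forall x, A x -> 0 <= h x}.
  apply: filterS uv => x + Ax => /(_ Ax) uvx.
  by rewrite subr_ge0 ge0_ler_powR ?(ltW r0)// nnegrE normc_ge0.
have : (\int[mu]_(x in A) `|(h x)%:E| = 0)%E.
  have -> : (\int[mu]_(x in A) `|(h x)%:E| = \int[mu]_(x in A) (h x)%:E)%E.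
    apply: ae_eq_integral => //; first exact: measurableT_comp.
    by apply: filterS h0 => x hx Ax /=; rewrite ger0_norm// hx.
  under eq_integral do rewrite EFinB.
  rewrite integralB_EFin// !massE// -EFinB; congr EFin.
  by apply/eqP; rewrite subr_eq0 eq_le vu/= le_mass.
move/(ae_eq_integral_abs mu mA mh); apply: filterS => x hx Ax.
have [/eqP] := hx Ax; rewrite subr_eq0 => /eqP.
by move/(powR_injective r0); rewrite !nnegrE !normc_ge0 => ->.
Qed.

End orthogonality.

(** * Norm-preserving correspondences between positive spheres *)

Section correspondences.
Context d1 (T1 : measurableType d1) d2 (T2 : measurableType d2) (R : realType).
Variables (mu1 : {measure set T1 -> \bar R}) (mu2 : {measure set T2 -> \bar R}).
Variables (p : \bar R) (p1 : (1 <= p)%E).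
Local Notation E1 := (cLp mu1 p1).
Local Notation E2 := (cLp mu2 p1).
Implicit Types (M : E1 -> E2 -> Prop) (A : set T1) (B : set T2).

(** A relation rather than a map, so that a sphere map and its inverse are
    treated by the same lemmas (after swapping the arguments). *)
Definition sphere_corr M := [/\
  forall x y, M x y -> pos_unit x /\ pos_unit y,
  forall x, pos_unit x -> exists y, M x y &
  forall y, pos_unit y -> exists x, M x y].

Definition norm_corr e M := forall x y x' y', M x y -> M x' y' ->
  cLp_norm (x + e%:C *: x') = cLp_norm (y + e%:C *: y').

Definition below1 (a : R) (f g : E1) A :=
  {ae mu1, forall x, A x -> a * complex.Re (f x) <= complex.Re (g x)}.
Definition below2 (a : R) (f g : E2) B :=
  {ae mu2, forall x, B x -> a * complex.Re (f x) <= complex.Re (g x)}.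

(** The sets [A] and [B] correspond to each other as far as order relations
    between multiples of related elements are concerned.  Scaling f by a is
    needed since all elements have norm 1. *)
Definition order_match M A B := forall f F g G (a : R), M f F -> M g G ->
  0 <= a -> below1 a f g A <-> below2 a F G B.

End correspondences.

Section swap.
Context d1 (T1 : measurableType d1) d2 (T2 : measurableType d2) (R : realType).
Variables (mu1 : {measure set T1 -> \bar R}) (mu2 : {measure set T2 -> \bar R}).
Variables (p : \bar R) (p1 : (1 <= p)%E).
Variable M : cLp mu1 p1 -> cLp mu2 p1 -> Prop.

Lemma sphere_corr_swap : sphere_corr M -> sphere_corr (fun y x => M x y).
Proof. by case=> h1 h2 h3; split=> // x y /h1[]. Qed.

Lemma norm_corr_swap e : norm_corr e M -> norm_corr e (fun y x => M x y).
Proof. by move=> h x y x' y' m m'; rewrite (h _ _ _ _ m m'). Qed.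

End swap.

(** * Order relations for a finite exponent *)

Section finite_exponent_half.
Context d1 (T1 : measurableType d1) d2 (T2 : measurableType d2) (R : realType).
Variables (mu1 : {measure set T1 -> \bar R}) (mu2 : {measure set T2 -> \bar R}).
Hypotheses (fin1 : mu1 setT \is a fin_num) (fin2 : mu2 setT \is a fin_num).
Variables (r : R) (p1 : (1 <= r%:E)%E) (e : R) (er : good_sign r e).
Local Notation E1 := (cLp mu1 p1).
Local Notation E2 := (cLp mu2 p1).
Variable M : E1 -> E2 -> Prop.
Hypotheses (cM : sphere_corr M) (nM : norm_corr e M).

Let r1 : 1 <= r. Proof. by rewrite -lee_fin. Qed.
Let r0 : 0 < r. Proof. exact: lt_le_trans r1. Qed.

Let Mdom x y : M x y -> pos_unit x /\ pos_unit y.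
Proof. by have [+ _ _] := cM; exact. Qed.
Let Mtot x : pos_unit x -> exists y, M x y.
Proof. by have [_ + _] := cM; exact. Qed.
Let Msurj y : pos_unit y -> exists x, M x y.
Proof. by have [_ _ +] := cM; exact. Qed.

Lemma corr_ortho x y x' y' : M x y -> M x' y' -> orthoLp x x' <-> orthoLp y y'.
Proof.
move=> m m'; have [px py] := Mdom m; have [px' py'] := Mdom m'.
by rewrite -(ortho_norm er px px') -(ortho_norm er py py') (nM m m').
Qed.

(** Inclusion of supports is expressible by disjointness: v vanishes where u does
    iff every w disjoint from u is disjoint from v.  If V were nonzero on a
    non-null part Z of the zero set of U, the element z supported by Z would
    be disjoint from U but not from V. *)
Lemma corr_supp u U v V : M u U -> M v V ->
  {ae mu1, forall x, u x = 0 -> v x = 0} ->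
  {ae mu2, forall x, U x = 0 -> V x = 0}.
Proof.
move=> mu mv uv; pose Z := ~` supp U `&` supp V.
have mZ : measurable Z.
  by apply: measurableI; [apply: measurableC|]; exact: measurable_supp.
have [Z0|Z0] := pselect {ae mu2, forall x, ~ Z x}.
  apply: filterS Z0 => x Zx Ux; apply: contrapT => Vx; apply: Zx.
  by split; [exact/suppNP|exact/suppP].
have [z pz zZ] := unit_with_supp fin2 p1 mZ Z0.
have [w mw] := Msurj pz.
have zU : orthoLp z U.
  apply: filterS zZ => x [_ zx]; have [Ux|/suppP Ux] := pselect (U x = 0).
    by right.
  by left; apply: zx => -[].
have wu := (corr_ortho mw mu).2 zU.
have wv : orthoLp w v.
  by apply: filterS2 wu uv => x [|] h h'; [left|right; exact: h'].
have zV := (corr_ortho mw mv).1 wv.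
exfalso; apply: Z0; apply: filterS2 zV zZ => x h1 [h2 _] Zx.
case: h1 => [/h2//|]; by case: Zx => _ /suppP.
Qed.

(** The norms of f + e u and F + e U are equal.  Here u is the normalized
    restriction of f to A, so the first norm is explicit, |a + e|^r + 1 - a^r
    with a^r the mass of f over A.  The second is the norm of the restriction
    of F to B plus e U, corrected by the mass outside B; the triangle
    inequality compares it with |h + e|^r + 1 - h^r, h^r being the mass of F
    over B.  Monotonicity of the gap gives a <= h. *)
Lemma mass_le_image f F u U A B (a : R) : measurable A -> measurable B ->
  M f F -> M u U -> 0 < a -> a `^ r = mass mu1 r f A ->
  {ae mu1, forall x, A x -> u x = a^-1%:C * f x} ->
  {ae mu1, forall x, ~ A x -> u x = 0} ->
  {ae mu2, forall x, ~ B x -> U x = 0} ->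
  mass mu1 r f A <= mass mu2 r F B.
Proof.
move=> mA mB mf mu a0 aA uA uA' UB.
have [[f0 nf] [F0 nF]] := Mdom mf; have [[u0 nu] [U0 nU]] := Mdom mu.
have [_ [ee ne]] := good_sign_facts er.
have mA' := measurableC mA; have mB' := measurableC mB.
have totf : mass mu1 r f A + mass mu1 r f (~` A) = 1.
  by rewrite mass_setC// massT nf powR1.
have totF : mass mu2 r F B + mass mu2 r F (~` B) = 1.
  by rewrite mass_setC// massT nF powR1.
have L : cLp_norm (f + e%:C *: u) `^ r = `|a + e| `^ r + (1 - a `^ r).
  rewrite -massT -(mass_setC _ mA); congr (_ + _).
    rewrite (@mass_scale _ _ _ mu1 r p1 `|1 + e / a| f)//; last first.
      apply: filterS3 (cLp_funD f (e%:C *: u)) (cLp_funZ e%:C u) uA =>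
        x -> -> h Ax.
      rewrite h// mulrA -rmorphM -[X in X + _]mul1r -mulrDl normcM.
      by rewrite -[1]/(1%:C) -rmorphD normc_real.
    rewrite -aA -powRM ?(ltW a0)//; congr (_ `^ _).
    rewrite -[X in _ * X](ger0_norm (ltW a0)) -normrM mulrDl mul1r -mulrA.
    by rewrite mulVf ?gt_eqF// mulr1.
  rewrite aA -totf addrAC subrr add0r; apply: eq_mass => //.
  apply: filterS3 (cLp_funD f (e%:C *: u)) (cLp_funZ e%:C u) uA' =>
    x -> -> h Ax.
  by rewrite h// mulr0 addr0.
pose h := cLp_norm (restr B F).
have hB : h `^ r = mass mu2 r F B by rewrite -massT mass_restr.
have h0 : 0 <= h := cLp_norm_ge0 _.
have RR : cLp_norm (F + e%:C *: U) `^ r =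
    cLp_norm (restr B F + e%:C *: U) `^ r + (1 - h `^ r).
  rewrite -massT -(mass_setC _ mB); congr (_ + _).
    rewrite -massT -(mass_setC (restr B F + e%:C *: U) mB).
    rewrite [X in _ = _ + X](_ : _ = 0) ?addr0; last first.
      apply/mass_eq0 => //.
      apply: filterS3 (cLp_funD (restr B F) (e%:C *: U))
        (filterI (cLp_funZ e%:C U) UB) (restr_out F mB) => x -> [-> h1] h2 Bx.
      by rewrite h1// h2// mulr0 addr0.
    apply: eq_mass => //.
    apply: filterS3 (cLp_funD (restr B F) (e%:C *: U))
        (cLp_funD F (e%:C *: U)) (restr_in F mB) => x -> -> h2 Bx.
    by rewrite h2.
  rewrite hB -totF addrAC subrr add0r; apply: eq_mass => //.
  apply: filterS3 (cLp_funD F (e%:C *: U)) (cLp_funZ e%:C U) UB => x -> -> h1 Bx.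
  by rewrite h1// mulr0 addr0.
have tri : e * cLp_norm (restr B F + e%:C *: U) `^ r <= e * `|h + e| `^ r.
  case: er => [[-> _]|[-> _]].
    rewrite !mulN1r lerN2 ge0_ler_powR ?(ltW r0) ?nnegrE ?cLp_norm_ge0//.
    rewrite rmorphN1 scaleN1r ler_norml; apply/andP; split.
      rewrite lerNl opprB lerBlDr -nU -[leLHS]cLp_normN.
      have {1}-> : - U = (restr B F - U) - restr B F by rewrite addrAC subrr add0r.
      by rewrite (le_trans (ler_cLp_normD _ _))// cLp_normN.
    rewrite lerBlDr -nU.
    have {1}-> : h = cLp_norm ((restr B F - U) + U) by rewrite subrK.
    exact: ler_cLp_normD.
  rewrite !mul1r ge0_ler_powR ?(ltW r0) ?nnegrE ?cLp_norm_ge0//.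
  rewrite rmorph1 scale1r (ger0_norm (addr_ge0 h0 ler01)) -nU.
  exact: ler_cLp_normD.
rewrite -aA -hB ge0_ler_powR ?(ltW r0) ?nnegrE ?(ltW a0)//.
have le1 (x y : R) : 0 <= x -> x `^ r + y = 1 -> 0 <= y -> 0 <= x <= 1.
  move=> x0 xy y0; rewrite x0/= leNgt; apply/negP => x1.
  have := gt0_ltr_powR r0; move=> /(_ 1 x); rewrite !nnegrE ler01 x0 powR1.
  by move=> /(_ isT isT x1); rewrite -xy ltNge lerDl y0.
apply: (sign_power_mono er).
- by apply: (le1 _ (mass mu1 r f (~` A))); rewrite ?(ltW a0)// ?aA// mass_ge0.
- by apply: (le1 _ (mass mu2 r F (~` B))) => //; rewrite ?hB// mass_ge0.
have := nM mf mu => /(congr1 (fun x => x `^ r)); rewrite L RR => LR.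
have -> : `|a + e| `^ r - a `^ r =
  cLp_norm (restr B F + e%:C *: U) `^ r - h `^ r by move: LR; lra.
by rewrite !mulrBr lerB.
Qed.

(** The mass of f over a support is at most the mass of F over the matching
    support, and the same holds for the complements; both sums of masses are
    1, so equality holds. *)
Lemma corr_mass f F u U : M f F -> M u U ->
  mass mu1 r f (supp u) = mass mu2 r F (supp U).
Proof.
move=> mf mu; have [[f0 nf] [F0 nF]] := Mdom mf.
have half A B : measurable A -> measurable B ->
    (forall v V, M v V -> {ae mu1, forall x, ~ A x -> v x = 0} ->
      {ae mu2, forall x, ~ B x -> V x = 0}) ->
    mass mu1 r f A <= mass mu2 r F B.
  move=> mA mB AB.
  have [fA|/eqP fA] := eqVneq (restr A f) 0.
    rewrite (_ : mass mu1 r f A = 0) ?mass_ge0//.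
    by rewrite -mass_restr// fA massT cLp_norm0 powR0// gt_eqF.
  have pv := pos_unit_scale (restr_ge0 mA f0) fA.
  have [V mV] := Mtot pv.
  have a0 : 0 < cLp_norm (restr A f).
    by rewrite lt_neqAle cLp_norm_ge0 andbT eq_sym; apply/eqP => /cLp_norm_eq0.
  have out : {ae mu1, forall x, ~ A x ->
      ((cLp_norm (restr A f))^-1%:C *: restr A f : E1) x = 0}.
    apply: filterS2 (cLp_funZ (cLp_norm (restr A f))^-1%:C (restr A f))
      (restr_out f mA) => x -> h Ax.
    by rewrite h// mulr0.
  apply: (mass_le_image mA mB mf mV a0) => //.
  - by rewrite -massT mass_restr.
  - apply: filterS2 (cLp_funZ (cLp_norm (restr A f))^-1%:C (restr A f))
      (restr_in f mA) => x -> h Ax.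
    by rewrite h.
  - exact: AB mV out.
have mu0 := measurable_supp u; have mU := measurable_supp U.
have h1 : mass mu1 r f (supp u) <= mass mu2 r F (supp U).
  apply: half => // v V mv vu.
  have := corr_supp mu mv; move=> H.
  have {}H : {ae mu2, forall x, U x = 0 -> V x = 0}.
    by apply: H; apply: filterS vu => x h ux; apply: h; exact/suppNP.
  by apply: filterS H => x h /suppNP.
have h2 : mass mu1 r f (~` supp u) <= mass mu2 r F (~` supp U).
  apply: half; [exact: measurableC|exact: measurableC|] => v V mv vu.
  have ov : orthoLp u v.
    apply: filterS vu => x h; have [|/suppP ux] := pselect (u x = 0); [by left|right].
    by apply: h => /(_ ux).
  have := (corr_ortho mu mv).1 ov.
  apply: filterS => x [Ux Bx|//].
  by exfalso; apply: Bx => /suppP.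
have e1 := mass_setC f mu0; have e2 := mass_setC F mU.
rewrite massT nf powR1 in e1; rewrite massT nF powR1 in e2.
by apply/eqP; rewrite eq_le h1/=; move: h2 e1 e2; lra.
Qed.

End finite_exponent_half.

Section finite_exponent.
Context (R : realType) (r : R) (p1 : (1 <= r%:E)%E) (e : R) (er : good_sign r e).

Let r1 : 1 <= r. Proof. by rewrite -lee_fin. Qed.
Let r0 : 0 < r. Proof. exact: lt_le_trans r1. Qed.

(** If G < a F on a non-null set B inside the support of z, let w' be the element
    matching one with support B.  Over the support of w' the mass of a f is at
    most that of g, hence the mass of a F over B is at most that of G.  As
    a F >= G there, both agree a.e. on B: a contradiction. *)
Lemma order_match_half d1 (T1 : measurableType d1) d2 (T2 : measurableType d2)
  (mu1 : {measure set T1 -> \bar R}) (mu2 : {measure set T2 -> \bar R})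
  (fin1 : mu1 setT \is a fin_num) (fin2 : mu2 setT \is a fin_num)
  (M : cLp mu1 p1 -> cLp mu2 p1 -> Prop) :
  sphere_corr M -> norm_corr e M ->
  forall w z f F g G (a : R), M w z -> M f F -> M g G -> 0 <= a ->
  below1 a f g (supp w) -> below2 a F G (supp z).
Proof.
move=> cM nM w z f F g G a mwz mf mg a0; rewrite /below1 /below2 => fg.
have [Mdom Mtot Msurj] := cM.
have [[f0 nf] [F0 nF]] := Mdom _ _ mf; have [[g0 ng] [G0 nG]] := Mdom _ _ mg.
pose B := supp z `&` [set x | complex.Re (G x) < a * complex.Re (F x)].
have mB : measurable B.
  apply: measurableI; first exact: measurable_supp.
  apply: measurable_ltset; first exact: measurable_Re.
  by apply: measurable_funM => //; exact: measurable_Re.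
have [B0|B0] := pselect {ae mu2, forall x, ~ B x}.
  apply: filterS B0 => x h zx; rewrite leNgt; apply/negP => h'; exact: h.
exfalso.
have [z' pz' zB] := unit_with_supp fin2 p1 mB B0.
have [w' mw'] := Msurj _ pz'.
have ww' : {ae mu1, forall x, w x = 0 -> w' x = 0}.
  apply: (corr_supp fin1 er (sphere_corr_swap cM) (norm_corr_swap nM) mwz mw').
  by apply: filterS zB => x [_ h] /suppNP zx; apply: h => -[].
have ms := measurable_supp w'; have ms' := measurable_supp z'.
have e1 := corr_mass fin2 er cM nM mf mw'.
have e2 := corr_mass fin2 er cM nM mg mw'.
have l1 : mass mu1 r (a%:C *: f : cLp mu1 p1) (supp w') <= mass mu1 r g (supp w').
  apply: le_mass => //; apply: filterS3 (cLp_funZ a%:C f) (filterI fg ww')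
    (filterI f0 g0) => x -> [h h'] [fx gx] w'x.
  have {}h : a * complex.Re (f x) <= complex.Re (g x).
    by apply: h; apply: contrapT => /suppNP/h'/suppNP.
  by rewrite normcM normc_real (ger0_norm a0) !normc_ge0E.
have sc (u : cLp mu1 p1) : mass mu1 r (a%:C *: u : cLp mu1 p1) (supp w') = a `^ r * mass mu1 r u (supp w').
  apply: mass_scale => //; apply: filterS (cLp_funZ a%:C u) => x -> _.
  by rewrite normcM normc_real ger0_norm.
have sc' (u : cLp mu2 p1) : mass mu2 r (a%:C *: u : cLp mu2 p1) (supp z') = a `^ r * mass mu2 r u (supp z').
  apply: mass_scale => //; apply: filterS (cLp_funZ a%:C u) => x -> _.
  by rewrite normcM normc_real ger0_norm.
have l2 : mass mu2 r (a%:C *: F : cLp mu2 p1) (supp z') <= mass mu2 r G (supp z').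
  by rewrite sc' -e1 -e2 -sc.
have /(_ ms') l3 := le_mass_eq _ _ l2.
have l4 : {ae mu2, forall x, supp z' x -> normc (G x) = normc ((a%:C *: F : cLp mu2 p1) x)}.
  apply: l3; apply: filterS3 (cLp_funZ a%:C F) zB (filterI F0 G0) => x -> h [Fx Gx] z'x.
  have [_] : B x by apply: contrapT => /(h.2)/suppNP.
  by move=> /= /ltW; rewrite normcM normc_real (ger0_norm a0) !normc_ge0E.
apply: B0; apply: filterS3 (filterI (cLp_funZ a%:C F) l4) zB (filterI F0 G0)
  => x [h1 h2] h [Fx Gx] Bx.
have : supp z' x by apply/suppP => /(h.1).
move=> /h2; rewrite h1 normcM normc_real (ger0_norm a0) !normc_ge0E// => E.
by case: Bx => _ /=; rewrite E ltxx.
Qed.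

Theorem order_match_finite d1 (T1 : measurableType d1) d2 (T2 : measurableType d2)
  (mu1 : {measure set T1 -> \bar R}) (mu2 : {measure set T2 -> \bar R})
  (fin1 : mu1 setT \is a fin_num) (fin2 : mu2 setT \is a fin_num)
  (M : cLp mu1 p1 -> cLp mu2 p1 -> Prop) :
  sphere_corr M -> norm_corr e M ->
  forall B, measurable B -> exists2 A, measurable A & order_match M A B.
Proof.
move=> cM nM B mB; have [_ _ Msurj] := cM.
have [B0|B0] := pselect {ae mu2, forall x, ~ B x}.
  exists set0 => // f F g G a _ _ _; split=> _; last exact: aeW.
  by apply: filterS B0 => x h /h.
have [z pz zB] := unit_with_supp fin2 p1 mB B0; have [w mwz] := Msurj _ pz.
exists (supp w); first exact: measurable_supp.
move=> f F g G a mf mg a0; split=> h.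
  have := order_match_half fin1 fin2 cM nM mwz mf mg a0 h.
  by apply: filterS2 zB => x z0 h' Bx; apply: h'; apply/suppP => /z0.1.
apply: (order_match_half fin2 fin1 (sphere_corr_swap cM) (norm_corr_swap nM)
  mwz mf mg a0).
apply: filterS2 zB h => x z0 h' zx; apply: h'; apply: contrapT => /z0.2.
exact/suppP.
Qed.

End finite_exponent.

Section almost_everywhere.
Context d (T : measurableType d) (R : realType).
Variable mu : {measure set T -> \bar R}.

Lemma ae_countable (I : countType) (P : I -> T -> Prop) :
  (forall i, {ae mu, forall x, P i x}) -> {ae mu, forall x, forall i, P i x}.
Proof.
move=> h.
have : forall n, {ae mu, forall x, if @unpickle I n is Some i then P i x else True}.
  by move=> n; case: unpickle => [i|]; [exact: h|exact: aeW].
move/ae_foralln; apply: filterS => x H i.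
by have := H (pickle i); rewrite pickleK.
Qed.

(** A strict inequality g < f leaves room for two rationals, and countably many
    null sets suffice to exclude all pairs. *)
Lemma ae_le_rat (f g : T -> R) (B : set T) :
  (forall q q' : rat, (q < q')%R ->
    {ae mu, forall x, B x -> g x <= ratr q -> ratr q' <= f x -> False}) ->
  {ae mu, forall x, B x -> f x <= g x}.
Proof.
move=> h.
have : {ae mu, forall x, forall qq : rat * rat, (qq.1 < qq.2)%R ->
    B x -> g x <= ratr qq.1 -> ratr qq.2 <= f x -> False}.
  apply: ae_countable => -[q q'] /=.
  have [qq'|qq'] := boolP (q < q')%R; last exact: aeW.
  by apply: filterS (h _ _ qq') => x H _.
apply: filterS => x H Bx; rewrite leNgt; apply/negP => gf.
have [q] := rat_in_itvoo gf; rewrite in_itv/= => /andP[gq qf].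
have [q'] := rat_in_itvoo qf; rewrite in_itv/= => /andP[qq' q'f].
apply: (H (q, q')) => //=; [|exact: ltW|exact: ltW].
by move: qq'; rewrite ltr_rat.
Qed.

End almost_everywhere.

(** * Order relations for the sup norm *)

Section sup_norm.
Context d (T : measurableType d) (R : realType).
Variable mu : {measure set T -> \bar R}.
Hypothesis mu_fin : mu setT \is a fin_num.
Variable p1 : (1 <= +oo :> \bar R)%E.
Local Notation E := (cLp mu p1).
Implicit Types (f g h u v : E) (A : set T).
Local Notation chi := (charLp mu p1).
Local Notation rho f x := (complex.Re ((f : E) x)).
Local Notation null A := {ae mu, forall x, ~ A x}.

(** For the zero measure the norm is 0 by convention instead of the essential
    supremum, and the left side then holds because c >= 0. *)
Lemma sup_normP u (c : R) : 0 <= c ->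
  cLp_norm u <= c <-> {ae mu, forall x, normc (u x) <= c}.
Proof.
move=> c0; rewrite -lee_fin -cLp_norm_fin unlock.
case: ifPn => [mu0|].
  split=> [/ess_supP|H].
    by apply: filterS => x /=; rewrite lee_fin ger0_norm ?normc_ge0.
  apply/ess_supP; apply: filterS H => x /=.
  by rewrite lee_fin ger0_norm ?normc_ge0.
rewrite -leNgt => mu0; split=> _; last by rewrite lee_fin.
have mT0 : mu setT = 0%E by apply/eqP; rewrite eq_le mu0/= measure_ge0.
by exists setT; split.
Qed.

Lemma pos_unit_le1 f : pos_unit f -> {ae mu, forall x, 0 <= rho f x <= 1}.
Proof.
move=> [f0 nf]; have : cLp_norm f <= 1 by rewrite nf.
move/(sup_normP f ler01); apply: filterS2 f0 => x fx.
by rewrite normc_ge0E// => ->; move: fx; rewrite cge0P => /andP[_ ->].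
Qed.

Lemma pos_unit_sup f (c : R) : pos_unit f -> c < 1 -> ~ {ae mu, forall x, rho f x <= c}.
Proof.
move=> [f0 nf] c1 H.
have : cLp_norm f <= Num.max c 0.
  apply/sup_normP; first by rewrite le_max lexx orbT.
  by apply: filterS2 f0 H => x fx h; rewrite normc_ge0E// le_max h.
by rewrite nf le_max leNgt c1/= leNgt ltr01.
Qed.

Lemma pos_unitP f : cLp_pos f -> {ae mu, forall x, rho f x <= 1} ->
  (forall c, c < 1 -> ~ {ae mu, forall x, rho f x <= c}) -> pos_unit f.
Proof.
move=> f0 f1 fc; split=> //; apply/eqP; rewrite eq_le; apply/andP; split.
  apply/sup_normP => //.
  by apply: filterS2 f0 f1 => x fx h; rewrite normc_ge0E.
rewrite leNgt; apply/negP => /fc; apply.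
have := (sup_normP f (cLp_norm_ge0 f)).1 (lexx _).
by apply: filterS2 f0 => x fx; rewrite normc_ge0E.
Qed.

Lemma dist_supP f g (c : R) : cLp_pos f -> cLp_pos g -> 0 <= c ->
  cLp_norm (f - g) <= c <-> {ae mu, forall x, `|rho f x - rho g x| <= c}.
Proof.
move=> f0 g0 c0; rewrite sup_normP//.
have H : {ae mu, forall x, normc ((f - g : E) x) = `|rho f x - rho g x|}.
  apply: filterS3 (cLp_funB f g) f0 g0 => x -> /cge0E fx /cge0E gx.
  by rewrite {1}fx {1}gx -rmorphB normc_real.
by split; apply: filterS2 H => x ->.
Qed.

Lemma charLp_Re A : measurable A ->
  {ae mu, forall x, rho (chi A) x = \1_A x}.
Proof. by move=> mA; apply: filterS (charLpE mu_fin p1 mA) => x ->. Qed.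

Lemma charLp_unit A : measurable A -> ~ null A -> pos_unit (chi A : E).
Proof.
move=> mA A0; apply: pos_unitP.
- exact: charLp_pos.
- by apply: filterS (charLp_Re mA) => x ->; rewrite indicE; case: (_ \in _).
- move=> c c1 H; apply: A0; apply: filterS2 (charLp_Re mA) H => x -> + Ax.
  by rewrite indicE mem_set//= leNgt c1.
Qed.

(** Distance to an indicator is read off separately on the set and off it. *)
Lemma charLp_close A f (c : R) : measurable A -> pos_unit f -> 0 <= c ->
  cLp_norm (f - chi A) <= c <->
  {ae mu, forall x, (A x -> 1 - c <= rho f x) /\ (~ A x -> rho f x <= c)}.
Proof.
move=> mA pf c0; rewrite dist_supP//; [|by case: pf|exact: charLp_pos].
split=> H; apply: filterS3 (charLp_Re mA) H (pos_unit_le1 pf) => x ->.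
  rewrite indicE => h /andP[f0 f1]; split=> Ax.
    by move: h; rewrite mem_set//= ler_norml => /andP[]; lra.
  by move: h; rewrite memNset//= subr0 ger0_norm.
move=> [h1 h2] /andP[f0 f1]; rewrite indicE.
case: (boolP (x \in A)); rewrite ?notin_setE ?inE => Ax.
  by have := h1 Ax; rewrite /= ler_norml; lra.
by have := h2 Ax; rewrite /= subr0 ger0_norm.
Qed.

(** Level sets can be found among the sets whose indicators are near f: |f - 1| is
    less than 1 - c <= c on {f > c}, and f <= c off it. *)
Lemma close_charLp_above f (c : R) : pos_unit f -> 0 <= c -> 1 <= c + c ->
  cLp_norm (f - chi [set x | c < rho f x]) <= c.
Proof.
move=> pf c0 cc; apply/charLp_close => //.
  by apply: measurable_ltset => //; exact: measurable_Re.
apply: aeW => x /=; split=> [h|/negP]; last by rewrite -leNgt.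
by move: h; lra.
Qed.

(** The companion for small levels: |f - 1| is at most 1 - c on {f >= c}, and
    f < c <= 1 - c off it. *)
Lemma close_charLp_atleast f (c : R) : pos_unit f -> c <= 1 -> c + c <= 1 ->
  cLp_norm (f - chi (~` [set x | rho f x < c])) <= 1 - c.
Proof.
move=> pf c1 cc; apply/charLp_close => //.
- apply: measurableC.
  by apply: measurable_ltset => //; exact: measurable_Re.
- by rewrite subr_ge0.
apply: aeW => x /=; split=> [/negP|/contrapT h]; last by move: h; lra.
by rewrite -leNgt; lra.
Qed.

(** On the positive unit sphere all distances are at most 1, so this says that
    the distance is maximal. *)
Definition far f g := 1 <= cLp_norm (f - g).

Lemma farC f g : far f g -> far g f.
Proof. by rewrite /far -cLp_normN opprB. Qed.

(** Near an indicator the distance is ultrametric: if f and h are both at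
    distance at most c from it, then both are in [1-c, 1] on A and in [0, c] off
    A, so they are at distance at most c from each other. *)
Lemma far_charLp A f h : measurable A -> pos_unit f -> pos_unit h ->
  ~ null A -> cLp_norm (f - chi A) < 1 -> far f h -> far (chi A) h.
Proof.
move=> mA pf ph A0 c1; rewrite /far leNgt => fh; rewrite leNgt.
apply: contra fh; rewrite -cLp_normN opprB => s1.
pose c := Num.max (cLp_norm (f - chi A)) (cLp_norm (h - chi A)).
apply: (@le_lt_trans _ _ c); last by rewrite gt_max c1.
have c0 : 0 <= c by rewrite le_max cLp_norm_ge0.
apply/dist_supP => //; [by case: pf|by case: ph|].
have Hf : cLp_norm (f - chi A) <= c by rewrite le_max lexx.
have Hh : cLp_norm (h - chi A) <= c by rewrite le_max lexx orbT.
move/(charLp_close mA pf c0) : Hf => Hf.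
move/(charLp_close mA ph c0) : Hh => Hh.
apply: filterS3 (filterI Hf Hh) (pos_unit_le1 pf) (pos_unit_le1 ph) => x.
move=> [[f1 f2] [h1 h2]] /andP[? ?] /andP[? ?].
have [Ax|Ax] := pselect (A x).
  by have := f1 Ax; have := h1 Ax; rewrite ler_norml; lra.
by have := f2 Ax; have := h2 Ax; rewrite ler_norml; lra.
Qed.

(** No other element of the sphere is far from all the elements that f is far
    from.  This property is formulated by distances only; it characterizes
    indicator functions. *)
Definition maximal f := forall g, pos_unit g ->
  (forall h, pos_unit h -> far f h -> far g h) -> g = f.

(** The indicator of {f > 1/2} is at distance at most 1/2 from f, hence far from
    everything that f is far from; by maximality it is f. *)
Lemma maximal_charLp f : pos_unit f -> maximal f ->
  exists A, [/\ measurable A, ~ null A & f = chi A].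
Proof.
move=> pf mf; pose A := [set x | 2^-1 < rho f x].
have mA : measurable A.
  by apply: measurable_ltset => //; exact: measurable_Re.
have A0 : ~ null A.
  move=> H; apply: (@pos_unit_sup f 2^-1 pf); first lra.
  by apply: filterS H => x /= /negP; rewrite -leNgt.
exists A; split => //; apply/esym/mf; first exact: charLp_unit.
move=> h ph; apply: far_charLp => //.
apply: (@le_lt_trans _ _ (2^-1)); last lra.
by apply: close_charLp_above => //; lra.
Qed.

(** If g is far from everything that the indicator of A is far from, then g is at
    distance less than 1 from that indicator.  Were g <= q < 1 on a non-null
    part A' of A, setting g to 0 on A' would give an element far from the
    indicator but not from g; were g >= q' > 0 on a non-null part A' of the
    complement, setting g to 1 on A' would do the same. *)
Lemma charLp_maximal A : measurable A -> ~ null A -> maximal (chi A).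
Proof.
move=> mA A0 g pg gmax.
have pA := charLp_unit mA A0.
have gA : cLp_norm (g - chi A) < 1.
  rewrite ltNge; apply/negP => /farC /(gmax _ pg).
  by rewrite /far subrr cLp_norm0 leNgt ltr01.
set c := cLp_norm (g - chi A) in gA.
have c0 : 0 <= c := cLp_norm_ge0 _.
have gc := (charLp_close mA pg c0).1 (lexx _).
have one : {ae mu, forall x, A x -> 1 <= rho g x}.
  apply: ae_le_rat => q q' qq'.
  have [q'1|q'1] := ltP 1 (ratr q' : R).
    by apply: aeW => x _ _ [].
  have {q'1}q1 : ratr q < 1 :> R by apply: lt_le_trans q'1; rewrite ltr_rat.
  pose A' := A `&` ~` [set x | ratr q < rho g x].
  have mA' : measurable A'.
    apply: measurableI => //; apply: measurableC.
    by apply: measurable_ltset => //; exact: measurable_Re.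
  have mcA' := measurableC mA'.
  have [A'0|A'0] := pselect (null A').
    apply: filterS A'0 => x h Ax h' _; apply: h; split=> //=.
    by apply/negP; rewrite -leNgt.
  exfalso; pose h := restr (~` A') g.
  have ph : pos_unit h.
    apply: pos_unitP.
    - by apply: restr_ge0 => //; case: pg.
    - apply: filterS3 (restr_in g mcA') (restr_out g mcA') (pos_unit_le1 pg).
      move=> x h1 h2 /andP[? ?]; have [/h1 ->//|/h2 ->] := pselect ((~` A') x).
      exact: ler01.
    - move=> e e1 H; apply: (@pos_unit_sup g (Num.max e (ratr q)) pg).
        by rewrite gt_max e1.
      apply: filterS2 H (restr_in g mcA') => x h1 h2.
      rewrite !le_max; have [[_ /= /negP]|A'x] := pselect (A' x).
        by rewrite -leNgt => ->; rewrite orbT.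
      by rewrite -h2// h1.
  have : far g h.
    apply: gmax => //; rewrite /far leNgt; apply/negP => lt1.
    have := (dist_supP (charLp_pos mu_fin p1 mA) ph.1 (cLp_norm_ge0 _)).1 (lexx _).
    move=> Hd; apply: A'0; apply: filterS3 Hd (charLp_Re mA) (restr_out g mcA').
    move=> x h1 h2 h3 A'x; move: h1; rewrite h2 indicE mem_set; last by case: A'x.
    rewrite h3; last by move/(_ A'x).
    by rewrite /= subr0 normr1 leNgt lt1.
  rewrite /far leNgt => /negP; apply.
  apply: (@le_lt_trans _ _ (Num.max (ratr q) 0)).
    have m0 : 0 <= Num.max (ratr q : R) 0 by rewrite le_max lexx orbT.
    apply/(dist_supP pg.1 ph.1 m0).
    apply: filterS3 (restr_in g mcA') (restr_out g mcA') (pos_unit_le1 pg).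
    move=> x h1 h2 /andP[g0 g1].
    have [A'x|A'x] := pselect (A' x); last by rewrite h1// subrr normr0 le_max lexx orbT.
    rewrite h2; last by move/(_ A'x).
    rewrite /= subr0 ger0_norm// le_max; case: A'x => _ /= /negP.
    by rewrite -leNgt => ->.
  by rewrite gt_max q1 ltr01.
have zero : {ae mu, forall x, (~` A) x -> rho g x <= 0}.
  apply: ae_le_rat => q q' qq'.
  have [q0|q0] := ltP (ratr q : R) 0.
    by apply: aeW => x _ [].
  have {q0}q'0 : 0 < ratr q' :> R by apply: le_lt_trans q0 _; rewrite ltr_rat.
  pose A' := ~` A `&` ~` [set x | rho g x < ratr q'].
  have mA' : measurable A'.
    apply: measurableI; apply: measurableC => //.
    by apply: measurable_ltset => //; exact: measurable_Re.
  have mcA' := measurableC mA'.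
  have [A'0|A'0] := pselect (null A').
    apply: filterS A'0 => x h Ax _ h'; apply: h; split=> //=.
    by apply/negP; rewrite -leNgt.
  exfalso; pose h : E := restr (~` A') g + chi A'.
  have hE : {ae mu, forall x, (A' x -> h x = 1) /\ (~ A' x -> h x = g x)}.
    apply: filterS3 (cLp_funD (restr (~` A') g) (chi A'))
      (restrE g mcA') (charLpE mu_fin p1 mA') => x -> -> ->.
    rewrite !indicE in_setC; case: (boolP (x \in A')); rewrite ?notin_setE ?inE => A'x.
      by rewrite mul0r add0r; split.
    by rewrite mul1r addr0; split.
  have ph : pos_unit h.
    apply: pos_unitP.
    - apply: filterS2 hE pg.1 => x [h1 h2] gx.
      have [/h1 ->|/h2 ->//] := pselect (A' x); exact: ler01.
    - apply: filterS2 hE (pos_unit_le1 pg) => x [h1 h2] /andP[_ g1].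
      by have [/h1 ->|/h2 ->] := pselect (A' x).
    - move=> e e1 H; apply: A'0; apply: filterS2 hE H => x [h1 _] + A'x.
      by rewrite h1//= leNgt e1.
  have : far g h.
    apply: gmax => //; rewrite /far leNgt; apply/negP => lt1.
    have := (dist_supP (charLp_pos mu_fin p1 mA) ph.1 (cLp_norm_ge0 _)).1 (lexx _).
    move=> Hd; apply: A'0; apply: filterS3 Hd (charLp_Re mA) hE.
    move=> x h1 h2 [h3 _] A'x; move: h1; rewrite h2 indicE memNset; last by case: A'x.
    by rewrite h3//= sub0r normrN normr1 leNgt lt1.
  rewrite /far leNgt => /negP; apply.
  apply: (@le_lt_trans _ _ (Num.max (1 - ratr q') 0)).
    have m0 : 0 <= Num.max (1 - ratr q' : R) 0 by rewrite le_max lexx orbT.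
    apply/(dist_supP pg.1 ph.1 m0).
    apply: filterS2 hE (pos_unit_le1 pg) => x [h1 h2] /andP[g0 g1].
    have [A'x|A'x] := pselect (A' x); last by rewrite h2// subrr normr0 le_max lexx orbT.
    rewrite h1//= distrC ger0_norm ?subr_ge0// le_max lerB//.
    by case: A'x => _ /= /negP; rewrite -leNgt.
  by rewrite gt_max ltr01 andbT; lra.
apply/cLp_eqP; apply: filterS3 (filterI one zero) (filterI pg.1 (charLpE mu_fin p1 mA))
  (pos_unit_le1 pg) => x [h1 h2] [gx ->] /andP[g0 g1].
rewrite (cge0E gx); congr (_%:C); rewrite indicE.
case: (boolP (x \in A)); rewrite ?notin_setE ?inE => Ax.
  by apply/eqP; rewrite eq_le g1/= h1.
by apply/eqP; rewrite eq_le g0/= andbT h2.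
Qed.

(** Disjointness of sets in terms of distances.  If A and A' meet in a non-null
    set, the function equal to 1 on the intersection and to 1/2 elsewhere is at
    distance 1/2 from both indicators; an element at distance less than 1 from
    the indicators of two disjoint sets would be bounded by a constant less
    than 1 everywhere. *)
Lemma charLp_meetP A A' : measurable A -> measurable A' -> ~ null A -> ~ null A' ->
  null (A `&` A') <->
  ~ exists f, [/\ pos_unit f, cLp_norm (f - chi A) < 1 & cLp_norm (f - chi A') < 1].
Proof.
move=> mA mA' A0 A'0; split=> [AA' [f [pf c1 c2]]|H].
  have H1 := (charLp_close mA pf (cLp_norm_ge0 _)).1 (lexx _).
  have H2 := (charLp_close mA' pf (cLp_norm_ge0 _)).1 (lexx _).
  apply: (@pos_unit_sup f (Num.max (cLp_norm (f - chi A)) (cLp_norm (f - chi A'))) pf).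
    by rewrite gt_max c1.
  apply: filterS3 AA' H1 H2 => x h [_ h1] [_ h2]; rewrite le_max.
  have [Ax|/h1 ->//] := pselect (A x).
  have [A'x|/h2 ->] := pselect (A' x); last by rewrite orbT.
  by exfalso; apply: h.
have mI := measurableI _ _ mA mA'.
apply: contrapT => I0; apply: H.
(* equal to 1 on the intersection and to 1/2 elsewhere *)
pose f : E := (2^-1)%:C *: (chi (A `&` A') + chi setT).
have fE : {ae mu, forall x, f x = (2^-1 * (\1_(A `&` A') x + 1))%:C}.
  apply: filterS3 (cLp_funZ (2^-1)%:C (chi (A `&` A') + chi setT))
    (cLp_funD (chi (A `&` A')) (chi setT))
    (filterI (charLpE mu_fin p1 mI) (charLpE mu_fin p1 measurableT)) => x -> -> [-> ->].
  by rewrite indicT rmorphM rmorphD.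
have i01 x : 0 <= (\1_(A `&` A') x : R) <= 1 by rewrite indicE; case: (_ \in _); rewrite ?lexx ?ler01.
have pf : pos_unit f.
  apply: pos_unitP.
  - apply: filterS fE => x ->; rewrite lecR; have /andP[? _] := i01 x.
    by rewrite mulr_ge0// addr_ge0.
  - apply: filterS fE => x -> /=; have /andP[_] := i01 x; lra.
  - move=> c c1 H; apply: I0; apply: filterS2 fE H => x -> /= h Ix.
    by move: h; rewrite indicE mem_set//=; lra.
have cl B : measurable B -> A `&` A' `<=` B -> cLp_norm (f - chi B) < 1.
  move=> mB IB; apply: (@le_lt_trans _ _ (2^-1)); last lra.
  apply/charLp_close => //.
  apply: filterS fE => x -> /=; have /andP[h1 h2] := i01 x.
  split=> Bx; first lra.
  by rewrite indicE memNset; [rewrite /=; lra|move/IB].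
by exists f; split=> //; apply: cl => // x [].
Qed.

End sup_norm.

Section infinite_exponent_half.
Context d1 (T1 : measurableType d1) d2 (T2 : measurableType d2) (R : realType).
Variables (mu1 : {measure set T1 -> \bar R}) (mu2 : {measure set T2 -> \bar R}).
Hypotheses (fin1 : mu1 setT \is a fin_num) (fin2 : mu2 setT \is a fin_num).
Variable p1 : (1 <= +oo :> \bar R)%E.
Local Notation E1 := (cLp mu1 p1).
Local Notation E2 := (cLp mu2 p1).
Variable M : E1 -> E2 -> Prop.
Hypotheses (cM : sphere_corr M) (nM : norm_corr (-1) M).
Local Notation chi1 := (charLp mu1 p1).
Local Notation chi2 := (charLp mu2 p1).
Local Notation null1 A := {ae mu1, forall x, ~ A x}.
Local Notation null2 A := {ae mu2, forall x, ~ A x}.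
Local Notation rho f x := (complex.Re (cLp_fun f x)).

Let Mdom x y : M x y -> pos_unit x /\ pos_unit y.
Proof. by have [+ _ _] := cM; exact. Qed.
Let Mtot x : pos_unit x -> exists y, M x y.
Proof. by have [_ + _] := cM; exact. Qed.
Let Msurj y : pos_unit y -> exists x, M x y.
Proof. by have [_ _ +] := cM; exact. Qed.

Lemma corr_dist x y x' y' : M x y -> M x' y' ->
  cLp_norm (x - x') = cLp_norm (y - y').
Proof. by move=> m m'; have := nM m m'; rewrite rmorphN1 !scaleN1r. Qed.

Lemma corr_fun x y y' : M x y -> M x y' -> y = y'.
Proof.
move=> m m'; have := corr_dist m m'; rewrite subrr cLp_norm0.
by move/esym/cLp_norm_eq0/eqP; rewrite subr_eq0 => /eqP.
Qed.

Lemma corr_maximal f F : M f F -> maximal f -> maximal F.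
Proof.
move=> mf fmax G pG H; have [g mg] := Msurj pG.
suff gf : g = f by apply: (corr_fun mg); rewrite gf.
have [pg _] := Mdom mg; apply: fmax => // h ph fh; have [K mh] := Mtot ph.
rewrite /far (corr_dist mg mh); apply: H; first by have [] := Mdom mh.
by rewrite /far -(corr_dist mf mh).
Qed.

(** The correspondence permutes indicator functions, thereby defining a
    correspondence between sets. *)
Definition matched A B := [/\ measurable A, measurable B & M (chi1 A) (chi2 B)].

Lemma matched_neq0 A B : matched A B -> ~ null1 A /\ ~ null2 B.
Proof.
move=> [mA mB /Mdom[[_ nA] [_ nB]]]; split=> H.
  have : chi1 A = 0.
    apply/cLp_eqP; apply: filterS3 H (charLpE fin1 p1 mA) (cLp_fun0 mu1 p1) => x ? -> ->.
    by rewrite indicE memNset.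
  by move=> c0; move: nA; rewrite c0 cLp_norm0 => /eqP; rewrite eq_sym oner_eq0.
have : chi2 B = 0.
  apply/cLp_eqP; apply: filterS3 H (charLpE fin2 p1 mB) (cLp_fun0 mu2 p1) => x ? -> ->.
  by rewrite indicE memNset.
by move=> c0; move: nB; rewrite c0 cLp_norm0 => /eqP; rewrite eq_sym oner_eq0.
Qed.

Lemma matched_exists A : measurable A -> ~ null1 A -> exists B, matched A B.
Proof.
move=> mA A0; have pA := charLp_unit fin1 p1 mA A0; have [F mF] := Mtot pA.
have [_ pF] := Mdom mF.
have [|B [mB B0 FB]] := maximal_charLp fin2 pF.
  exact: corr_maximal mF (charLp_maximal fin1 mA A0).
by exists B; split=> //; rewrite -FB.
Qed.

Lemma matched_disj A B A' B' : matched A B -> matched A' B' ->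
  null1 (A `&` A') -> null2 (B `&` B').
Proof.
move=> m m'; have [A0 B0] := matched_neq0 m; have [A'0 B'0] := matched_neq0 m'.
case: m m' => mA mB m [mA' mB' m'].
move=> /(charLp_meetP fin1 p1 mA mA' A0 A'0) H.
apply/(charLp_meetP fin2 p1 mB mB' B0 B'0) => -[F [pF c1 c2]]; apply: H.
have [f mf] := Msurj pF; exists f; split; first by have [] := Mdom mf.
- by rewrite (corr_dist mf m).
- by rewrite (corr_dist mf m').
Qed.

End infinite_exponent_half.

Section infinite_exponent_levels.
Context (R : realType) (p1 : (1 <= +oo :> \bar R)%E).
Local Notation rho f x := (complex.Re (cLp_fun f x)).

Lemma matched_swap d1 (T1 : measurableType d1) d2 (T2 : measurableType d2)
  (mu1 : {measure set T1 -> \bar R}) (mu2 : {measure set T2 -> \bar R})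
  (M : cLp mu1 p1 -> cLp mu2 p1 -> Prop) A B :
  matched M A B -> matched (fun y x => M x y) B A.
Proof. by case. Qed.

(** The set A = {f > c} is disjoint from C, so its match B is disjoint from D;
    since f is c-close to the indicator of A, F is c-close to that of B, hence
    F <= c off B, in particular on D. *)
Lemma level_le_strong d1 (T1 : measurableType d1) d2 (T2 : measurableType d2)
  (mu1 : {measure set T1 -> \bar R}) (mu2 : {measure set T2 -> \bar R})
  (fin1 : mu1 setT \is a fin_num) (fin2 : mu2 setT \is a fin_num)
  (M : cLp mu1 p1 -> cLp mu2 p1 -> Prop) (C : set T1) D f F (c : R) :
  sphere_corr M -> norm_corr (-1) M -> matched M C D -> M f F -> 1 <= c + c ->
  {ae mu1, forall x, C x -> rho f x <= c} ->
  {ae mu2, forall x, D x -> rho F x <= c}.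
Proof.
move=> cM nM CD mf cc fc; have [pf pF] : pos_unit f /\ pos_unit F.
  by have [h _ _] := cM; exact: h.
have [c1|c1] := leP 1 c.
  by apply: filterS (pos_unit_le1 pF) => x /andP[_ h] _; exact: le_trans c1.
have c0 : 0 <= c by lra.
pose A := [set x | c < rho f x].
have mA : measurable A by apply: measurable_ltset => //; exact: measurable_Re.
have A0 : ~ {ae mu1, forall x, ~ A x}.
  move=> H; apply: (pos_unit_sup pf c1); apply: filterS H => x /negP.
  by rewrite -leNgt.
have [B AB] := matched_exists fin1 fin2 cM nM mA A0.
have CA : {ae mu1, forall x, ~ (C `&` A) x}.
  by apply: filterS fc => x h [/h + /=]; rewrite leNgt => /negP.
have DB := matched_disj fin1 fin2 cM nM CD AB CA.
have : cLp_norm (F - charLp mu2 p1 B) <= c.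
  have [_ _ mAB] := AB; rewrite -(corr_dist nM mf mAB).
  exact: close_charLp_above.
have [_ mB _] := AB.
move/(charLp_close fin2 mB pF c0); apply: filterS2 DB => x h [_ h'] Dx.
by apply: h' => Bx; apply: h.
Qed.

(** Same idea with A = {f >= c}, which contains C: then its match contains D, on
    which F >= c because the distance to the indicator is at most 1 - c. *)
Lemma level_ge_strong d1 (T1 : measurableType d1) d2 (T2 : measurableType d2)
  (mu1 : {measure set T1 -> \bar R}) (mu2 : {measure set T2 -> \bar R})
  (fin1 : mu1 setT \is a fin_num) (fin2 : mu2 setT \is a fin_num)
  (M : cLp mu1 p1 -> cLp mu2 p1 -> Prop) (C : set T1) D f F (c : R) :
  sphere_corr M -> norm_corr (-1) M -> matched M C D -> M f F -> c + c <= 1 ->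
  {ae mu1, forall x, C x -> c <= rho f x} ->
  {ae mu2, forall x, D x -> c <= rho F x}.
Proof.
move=> cM nM CD mf cc fc; have [pf pF] : pos_unit f /\ pos_unit F.
  by have [h _ _] := cM; exact: h.
have c1 : c < 1 by lra.
pose A := ~` [set x | rho f x < c].
have mA : measurable A.
  by apply: measurableC; apply: measurable_ltset => //; exact: measurable_Re.
have A0 : ~ {ae mu1, forall x, ~ A x}.
  by move=> H; apply: (pos_unit_sup pf c1); apply: filterS H => x /contrapT/ltW.
have [B AB] := matched_exists fin1 fin2 cM nM mA A0.
have DB : {ae mu2, forall x, D x -> B x}.
  pose D' := D `\` B; have [_ mD _] := CD; have [_ mB _] := AB.
  have mD' : measurable D' by exact: measurableD.
  have [D'0|D'0] := pselect {ae mu2, forall x, ~ D' x}.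
    by apply: filterS D'0 => x h Dx; apply: contrapT => Bx; apply: h.
  have [C' /matched_swap D'C'] := matched_exists fin2 fin1 (sphere_corr_swap cM)
    (norm_corr_swap nM) mD' D'0.
  have h1 : {ae mu1, forall x, ~ (C' `&` A) x}.
    apply: (matched_disj fin2 fin1 (sphere_corr_swap cM) (norm_corr_swap nM)
      (matched_swap D'C') (matched_swap AB)).
    by apply: aeW => x [[_]].
  have h2 : {ae mu2, forall x, ~ (D' `&` D) x}.
    apply: (matched_disj fin1 fin2 cM nM D'C' CD).
    apply: filterS2 h1 fc => x h h' [C'x /h']; rewrite leNgt => /negP Ax.
    by apply: h.
  exfalso; apply: D'0; apply: filterS h2 => x h D'x; apply: h; split=> //.
  by case: D'x.
have c0' : 0 <= 1 - c by lra.
have : cLp_norm (F - charLp mu2 p1 B) <= 1 - c.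
  have [_ _ mAB] := AB; rewrite -(corr_dist nM mf mAB).
  by apply: close_charLp_atleast => //; exact: ltW.
have [_ mB _] := AB.
move/(charLp_close fin2 mB pF c0'); apply: filterS2 DB => x h [h' _] Dx.
by have := h' (h Dx); lra.
Qed.

(** Inclusion follows from preservation of disjointness, tested on the set
    difference. *)
Lemma matched_subset d1 (T1 : measurableType d1) d2 (T2 : measurableType d2)
  (mu1 : {measure set T1 -> \bar R}) (mu2 : {measure set T2 -> \bar R})
  (fin1 : mu1 setT \is a fin_num) (fin2 : mu2 setT \is a fin_num)
  (M : cLp mu1 p1 -> cLp mu2 p1 -> Prop) (C : set T1) D D' :
  sphere_corr M -> norm_corr (-1) M -> matched M C D -> measurable D' ->
  ~ {ae mu2, forall x, ~ D' x} -> {ae mu2, forall x, D' x -> D x} ->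
  exists2 C', matched M C' D' & {ae mu1, forall x, C' x -> C x}.
Proof.
move=> cM nM CD mD' D'0 D'D.
have [C' /matched_swap C'D'] := matched_exists fin2 fin1 (sphere_corr_swap cM)
  (norm_corr_swap nM) mD' D'0.
exists C' => //.
pose A := C' `\` C; have [mC _ _] := CD; have [mC' _ _] := C'D'.
have mA : measurable A by exact: measurableD.
have [A0|A0] := pselect {ae mu1, forall x, ~ A x}.
  by apply: filterS A0 => x h Dx; apply: contrapT => Bx; apply: h.
have [B AB] := matched_exists fin1 fin2 cM nM mA A0.
have h1 : {ae mu2, forall x, ~ (B `&` D) x}.
  by apply: (matched_disj fin1 fin2 cM nM AB CD); apply: aeW => x [[_]].
have h2 : {ae mu1, forall x, ~ (A `&` C') x}.
  apply: (matched_disj fin2 fin1 (sphere_corr_swap cM) (norm_corr_swap nM)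
    (matched_swap AB) (matched_swap C'D')).
  by apply: filterS2 h1 D'D => x h h' [Bx /h'] Dx; apply: h.
exfalso; apply: A0; apply: filterS h2 => x h Ax; apply: h; split=> //.
by case: Ax.
Qed.

(** Levels below 1/2 are reduced to the other half: if F > c' on a non-null part
    of D, then the lower bound c' < 1/2 is transported back to a non-null part
    of C, against f <= c. *)
Lemma level_le d1 (T1 : measurableType d1) d2 (T2 : measurableType d2)
  (mu1 : {measure set T1 -> \bar R}) (mu2 : {measure set T2 -> \bar R})
  (fin1 : mu1 setT \is a fin_num) (fin2 : mu2 setT \is a fin_num)
  (M : cLp mu1 p1 -> cLp mu2 p1 -> Prop) (C : set T1) D f F (c c' : R) :
  sphere_corr M -> norm_corr (-1) M -> matched M C D -> M f F -> c < c' ->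
  {ae mu1, forall x, C x -> rho f x <= c} ->
  {ae mu2, forall x, D x -> rho F x <= c'}.
Proof.
move=> cM nM CD mf cc' fc; have [pf pF] : pos_unit f /\ pos_unit F.
  by have [h _ _] := cM; exact: h.
have [h|h] := leP 1 (c' + c').
  apply: (level_le_strong fin1 fin2 cM nM CD mf h).
  by apply: filterS fc => x h' /h' /le_trans; apply; exact: ltW.
pose D' := D `&` [set x | c' < rho F x]; have [mC mD _] := CD.
have mD' : measurable D'.
  by apply: measurableI => //; apply: measurable_ltset => //; exact: measurable_Re.
have [D'0|D'0] := pselect {ae mu2, forall x, ~ D' x}.
  by apply: filterS D'0 => x h' Dx; rewrite leNgt; apply/negP => ?; apply: h'.
have [|C' C'D' C'C] := matched_subset fin1 fin2 cM nM CD mD' D'0.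
  by apply: aeW => x [].
have [C'0 _] := matched_neq0 fin1 fin2 cM C'D'.
have fc' : {ae mu1, forall x, C' x -> c' <= rho f x}.
  apply: (level_ge_strong fin2 fin1 (sphere_corr_swap cM) (norm_corr_swap nM)
    (matched_swap C'D') mf (ltW h)).
  by apply: aeW => x [_ /ltW].
exfalso; apply: C'0; apply: filterS3 fc fc' C'C => x h1 h2 h3 C'x.
by have := h1 (h3 C'x); have := h2 C'x; lra.
Qed.

(** Symmetric to the case of upper bounds. *)
Lemma level_ge d1 (T1 : measurableType d1) d2 (T2 : measurableType d2)
  (mu1 : {measure set T1 -> \bar R}) (mu2 : {measure set T2 -> \bar R})
  (fin1 : mu1 setT \is a fin_num) (fin2 : mu2 setT \is a fin_num)
  (M : cLp mu1 p1 -> cLp mu2 p1 -> Prop) (C : set T1) D f F (c c' : R) :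
  sphere_corr M -> norm_corr (-1) M -> matched M C D -> M f F -> c' < c ->
  {ae mu1, forall x, C x -> c <= rho f x} ->
  {ae mu2, forall x, D x -> c' <= rho F x}.
Proof.
move=> cM nM CD mf cc' fc; have [pf pF] : pos_unit f /\ pos_unit F.
  by have [h _ _] := cM; exact: h.
have [h|h] := leP (c' + c') 1.
  apply: (level_ge_strong fin1 fin2 cM nM CD mf h).
  by apply: filterS fc => x h' /h'; apply: le_trans; exact: ltW.
pose D' := D `&` [set x | rho F x < c']; have [mC mD _] := CD.
have mD' : measurable D'.
  by apply: measurableI => //; apply: measurable_ltset => //; exact: measurable_Re.
have [D'0|D'0] := pselect {ae mu2, forall x, ~ D' x}.
  by apply: filterS D'0 => x h' Dx; rewrite leNgt; apply/negP => ?; apply: h'.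
have [|C' C'D' C'C] := matched_subset fin1 fin2 cM nM CD mD' D'0.
  by apply: aeW => x [].
have [C'0 _] := matched_neq0 fin1 fin2 cM C'D'.
have fc' : {ae mu1, forall x, C' x -> rho f x <= c'}.
  apply: (level_le_strong fin2 fin1 (sphere_corr_swap cM) (norm_corr_swap nM)
    (matched_swap C'D') mf (ltW h)).
  by apply: aeW => x [_ /ltW].
exfalso; apply: C'0; apply: filterS3 fc fc' C'C => x h1 h2 h3 C'x.
by have := h1 (h3 C'x); have := h2 C'x; lra.
Qed.

(** If G <= q < q' <= a F on a non-null set B', both bounds are transported to
    the set matching B', up to a loss smaller than (q' - q) / 2, and contradict
    a f <= g there. *)
Lemma order_match_sup_half d1 (T1 : measurableType d1) d2 (T2 : measurableType d2)
  (mu1 : {measure set T1 -> \bar R}) (mu2 : {measure set T2 -> \bar R})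
  (fin1 : mu1 setT \is a fin_num) (fin2 : mu2 setT \is a fin_num)
  (M : cLp mu1 p1 -> cLp mu2 p1 -> Prop) (A : set T1) B f F g G (a : R) :
  sphere_corr M -> norm_corr (-1) M -> matched M A B -> M f F -> M g G ->
  0 <= a -> below1 a f g A -> below2 a F G B.
Proof.
move=> cM nM AB mf mg; rewrite /below1 /below2.
have [pf pF] : pos_unit f /\ pos_unit F by have [h _ _] := cM; exact: h.
have [pg pG] : pos_unit g /\ pos_unit G by have [h _ _] := cM; exact: h.
rewrite le_eqVlt => /predU1P[<- _|a0 fg].
  by apply: filterS (pos_unit_le1 pG) => x /andP[h _] _; rewrite mul0r.
apply: ae_le_rat => q q' qq'.
have [_ mB _] := AB.
pose B' := B `&` (~` [set x | ratr q < rho G x] `&` ~` [set x | a * rho F x < ratr q']).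
have mB' : measurable B'.
  apply: measurableI => //; apply: measurableI; apply: measurableC;
    apply: measurable_ltset => //; try exact: measurable_Re.
  by apply: measurable_funM => //; exact: measurable_Re.
have [B'0|B'0] := pselect {ae mu2, forall x, ~ B' x}.
  apply: filterS B'0 => x h Bx h1 h2; apply: h; split=> //; split=> /=;
    by apply/negP; rewrite -leNgt.
exfalso.
have [|A' A'B' A'A] := matched_subset fin1 fin2 cM nM AB mB' B'0.
  by apply: aeW => x [].
have [A'0 _] := matched_neq0 fin1 fin2 cM A'B'.
have {}qq' : ratr q < ratr q' :> R by rewrite ltr_rat.
(* each of the two transported bounds loses del, and 2 del < q' - q *)
pose del : R := (ratr q' - ratr q) / 3.
have d0 : 0 < del by rewrite divr_gt0 ?subr_gt0.
have h1 : {ae mu1, forall x, A' x -> rho g x <= ratr q + del}.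
  apply: (level_le fin2 fin1 (sphere_corr_swap cM) (norm_corr_swap nM)
    (matched_swap A'B') mg (c := ratr q)); first by rewrite ltrDl.
  by apply: aeW => x [_ [/negP + _]]; rewrite -leNgt.
have h2 : {ae mu1, forall x, A' x -> (ratr q' - del) / a <= rho f x}.
  apply: (level_ge fin2 fin1 (sphere_corr_swap cM) (norm_corr_swap nM)
    (matched_swap A'B') mf (c := ratr q' / a)).
    by rewrite ltr_pM2r ?invr_gt0// gtrDl oppr_lt0.
  apply: aeW => x [_ [_ /negP h]]; rewrite ler_pdivrMr// mulrC leNgt.
  exact: h.
apply: A'0; apply: filterS3 fg (filterI h1 h2) A'A => x h [h3 h4] h5 A'x.
have := h4 A'x; rewrite ler_pdivrMr// mulrC => h6.
have := h3 A'x; have := h (h5 A'x); move: h6 qq'; rewrite /del; lra.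
Qed.

Theorem order_match_sup d1 (T1 : measurableType d1) d2 (T2 : measurableType d2)
  (mu1 : {measure set T1 -> \bar R}) (mu2 : {measure set T2 -> \bar R})
  (fin1 : mu1 setT \is a fin_num) (fin2 : mu2 setT \is a fin_num)
  (M : cLp mu1 p1 -> cLp mu2 p1 -> Prop) :
  sphere_corr M -> norm_corr (-1) M ->
  forall B, measurable B -> exists2 A, measurable A & order_match M A B.
Proof.
move=> cM nM B mB.
have [B0|B0] := pselect {ae mu2, forall x, ~ B x}.
  exists set0 => // f F g G a _ _ _; split=> _; last exact: aeW.
  by apply: filterS B0 => x h /h.
have [A /matched_swap AB] := matched_exists fin2 fin1 (sphere_corr_swap cM)
  (norm_corr_swap nM) mB B0.
exists A; first by case: AB.
move=> f F g G a mf mg a0; split=> h.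
  exact: (order_match_sup_half fin1 fin2 cM nM AB mf mg a0 h).
exact: (order_match_sup_half fin2 fin1 (sphere_corr_swap cM)
  (norm_corr_swap nM) (matched_swap AB) mf mg a0 h).
Qed.

End infinite_exponent_levels.

(** Kept from unfolding by simplification, which would break up products with
    the imaginary unit into components. *)
Definition imag_unit (R : realType) : R[i] := 0 +i* 1.
Arguments imag_unit R : simpl never.

Lemma imag_unit_sqr (R : realType) : imag_unit R * imag_unit R = -1.
Proof. by apply/eqP; rewrite eq_complex/=; apply/andP; split; apply/eqP; ring. Qed.

Lemma imag_unit_decomp (R : realType) (z : R[i]) : z = (complex.Re z)%:C + imag_unit R * (complex.Im z)%:C.
Proof. by case: z => a b; apply/eqP; rewrite eq_complex/=; apply/andP; split; apply/eqP; ring. Qed.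

(** * From additive maps on the cone to linear operators *)

Section positive_parts.
Context d (T : measurableType d) (R : realType).
Variable mu : {measure set T -> \bar R}.
Variables (p : \bar R) (p1 : (1 <= p)%E).
Local Notation E := (cLp mu p1).
Implicit Types (x y a b c e : E).

Definition ppart x : E := toLp mu p1 (fun t => (Num.max (complex.Re (x t)) 0)%:C).

Lemma ppartE x : {ae mu, forall t, ppart x t = (Num.max (complex.Re (x t)) 0)%:C}.
Proof.
apply: toLpE; apply: (@inLp_real_le _ _ _ _ _ _ _ x) => //.
  by apply: measurable_maxr => //; exact: measurable_Re.
move=> t; rewrite ger0_norm ?le_max ?lexx ?orbT// ge_max normc_ge0 andbT.
exact: le_trans (ler_norm _) (normr_Re_le _).
Qed.

Lemma ppart_pos x : cLp_pos (ppart x).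
Proof. by apply: filterS (ppartE x) => t ->; rewrite lecR le_max lexx orbT. Qed.

(** The real part of x as a difference of two elements of the cone, which is the
    form in which a map defined on the cone can be applied to it. *)
Definition repart x : E := ppart x - ppart (- x).

Lemma repartE x : {ae mu, forall t, repart x t = (complex.Re (x t))%:C}.
Proof.
apply: filterS3 (cLp_funB (ppart x) (ppart (- x))) (ppartE x)
  (filterI (ppartE (- x)) (cLp_funN x)) => t -> -> [-> ->].
rewrite -rmorphB; congr (_%:C).
have -> : complex.Re (- x t) = - complex.Re (x t) by case: (x t).
by case: (leP (complex.Re (x t)) 0); case: (leP (- complex.Re (x t)) 0); lra.
Qed.

Lemma cLp_decomp x : x = repart x + (imag_unit R) *: repart ((- imag_unit R) *: x).
Proof.
apply/cLp_eqP.
apply: filterS3 (cLp_funD (repart x) ((imag_unit R) *: repart ((- imag_unit R) *: x))) (repartE x)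
  (filterI (repartE ((- imag_unit R) *: x)) (filterI (cLp_funZ (- imag_unit R) x)
    (cLp_funZ (imag_unit R) (repart ((- imag_unit R) *: x))))) => t -> -> [h1 [h2 ->]].
rewrite h1 h2 {1}[x t]imag_unit_decomp; congr (_ + _ * _%:C).
by case: (x t) => u v; rewrite Defs.ReM /=; ring.
Qed.

Definition cabs x : E := toLp mu p1 (fun t => (normc (x t))%:C).

Lemma cabsE x : {ae mu, forall t, cabs x t = (normc (x t))%:C}.
Proof.
apply: toLpE; apply: (@inLp_real_le _ _ _ _ _ _ _ x) => //.
  exact: measurable_normu.
by move=> t; rewrite ger0_norm ?normc_ge0.
Qed.

Lemma cabs_pos x : cLp_pos (cabs x).
Proof. by apply: filterS (cabsE x) => t ->; rewrite lecR normc_ge0. Qed.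

Lemma cabs_norm x : cLp_norm (cabs x) = cLp_norm x.
Proof.
apply: eq_cLp_norm; apply: filterS (cabsE x) => t ->.
by rewrite normc_real ger0_norm ?normc_ge0.
Qed.

Lemma pos_real x : cLp_pos x -> {ae mu, forall t, complex.Im (x t) = 0}.
Proof. by apply: filterS => t; rewrite cge0P => /andP[/eqP]. Qed.

(** Uniqueness of real and imaginary parts. *)
Lemma real_split a b c e : {ae mu, forall t, complex.Im (a t) = 0} ->
  {ae mu, forall t, complex.Im (b t) = 0} ->
  {ae mu, forall t, complex.Im (c t) = 0} ->
  {ae mu, forall t, complex.Im (e t) = 0} ->
  a + (imag_unit R) *: b = c + (imag_unit R) *: e -> a = c /\ b = e.
Proof.
move=> a0 b0 c0 e0 /cLp_eqP H.
have {}H : {ae mu, forall t, a t + imag_unit R * b t = c t + imag_unit R * e t}.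
  apply: filterS3 H (filterI (cLp_funD a ((imag_unit R) *: b)) (cLp_funD c ((imag_unit R) *: e)))
    (filterI (cLp_funZ (imag_unit R) b) (cLp_funZ (imag_unit R) e)) => t.
  by move=> + [h1 h2] [h3 h4]; rewrite h1 h2 h3 h4.
have {}H : {ae mu, forall t, a t = c t /\ b t = e t}.
  apply: filterS3 H (filterI a0 b0) (filterI c0 e0) => t.
  move=> + [/= h1 h2] [/= h3 h4]; move: h1 h2 h3 h4.
  case: (a t) (b t) (c t) (e t) => [a1 a2] [b1 b2] [c1 c2] [e1 e2] /=.
  move=> -> -> -> -> -[].
  rewrite !mul0r !mul1r !subr0 !addr0 !add0r.
  by move=> -> ->.
by split; apply/cLp_eqP; apply: filterS H => t [].
Qed.

Lemma pos_diff_real x y : cLp_pos x -> cLp_pos y ->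
  {ae mu, forall t, complex.Im ((x - y : E) t) = 0}.
Proof.
move=> x0 y0; apply: filterS3 (cLp_funB x y) (pos_real x0) (pos_real y0) => t ->.
by case: (x t) (y t) => [a b] [c e] /= -> ->; rewrite subrr.
Qed.

End positive_parts.

Section additive_extension.
Context d1 (T1 : measurableType d1) d2 (T2 : measurableType d2) (R : realType).
Variables (mu1 : {measure set T1 -> \bar R}) (mu2 : {measure set T2 -> \bar R}).
Variables (p : \bar R) (p1 : (1 <= p)%E).
Local Notation E1 := (cLp mu1 p1).
Local Notation E2 := (cLp mu2 p1).
Variable D : E1 -> E2.
Hypothesis Dpos : forall x, cLp_pos x -> cLp_pos (D x).
Hypothesis DD : forall x y, cLp_pos x -> cLp_pos y -> D (x + y) = D x + D y.
Hypothesis DZ : forall (c : R) x, 0 <= c -> cLp_pos x -> D (c%:C *: x) = c%:C *: D x.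

Let D0 : D 0 = 0.
Proof.
have := DZ (lexx 0) (cLp_pos0 mu1 p1).
by rewrite (_ : 0%:C = 0 :> R[i])// !scale0r.
Qed.

Definition cone_extension (x : E1) : E2 :=
  (D (ppart x) - D (ppart (- x))) +
  (imag_unit R) *: (D (ppart ((- imag_unit R) *: x)) - D (ppart (- ((- imag_unit R) *: x)))).

(** Any decomposition of x into four elements of the cone computes the extension,
    so that linearity can be checked by choosing convenient decompositions. *)
Lemma cone_extensionE x a b c e : cLp_pos a -> cLp_pos b -> cLp_pos c ->
  cLp_pos e -> x = (a - b) + (imag_unit R) *: (c - e) ->
  cone_extension x = (D a - D b) + (imag_unit R) *: (D c - D e).
Proof.
move=> a0 b0 c0 e0 xE.
have := cLp_decomp x; rewrite {1}xE => /real_split[].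
- exact: pos_diff_real.
- exact: pos_diff_real.
- by apply: pos_diff_real; exact: ppart_pos.
- by apply: pos_diff_real; exact: ppart_pos.
rewrite /repart.
have H (u v u' v' : E1) : cLp_pos u -> cLp_pos v -> cLp_pos u' -> cLp_pos v' ->
    u - v = u' - v' -> D u' - D v' = D u - D v.
  move=> pu pv pu' pv' /eqP; rewrite subr_eq addrAC eq_sym subr_eq => /eqP h.
  apply/eqP; rewrite subr_eq addrAC eq_sym subr_eq -!DD// eq_sym.
  exact/eqP/(congr1 D).
move=> /H h1 /H h2; rewrite /cone_extension h1 ?h2//; exact: ppart_pos.
Qed.

Lemma cone_extension_pos x : cLp_pos x -> cone_extension x = D x.
Proof.
move=> x0; have z0 := cLp_pos0 mu1 p1.
by rewrite (cone_extensionE x0 z0 z0 z0) ?D0 !subr0 ?scaler0 ?addr0.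
Qed.

Lemma cone_extension_linear : linear cone_extension.
Proof.
have dec (x : E1) : exists q : E1 * E1 * (E1 * E1),
    [/\ cLp_pos q.1.1, cLp_pos q.1.2, cLp_pos q.2.1 & cLp_pos q.2.2] /\
    x = (q.1.1 - q.1.2) + (imag_unit R) *: (q.2.1 - q.2.2).
  exists ((ppart x, ppart (- x)), (ppart ((- imag_unit R) *: x), ppart (- ((- imag_unit R) *: x)))).
  by split; [split; exact: ppart_pos|exact: cLp_decomp].
have addE x y : cone_extension (x + y) = cone_extension x + cone_extension y.
  have [[[a b] [c e]] /= [[pa pb pc pe] xE]] := dec x.
  have [[[a' b'] [c' e']] /= [[pa' pb' pc' pe'] yE]] := dec y.
  rewrite (cone_extensionE pa pb pc pe xE) (cone_extensionE pa' pb' pc' pe' yE).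
  rewrite (@cone_extensionE _ (a + a') (b + b') (c + c') (e + e'));
    try exact: cLp_posD.
    rewrite !DD// addrACA -scalerDr; congr (_ + (imag_unit R) *: _); by rewrite opprD addrACA.
  by rewrite xE yE addrACA -scalerDr; congr (_ + (imag_unit R) *: _); rewrite opprD addrACA.
have scaleE (r : R) x : 0 <= r -> cone_extension (r%:C *: x) = r%:C *: cone_extension x.
  move=> r0; have [[[a b] [c e]] /= [[pa pb pc pe] xE]] := dec x.
  rewrite (cone_extensionE pa pb pc pe xE).
  rewrite (@cone_extensionE _ (r%:C *: a) (r%:C *: b) (r%:C *: c) (r%:C *: e));
    try exact: cLp_posZ.
    rewrite !DZ// -!scalerBr [RHS]scalerDr.
    by rewrite !scalerA [imag_unit R * _]mulrC.
  rewrite xE -!scalerBr [LHS]scalerDr.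
  by rewrite !scalerA [imag_unit R * _]mulrC.
have oppE x : cone_extension (- x) = - cone_extension x.
  have [[[a b] [c e]] /= [[pa pb pc pe] xE]] := dec x.
  rewrite (cone_extensionE pa pb pc pe xE) (cone_extensionE pb pa pe pc).
    by rewrite opprD -scalerN !opprB.
  by rewrite xE opprD -scalerN !opprB.
have imE x : cone_extension ((imag_unit R) *: x) = (imag_unit R) *: cone_extension x.
  have [[[a b] [c e]] /= [[pa pb pc pe] xE]] := dec x.
  have ii : imag_unit R * imag_unit R = -1 :> R[i] by exact: imag_unit_sqr.
  rewrite (cone_extensionE pa pb pc pe xE) (cone_extensionE pe pc pa pb).
    by rewrite [RHS]scalerDr scalerA ii scaleN1r addrC opprB.
  by rewrite xE [LHS]scalerDr scalerA ii scaleN1r addrC opprB.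
have realE (r : R) x : cone_extension (r%:C *: x) = r%:C *: cone_extension x.
  have [r0|r0] := leP 0 r; first exact: scaleE.
  have nr0 : 0 <= - r by rewrite oppr_ge0 ltW.
  have := scaleE _ x nr0; rewrite rmorphN !scaleNr oppE => /eqP.
  by rewrite eqr_opp => /eqP.
move=> l x y; rewrite addE; congr (_ + _).
rewrite [in LHS](imag_unit_decomp l) [in RHS](imag_unit_decomp l) !scalerDl addE -!scalerA.
by rewrite imE !realE.
Qed.

End additive_extension.

(** * Positive operators and moduli *)

Section positive_operators.
Context d1 (T1 : measurableType d1) d2 (T2 : measurableType d2) (R : realType).
Variables (mu1 : {measure set T1 -> \bar R}) (mu2 : {measure set T2 -> \bar R}).
Variables (p : \bar R) (p1 : (1 <= p)%E).
Local Notation E1 := (cLp mu1 p1).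
Local Notation E2 := (cLp mu2 p1).

(** A complex number is bounded by g as soon as all its real linear functionals
    are bounded accordingly; countably many functionals suffice, which is what
    makes the argument usable almost everywhere. *)
Lemma normc_le_rat (z : R[i]) (g : R) :
  (forall s t : rat, ratr s * complex.Re z + ratr t * complex.Im z <=
    normc (ratr s +i* ratr t) * g) -> normc z <= g.
Proof.
move=> H; set a := complex.Re z in H; set b := complex.Im z in H.
set n := normc z; have n0 : 0 <= n by exact: normc_ge0.
have n2 : n * n = a ^+ 2 + b ^+ 2.
  by rewrite -expr2 /n normcE2 sqr_sqrtr// addr_ge0 ?sqr_ge0.
have g0 : 0 <= g.
  have := H 1 0; have := H (-1) 0; rewrite !rmorphN1 !rmorph1 !rmorph0 !normcE2/=.
  rewrite sqrrN !expr1n expr0n/= addr0 sqrtr1 !mul0r !mul1r; lra.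
rewrite leNgt; apply/negP => gn.
have np : 0 < n by exact: le_lt_trans gn.
(* the rational approximation of z must be so good that the error terms, which
   are bounded by e K, stay below n (n - g) *)
pose K : R := `|a| + `|b| + 2 * g + 1.
have K0 : 0 < K by rewrite ltr_wpDl// !addr_ge0// mulr_ge0.
pose e : R := n * (n - g) / K.
have e0 : 0 < e by rewrite divr_gt0// mulr_gt0// subr_gt0.
have ae : a < a + e by rewrite ltrDl.
have be : b < b + e by rewrite ltrDl.
have [s] := rat_in_itvoo ae; have [t] := rat_in_itvoo be.
rewrite !in_itv/= => /andP[bt te] /andP[sa se].
have h1 : normc (ratr s +i* ratr t) <= n + (e + e).
  have -> : ratr s +i* ratr t = z + ((ratr s - a)%:C + (0 +i* 1) * (ratr t - b)%:C).
    apply/eqP; rewrite eq_complex ReD ImD/= -/a -/b; apply/andP.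
    by split; apply/eqP; ring.
  rewrite (le_trans (le_normcD _ _))// lerD2l (le_trans (le_normcD _ _))//.
  rewrite normcM !normc_real [normc (0 +i* 1)]normcE2/= expr0n expr1n add0r sqrtr1 mul1r.
  by rewrite lerD// ger0_norm; lra.
have h2 : n * n - e * (`|a| + `|b|) <= ratr s * a + ratr t * b.
  have x1 : - (e * `|a|) <= (ratr s - a) * a.
    rewrite lerNl -mulNr (le_trans (ler_norm _))// normrM normrN ler_wpM2r//.
    by rewrite ger0_norm; lra.
  have x2 : - (e * `|b|) <= (ratr t - b) * b.
    rewrite lerNl -mulNr (le_trans (ler_norm _))// normrM normrN ler_wpM2r//.
    by rewrite ger0_norm; lra.
  by rewrite n2 !expr2; move: x1 x2; rewrite !mulrBl mulrDr; lra.
have h3 : n * n - e * (`|a| + `|b|) <= (n + (e + e)) * g.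
  by rewrite (le_trans h2)// (le_trans (H s t))// ler_wpM2r.
have eK : e * K = n * (n - g) by rewrite /e divfK// gt_eqF.
move: h3 eK e0; rewrite /K; clear; nra.
Qed.

Variable Phi : E1 -> E2.
Hypothesis lin : linear Phi.
Hypothesis Ppos : forall x, cLp_pos x -> cLp_pos (Phi x).
Hypothesis Pnorm : forall x, cLp_pos x -> cLp_norm (Phi x) = cLp_norm x.

Let PD := linD lin.
Let PZ := linZ lin.

Let PN x : Phi (- x) = - Phi x.
Proof. by rewrite -scaleN1r PZ scaleN1r. Qed.

Lemma positive_operator_repart x :
  {ae mu2, forall t, Phi (repart x) t = (complex.Re (Phi x t))%:C /\
    Phi (repart (- imag_unit R *: x)) t = (complex.Im (Phi x t))%:C}.
Proof.
have real y : {ae mu2, forall t, complex.Im (Phi (repart y) t) = 0}.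
  rewrite /repart PD PN; apply: pos_diff_real; apply: Ppos; exact: ppart_pos.
have E : Phi x = Phi (repart x) + imag_unit R *: Phi (repart (- imag_unit R *: x)).
  by rewrite -PZ -PD -cLp_decomp.
apply: filterS3 (real x) (real (- imag_unit R *: x)) (filterI
  (cLp_funD (Phi (repart x)) (imag_unit R *: Phi (repart (- imag_unit R *: x))))
  (cLp_funZ (imag_unit R) (Phi (repart (- imag_unit R *: x))))) => t.
rewrite -E => h1 h2 [-> ->]; move: h1 h2.
case: (Phi (repart x) t) => a b; case: (Phi _ t) => c e /= -> ->.
by split; apply/eqP; rewrite eq_complex/= eqxx andbT; apply/eqP; ring.
Qed.

(** For real s and t the element |s + i t| |x| - s Re x - t Im x is positive, hence
    so is its image; taking the supremum over rational s and t bounds the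
    modulus of the image of x. *)
Lemma positive_operator_modulus x :
  {ae mu2, forall t, normc (Phi x t) <= complex.Re (Phi (cabs x) t)}.
Proof.
have H (s t : R) : {ae mu2, forall v,
    s * complex.Re (Phi x v) + t * complex.Im (Phi x v) <=
    normc (s +i* t) * complex.Re (Phi (cabs x) v)}.
  pose z := (normc (s +i* t : R[i]))%:C *: cabs x +
    (- (s)%:C *: repart x + - (t)%:C *: repart (- imag_unit R *: x)) : E1.
  have zpos : cLp_pos z.
    apply: filterS3 (filterI (cLp_funD ((normc (s +i* t : R[i]))%:C *: cabs x)
       (- (s)%:C *: repart x + - (t)%:C *: repart (- imag_unit R *: x)))
       (cLp_funD (- (s)%:C *: repart x) (- (t)%:C *: repart (- imag_unit R *: x))))
      (filterI (filterI (cLp_funZ (normc (s +i* t : R[i]))%:C (cabs x)) (cabsE x))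
        (filterI (cLp_funZ (- (s)%:C) (repart x)) (repartE x)))
      (filterI (filterI (cLp_funZ (- (t)%:C) (repart (- imag_unit R *: x)))
        (repartE (- imag_unit R *: x))) (cLp_funZ (- imag_unit R) x)) => v.
    move=> [e1 e2] [[e3 e4] [e5 e6]] [[e7 e8] e9].
    rewrite /z e1 e2 e3 e4 e5 e6 e7 e8 e9.
    rewrite -!rmorphN -!rmorphM -!rmorphD lecR.
    have -> : complex.Re (- imag_unit R * x v) = complex.Im (x v).
      by case: (x v) => a b; rewrite Defs.ReM/=; ring.
    rewrite !mulNr -opprD subr_ge0 -normcM.
    apply: (@le_trans _ _ (complex.Re ((s -i* t) * x v))).
      by rewrite Defs.ReM /= mulNr opprK.
    apply: le_trans (ler_norm _) (le_trans (normr_Re_le _) _).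
    by rewrite !normcM !normcE2/= sqrrN.
  have := Ppos zpos; rewrite /z !PD !PZ => pz.
  apply: filterS3 (filterI pz (cLp_funD ((normc (s +i* t : R[i]))%:C *: Phi (cabs x))
       (- (s)%:C *: Phi (repart x) + - (t)%:C *: Phi (repart (- imag_unit R *: x)))))
    (filterI (cLp_funD (- (s)%:C *: Phi (repart x)) (- (t)%:C *: Phi (repart (- imag_unit R *: x))))
      (filterI (cLp_funZ (normc (s +i* t : R[i]))%:C (Phi (cabs x)))
        (filterI (cLp_funZ (- (s)%:C) (Phi (repart x)))
          (cLp_funZ (- (t)%:C) (Phi (repart (- imag_unit R *: x)))))))
    (filterI (positive_operator_repart x) (Ppos (cabs_pos x))) => v.
  move=> [e0 e1] [e2 [e3 [e4 e5]]] [[e6 e7] e8].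
  move: e0; rewrite e1 e2 e3 e4 e5 e6 e7 {1}(cge0E e8).
  by rewrite -!rmorphN -!rmorphM -!rmorphD lecR !mulNr -opprD subr_ge0.
have : {ae mu2, forall v, forall st : rat * rat,
    ratr st.1 * complex.Re (Phi x v) + ratr st.2 * complex.Im (Phi x v) <=
    normc (ratr st.1 +i* ratr st.2) * complex.Re (Phi (cabs x) v)}.
  by apply: ae_countable => -[s t]; exact: H.
by apply: filterS => v h; apply: normc_le_rat => s t; exact: (h (s, t)).
Qed.

Lemma positive_operator_contraction x : cLp_norm (Phi x) <= cLp_norm x.
Proof.
rewrite -(cabs_norm x) -Pnorm; last exact: cabs_pos.
apply: le_cLp_norm; apply: filterS2 (positive_operator_modulus x)
  (Ppos (cabs_pos x)) => t h1 h2.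
by rewrite [leRHS]normc_ge0E.
Qed.

End positive_operators.

(** * Extension of sphere maps *)

Section rational_splitting.
Context {R : realType}.

(** If s + t < u there are rational fractions of u of total weight less than 1
    above s and t. *)
Lemma split_below (s t u : R) : 0 <= s -> 0 <= t -> s + t < u ->
  exists q q' : rat, [/\ s <= ratr q * u, t <= ratr q' * u,
    0 <= ratr q :> R, 0 <= ratr q' :> R & ratr q + ratr q' < 1 :> R].
Proof.
move=> s0 t0 stu; have u0 : 0 < u by lra.
pose e : R := (u - s - t) / u / 3.
have e0 : 0 < e by rewrite !divr_gt0//; lra.
have l1 : s / u < s / u + e by rewrite ltrDl.
have l2 : t / u < t / u + e by rewrite ltrDl.
have [q] := rat_in_itvoo l1; have [q'] := rat_in_itvoo l2.
rewrite !in_itv/= => /andP[a1 a2] /andP[b1 b2]; exists q, q'.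
have su0 : 0 <= s / u by rewrite divr_ge0// ltW.
have tu0 : 0 <= t / u by rewrite divr_ge0// ltW.
have E : s / u + t / u + (e + e + e) = 1.
  by rewrite /e; field; rewrite gt_eqF.
split; first by rewrite -ler_pdivrMr// ltW.
- by rewrite -ler_pdivrMr// ltW.
- by rewrite ltW// (le_lt_trans su0).
- by rewrite ltW// (le_lt_trans tu0).
- lra.
Qed.

Lemma split_above (s t u : R) : 0 <= s -> 0 <= t -> 0 <= u -> u < s + t ->
  exists q q' : rat, [/\ ratr q * u <= s, ratr q' * u <= t
    & 1 < ratr q + ratr q' :> R].
Proof.
move=> s0 t0; rewrite le_eqVlt => /predU1P[<- st|u0 stu].
  by exists 1, 1; rewrite !rmorph1 mulr0; split => //; lra.
(* q and q' may fall short of s / u and t / u by e each; the remaining third of the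
   relative excess makes their sum exceed 1 *)
pose e : R := (s + t - u) / u / 3.
have e0 : 0 < e by rewrite !divr_gt0//; lra.
have l1 : s / u - e < s / u by rewrite ltrBlDr ltrDl.
have l2 : t / u - e < t / u by rewrite ltrBlDr ltrDl.
have [q] := rat_in_itvoo l1; have [q'] := rat_in_itvoo l2.
rewrite !in_itv/= => /andP[a1 a2] /andP[b1 b2]; exists q, q'.
have E : s / u + t / u - (e + e + e) = 1.
  by rewrite /e; field; rewrite gt_eqF.
split; first by rewrite -ler_pdivlMr// ltW.
- by rewrite -ler_pdivlMr// ltW.
- lra.
Qed.

End rational_splitting.

Section cone_map.
Context d1 (T1 : measurableType d1) d2 (T2 : measurableType d2) (R : realType).
Variables (mu1 : {measure set T1 -> \bar R}) (mu2 : {measure set T2 -> \bar R}).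
Variables (p : \bar R) (p1 : (1 <= p)%E).
Local Notation E1 := (cLp mu1 p1).
Local Notation E2 := (cLp mu2 p1).
Variable M : E1 -> E2 -> Prop.
Hypothesis cM : sphere_corr M.
Hypothesis matchM : forall B, measurable B ->
  exists2 A, measurable A & order_match M A B.
Local Notation rho f x := (complex.Re (cLp_fun f x)).

(** Reflexivity of the order is transported to F <= F' and F' <= F. *)
Lemma corr_functional f F F' : M f F -> M f F' -> F = F'.
Proof.
move=> m m'; have [A mA AB] := matchM measurableT.
have [Mdom _ _] := cM; have [_ [F0 _]] := Mdom _ _ m; have [_ [F'0 _]] := Mdom _ _ m'.
have h : below1 1 f f A by apply: aeW => x _; rewrite mul1r.
have h1 := (AB _ _ _ _ 1 m m' ler01).1 h.
have h2 := (AB _ _ _ _ 1 m' m ler01).1 h.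
rewrite /below2 in h1 h2.
apply/cLp_eqP; apply: filterS3 (filterI h1 h2) F0 F'0 => x [].
move=> /(_ Logic.I) + /(_ Logic.I); rewrite !mul1r => l1 l2 /cge0E-> /cge0E->.
by congr (_%:C); apply/eqP; rewrite eq_le l1.
Qed.

(** The positively homogeneous extension from the sphere to the cone.  The choice
    operator is harmless because the correspondence is functional. *)
Definition cone_map (x : E1) : E2 :=
  (cLp_norm x)%:C *: xget 0 [set y | M ((cLp_norm x)^-1%:C *: x) y].

Lemma cone_map0 : cone_map 0 = 0.
Proof. by rewrite /cone_map cLp_norm0 scale0r. Qed.

Lemma cone_mapP x : cLp_pos x -> x <> 0 -> exists F,
  M ((cLp_norm x)^-1%:C *: x) F /\ cone_map x = (cLp_norm x)%:C *: F.
Proof.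
move=> x0 xn0; have [_ Mtot _] := cM.
have [F mF] := Mtot _ (pos_unit_scale x0 xn0).
rewrite /cone_map; case: xgetP => [y _ my|/(_ F)//].
by exists y.
Qed.

Lemma cLp_norm_gt0 d (T : measurableType d) (mu : {measure set T -> \bar R})
  (x : cLp mu p1) : x <> 0 -> 0 < cLp_norm x.
Proof.
move=> x0; rewrite lt_neqAle cLp_norm_ge0 andbT eq_sym.
by apply/eqP => /cLp_norm_eq0.
Qed.

Lemma cLp_norm_scaleK d (T : measurableType d) (mu : {measure set T -> \bar R})
  (x : cLp mu p1) : x <> 0 ->
  x = (cLp_norm x)%:C *: ((cLp_norm x)^-1%:C *: x).
Proof.
move=> x0; rewrite scalerA -rmorphM divff ?gt_eqF ?cLp_norm_gt0//.
by rewrite rmorph1 scale1r.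
Qed.

Lemma cone_map_sphere f F : M f F -> cone_map f = F.
Proof.
move=> m; have [Mdom _ _] := cM; have [[f0 nf] [F0 nF]] := Mdom _ _ m.
have fn0 : f <> 0 by move=> h; move: nf; rewrite h cLp_norm0 => /eqP; rewrite eq_sym oner_eq0.
have [F' []] := cone_mapP f0 fn0; rewrite nf invr1 !rmorph1 !scale1r => m' ->.
exact: corr_functional m' m.
Qed.

Lemma cone_map_pos x : cLp_pos x -> cLp_pos (cone_map x).
Proof.
move=> x0; have [->|/eqP xn0] := eqVneq x 0; first by rewrite cone_map0; exact: cLp_pos0.
have [F [m ->]] := cone_mapP x0 xn0; have [Mdom _ _] := cM.
by apply: cLp_posZ; [exact: cLp_norm_ge0|have [_ []] := Mdom _ _ m].
Qed.

Lemma cone_map_norm x : cLp_pos x -> cLp_norm (cone_map x) = cLp_norm x.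
Proof.
move=> x0; have [->|/eqP xn0] := eqVneq x 0; first by rewrite cone_map0 !cLp_norm0.
have [F [m ->]] := cone_mapP x0 xn0; have [Mdom _ _] := cM.
rewrite cLp_normZ normc_real ger0_norm ?cLp_norm_ge0//.
by have [_ [_ ->]] := Mdom _ _ m; rewrite mulr1.
Qed.

Lemma cone_mapZ (c : R) x : 0 <= c -> cLp_pos x ->
  cone_map (c%:C *: x) = c%:C *: cone_map x.
Proof.
rewrite le_eqVlt => /predU1P[<- x0|c0 x0].
  by rewrite (_ : 0%:C = 0 :> R[i])// !scale0r cone_map0.
rewrite /cone_map cLp_normZ normc_real gtr0_norm// scalerA -rmorphM.
rewrite scalerA -rmorphM invfM mulrAC mulVf ?gt_eqF// mul1r//.
Qed.

Lemma Re_cLpZ d (T : measurableType d) (mu : {measure set T -> \bar R})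
  (c : R) (x : cLp mu p1) :
  {ae mu, forall t, complex.Re ((c%:C *: x : cLp mu p1) t) = c * complex.Re (x t)}.
Proof.
by apply: filterS (cLp_funZ c%:C x) => t ->; rewrite Defs.ReM/= mul0r subr0.
Qed.

Definition above_on d (T : measurableType d) (mu : {measure set T -> \bar R})
  (x y : cLp mu p1) (A : set T) :=
  {ae mu, forall t, A t -> complex.Re (x t) <= complex.Re (y t)}.

Lemma above_on_scale d (T : measurableType d) (mu : {measure set T -> \bar R})
  (c c' : R) (x y : cLp mu p1) A : 0 <= c -> 0 < c' ->
  above_on (c%:C *: x) (c'%:C *: y) A <->
  {ae mu, forall t, A t -> c / c' * complex.Re (x t) <= complex.Re (y t)}.
Proof.
move=> c0 c'0; split; apply: filterS3 (Re_cLpZ c x) (Re_cLpZ c' y)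
  => t -> -> h /h.
  by rewrite mulrAC ler_pdivrMr// mulrC [X in _ <= X]mulrC.
by rewrite mulrAC ler_pdivrMr// [X in _ <= X]mulrC.
Qed.

(** The set-wise order relations extend from the sphere to the cone by
    homogeneity. *)
Lemma cone_map_order x y A B : cLp_pos x -> cLp_pos y -> order_match M A B ->
  above_on x y A <-> above_on (cone_map x) (cone_map y) B.
Proof.
move=> x0 y0 AB; have [->|/eqP xn0] := eqVneq x 0.
  rewrite cone_map0; split=> _.
    apply: filterS2 (cLp_fun0 mu2 p1) (cone_map_pos y0) => t -> h _.
    by move: h; rewrite cge0P => /andP[].
  apply: filterS2 (cLp_fun0 mu1 p1) y0 => t -> h _.
  by move: h; rewrite cge0P => /andP[].
have [F [m FE]] := cone_mapP x0 xn0.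
have nx := cLp_norm_gt0 xn0.
have [yE|/eqP yn0] := eqVneq y 0; last first.
  have [G [m' GE]] := cone_mapP y0 yn0.
  have ny := cLp_norm_gt0 yn0.
  rewrite FE GE {1}(cLp_norm_scaleK xn0) {1}(cLp_norm_scaleK yn0).
  rewrite !above_on_scale ?ltW//; apply: AB => //.
  by rewrite divr_ge0// ltW.
have H := AB _ _ _ _ 2 m m (ler0n R 2).
rewrite yE cone_map0 FE {1}(cLp_norm_scaleK xn0); split; rewrite {1}/above_on => h.
  have : below1 2 ((cLp_norm x)^-1%:C *: x) ((cLp_norm x)^-1%:C *: x) A.
    apply: filterS3 h (cLp_fun0 mu1 p1) (Re_cLpZ (cLp_norm x) ((cLp_norm x)^-1%:C *: x)).
    move=> t h1 h2 h3 At; move: (h1 At); rewrite h2 h3 /= pmulr_rle0//; lra.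
  move/H; apply: filterS3 (cLp_fun0 mu2 p1) (Re_cLpZ (cLp_norm x) F) => t -> -> h1 Bt.
  by have := h1 Bt; rewrite /= pmulr_rle0//; lra.
have : below2 2 F F B.
  apply: filterS3 h (cLp_fun0 mu2 p1) (Re_cLpZ (cLp_norm x) F).
  move=> t h1 h2 h3 At; move: (h1 At); rewrite h2 h3 /= pmulr_rle0//; lra.
move/H; apply: filterS3 (cLp_fun0 mu1 p1) (Re_cLpZ (cLp_norm x) ((cLp_norm x)^-1%:C *: x)) => t -> -> h1 Bt.
by have := h1 Bt; rewrite /= pmulr_rle0//; lra.
Qed.

Lemma Re_cLpD d (T : measurableType d) (mu : {measure set T -> \bar R})
  (x y : cLp mu p1) :
  {ae mu, forall t, complex.Re ((x + y : cLp mu p1) t) = complex.Re (x t) + complex.Re (y t)}.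
Proof. by apply: filterS (cLp_funD x y) => t ->; rewrite Defs.ReD. Qed.

Lemma Re_cLp_ge0 d (T : measurableType d) (mu : {measure set T -> \bar R})
  (x : cLp mu p1) : cLp_pos x -> {ae mu, forall t, 0 <= complex.Re (x t)}.
Proof. by apply: filterS => t; rewrite cge0P => /andP[]. Qed.

(** Write w = x + y, with images W, X, Y.  If X + Y < W on a non-null set, then on a
    smaller one X <= q W and Y <= q' W with rationals q + q' < 1; pulled back,
    w = x + y <= (q + q') w on the matching set, so w = 0 there and W = 0 on the
    set.  The opposite inequality is excluded in the same way. *)
Lemma cone_mapD x y : cLp_pos x -> cLp_pos y ->
  cone_map (x + y) = cone_map x + cone_map y.
Proof.
move=> x0 y0; pose w : E1 := x + y; have w0 : cLp_pos w by exact: cLp_posD.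
pose X := cone_map x; pose Y := cone_map y; pose W := cone_map w.
have X0 := cone_map_pos x0; have Y0 := cone_map_pos y0.
have W0 := cone_map_pos w0.
have mle (c : R) (U V : E2) : measurable [set t | c * rho U t <= rho V t].
  rewrite (_ : [set _ | _] = ~` [set t | rho V t < c * rho U t]).
    apply: measurableC; apply: measurable_ltset; first exact: measurable_Re.
    by apply: measurable_funM => //; exact: measurable_Re.
  by apply/seteqP; split=> t /=; rewrite leNgt => /negP.
have mle' (c : R) (U V : E2) : measurable [set t | rho U t <= c * rho V t].
  rewrite (_ : [set _ | _] = ~` [set t | c * rho V t < rho U t]).
    apply: measurableC; apply: measurable_ltset; last exact: measurable_Re.
    by apply: measurable_funM => //; exact: measurable_Re.
  by apply/seteqP; split=> t /=; rewrite leNgt => /negP.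
have up : {ae mu2, forall t, rho W t <= rho X t + rho Y t}.
  have H (q q' : R) : 0 <= q -> 0 <= q' -> q + q' < 1 ->
      {ae mu2, forall t, rho X t <= q * rho W t -> rho Y t <= q' * rho W t ->
        rho W t <= 0}.
    move=> q0 q'0 qq'.
    pose B := [set t | rho X t <= q * rho W t] `&` [set t | rho Y t <= q' * rho W t].
    have mB : measurable B by apply: measurableI; exact: mle'.
    have [A mA AB] := matchM mB.
    have h1 : above_on x (q%:C *: w) A.
      apply/(cone_map_order x0 (cLp_posZ q0 w0) AB); rewrite cone_mapZ//.
      by apply: filterS (Re_cLpZ q W) => t e [Bt _]; rewrite e.
    have h2 : above_on y (q'%:C *: w) A.
      apply/(cone_map_order y0 (cLp_posZ q'0 w0) AB); rewrite cone_mapZ//.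
      by apply: filterS (Re_cLpZ q' W) => t e [_ Bt]; rewrite e.
    have : above_on w 0 A.
      rewrite /above_on in h1 h2; apply: filterS3 (filterI h1 h2) (filterI (Re_cLpZ q w) (Re_cLpZ q' w))
        (filterI (filterI (Re_cLpD x y) (cLp_fun0 mu1 p1)) (Re_cLp_ge0 w0)) => t.
      move=> [l1 l2] [e1 e2] [[e3 e4] wt] At; have := l1 At; have := l2 At.
      by rewrite e1 e2 e4 -/w /=; move: wt; rewrite e3 => *; nra.
    move/(cone_map_order w0 (cLp_pos0 mu1 p1) AB); rewrite cone_map0.
    apply: filterS2 (cLp_fun0 mu2 p1) => t -> h a1 a2; exact: h.
  have : {ae mu2, forall t, forall qq : rat * rat, 0 <= ratr qq.1 :> R ->
     0 <= ratr qq.2 :> R -> ratr qq.1 + ratr qq.2 < 1 :> R ->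
     rho X t <= ratr qq.1 * rho W t -> rho Y t <= ratr qq.2 * rho W t ->
     rho W t <= 0}.
    apply: ae_countable => -[q q'] /=.
    have [[q0 q'0 qq']|n] := pselect [/\ 0 <= ratr q :> R,
       0 <= ratr q' :> R & ratr q + ratr q' < 1 :> R].
      by apply: filterS (H _ _ q0 q'0 qq') => t h _ _ _.
    by apply: aeW => t ? ? ?; exfalso; apply: n.
  apply: filterS3 (Re_cLp_ge0 X0) (Re_cLp_ge0 Y0) => t xt yt h.
  rewrite leNgt; apply/negP => lt.
  have [q [q' [a1 a2 a3 a4 a5]]] := split_below xt yt lt.
  have := h (q, q') a3 a4 a5 a1 a2; move: xt yt lt; rewrite -/X -/Y -/W; lra.
have lo : {ae mu2, forall t, rho X t + rho Y t <= rho W t}.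
  have H (q q' : R) : 0 <= q -> 0 <= q' -> 1 < q + q' ->
      {ae mu2, forall t, q * rho W t <= rho X t -> q' * rho W t <= rho Y t ->
        rho X t <= 0 /\ rho Y t <= 0}.
    move=> q0 q'0 qq'.
    pose B := [set t | q * rho W t <= rho X t] `&` [set t | q' * rho W t <= rho Y t].
    have mB : measurable B by apply: measurableI; exact: mle.
    have [A mA AB] := matchM mB.
    have h1 : above_on (q%:C *: w) x A.
      apply/(cone_map_order (cLp_posZ q0 w0) x0 AB); rewrite cone_mapZ//.
      by apply: filterS (Re_cLpZ q W) => t e [Bt _]; rewrite e.
    have h2 : above_on (q'%:C *: w) y A.
      apply/(cone_map_order (cLp_posZ q'0 w0) y0 AB); rewrite cone_mapZ//.
      by apply: filterS (Re_cLpZ q' W) => t e [_ Bt]; rewrite e.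
    have h3 : {ae mu1, forall t, A t -> rho w t <= rho (0 : E1) t}.
      rewrite /above_on in h1 h2; apply: filterS3 (filterI h1 h2) (filterI (Re_cLpZ q w) (Re_cLpZ q' w))
        (filterI (filterI (Re_cLpD x y) (cLp_fun0 mu1 p1)) (Re_cLp_ge0 w0)) => t.
      move=> [l1 l2] [e1 e2] [[e3 e4] wt] At; have := l1 At; have := l2 At.
      by rewrite e1 e2 e4 -/w /=; move: wt; rewrite e3 => *; nra.
    have h4 : above_on x 0 A /\ above_on y 0 A.
      by split; apply: filterS3 h3 (Re_cLpD x y) (filterI (Re_cLp_ge0 x0) (Re_cLp_ge0 y0)) =>
        t h e [xt yt] At; move: (h At); rewrite e => *; lra.
    case: h4 => /(cone_map_order x0 (cLp_pos0 mu1 p1) AB).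
    rewrite cone_map0 => h5 /(cone_map_order y0 (cLp_pos0 mu1 p1) AB).
    rewrite cone_map0 /above_on => h6; rewrite /above_on in h5.
    apply: filterS3 h5 h6 (cLp_fun0 mu2 p1) => t + + e a1 a2.
    by rewrite e => /(_ (conj a1 a2)) h /(_ (conj a1 a2)).
  have : {ae mu2, forall t, forall qq : rat * rat, 1 < ratr qq.1 + ratr qq.2 :> R ->
     Num.max (ratr qq.1) 0 * rho W t <= rho X t ->
     Num.max (ratr qq.2) 0 * rho W t <= rho Y t ->
     rho X t <= 0 /\ rho Y t <= 0}.
    apply: ae_countable => -[q q'] /=.
    have [qq'|n] := pselect (1 < ratr q + ratr q' :> R); last exact: aeW.
    have l1 : 0 <= Num.max (ratr q) 0 :> R by rewrite le_max lexx orbT.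
    have l2 : 0 <= Num.max (ratr q') 0 :> R by rewrite le_max lexx orbT.
    have l3 : 1 < Num.max (ratr q) 0 + Num.max (ratr q') 0 :> R.
      by apply: lt_le_trans qq' _; apply: lerD; rewrite le_max lexx.
    by apply: filterS (H _ _ l1 l2 l3) => t h _.
  apply: filterS3 (filterI (Re_cLp_ge0 X0) (Re_cLp_ge0 W0)) (Re_cLp_ge0 Y0) => t [xt wt] yt h.
  rewrite leNgt; apply/negP => lt.
  have [q [q' [a1 a2 a5]]] := split_above xt yt wt lt.
  have [] := h (q, q') a5.
  - by case: (leP (ratr q : R) 0) => _ //; rewrite mul0r.
  - by case: (leP (ratr q' : R) 0) => _ //; rewrite mul0r.
  - by move: lt wt; rewrite -/X -/Y -/W; lra.
apply/cLp_eqP; apply: filterS3 (filterI up lo) (cLp_funD X Y)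
  (filterI W0 (filterI X0 Y0)) => t [l1 l2] -> [/cge0E -> [/cge0E -> /cge0E ->]].
by rewrite -rmorphD; congr (_%:C); apply/eqP; rewrite eq_le l1 l2.
Qed.

Theorem corr_extension : exists Phi : E1 -> E2, [/\ linear Phi,
  forall x, cLp_pos x -> cLp_pos (Phi x),
  forall x, cLp_pos x -> cLp_norm (Phi x) = cLp_norm x &
  forall f F, M f F -> Phi f = F].
Proof.
have DE x : cLp_pos x -> cone_extension cone_map x = cone_map x.
  by apply: cone_extension_pos; [exact: cone_mapD|exact: cone_mapZ].
exists (cone_extension cone_map); split.
- by apply: cone_extension_linear; [exact: cone_mapD|exact: cone_mapZ].
- by move=> x x0; rewrite DE//; exact: cone_map_pos.
- by move=> x x0; rewrite DE//; exact: cone_map_norm.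
- move=> f F m; have [Mdom _ _] := cM; have [[f0 _] _] := Mdom _ _ m.
  by rewrite DE//; exact: cone_map_sphere.
Qed.

End cone_map.

Section isometric_extension.
Context d1 (T1 : measurableType d1) d2 (T2 : measurableType d2) (R : realType).
Variables (mu1 : {measure set T1 -> \bar R}) (mu2 : {measure set T2 -> \bar R}).
Variables (p : \bar R) (p1 : (1 <= p)%E).

(** The positive sphere spans the space. *)
Lemma linear_ext_sphere d (T : measurableType d) (mu : {measure set T -> \bar R})
  (V : lmodType R[i]) (Phi Psi : cLp mu p1 -> V) : linear Phi -> linear Psi ->
  (forall f, pos_unit f -> Phi f = Psi f) -> Phi =1 Psi.
Proof.
move=> lP lQ H.
have [PD QD] := (linD lP, linD lQ); have [PZ QZ] := (linZ lP, linZ lQ).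
have Hp f : cLp_pos f -> Phi f = Psi f.
  move=> f0; have [->|/eqP fn0] := eqVneq f 0.
    by rewrite -(scale0r (0 : cLp mu p1)) PZ QZ !scale0r.
  by rewrite (cLp_norm_scaleK fn0) PZ QZ H//; exact: pos_unit_scale.
have N (G : cLp mu p1 -> V) : (forall c x, G (c *: x) = c *: G x) ->
    forall x, G (- x) = - G x by move=> Z x; have := Z (-1) x; rewrite !scaleN1r.
have Hr f : Phi (repart f) = Psi (repart f).
  by rewrite /repart PD QD (N _ PZ) (N _ QZ) !Hp//; exact: ppart_pos.
by move=> f; rewrite (cLp_decomp f) PD QD PZ QZ !Hr.
Qed.

(** Both the correspondence and its inverse extend to positive operators which
    are contractions by the bound on moduli, and they are inverse to each
    other. *)
Theorem corr_isometric_extension (M : cLp mu1 p1 -> cLp mu2 p1 -> Prop) :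
  sphere_corr M ->
  (forall B, measurable B -> exists2 A, measurable A & order_match M A B) ->
  (forall A, measurable A -> exists2 B, measurable B &
    order_match (fun y x => M x y) B A) ->
  exists2 Phi : cLp mu1 p1 -> cLp mu2 p1,
    isometric_order_iso (@cLp_norm _ _ _ _ _ _) (@cLp_norm _ _ _ _ _ _)
      (@cLp_pos _ _ _ _ _ _) (@cLp_pos _ _ _ _ _ _) Phi &
    forall f F, M f F -> Phi f = F.
Proof.
move=> cM m1 m2.
have [Phi [linP posP normP PM]] := corr_extension cM m1.
have [Psi [linQ posQ normQ QM]] := corr_extension (sphere_corr_swap cM) m2.
have [_ Mtot Msurj] := cM.
have linC d (T : measurableType d) (mu : {measure set T -> \bar R})
    d' (T' : measurableType d') (mu' : {measure set T' -> \bar R})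
    (f : cLp mu p1 -> cLp mu' p1) (g : cLp mu' p1 -> cLp mu p1) :
    linear f -> linear g -> linear (g \o f).
  by move=> lf lg c x y /=; rewrite lf lg.
have QP : Psi \o Phi =1 id.
  apply: linear_ext_sphere; [exact: linC|by move=> c x y|].
  by move=> f /Mtot[F m] /=; rewrite (PM _ _ m) (QM _ _ m).
have PQ : Phi \o Psi =1 id.
  apply: linear_ext_sphere; [exact: linC|by move=> c x y|].
  by move=> F /Msurj[f m] /=; rewrite (QM _ _ m) (PM _ _ m).
exists Phi => //; split=> //.
- by move=> y _; exists (Psi y) => //; exact: PQ.
- move=> x y _ _.
  have -> : Phi x - Phi y = Phi (x - y).
    by rewrite -[in RHS]scaleN1r addrC [in RHS]addrC linP scaleN1r.
  apply/eqP; rewrite eq_le (positive_operator_contraction linP posP normP)/=.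
  rewrite -[leLHS](congr1 (@cLp_norm _ _ _ _ _ _) (QP (x - y))).
  exact: (positive_operator_contraction linQ posQ normQ).
- apply/seteqP; split=> [y [x x0 <-]|y y0]; first exact: posP.
  by exists (Psi y); [exact: posQ|exact: PQ].
- apply/seteqP; split=> x; last exact: posP.
  by move=> /= x0; rewrite -[x](QP x); exact: posQ.
Qed.

End isometric_extension.

Lemma order_match_exists d1 (T1 : measurableType d1) d2 (T2 : measurableType d2)
  (R : realType) (mu1 : {measure set T1 -> \bar R})
  (mu2 : {measure set T2 -> \bar R}) (fin1 : mu1 setT \is a fin_num)
  (fin2 : mu2 setT \is a fin_num) (p : \bar R) (p1 : (1 <= p)%E) (e : R)
  (M : cLp mu1 p1 -> cLp mu2 p1 -> Prop) :
  e = -1 \/ (e = 1 /\ (1 < p < +oo)%E) -> sphere_corr M -> norm_corr e M ->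
  forall B, measurable B -> exists2 A, measurable A & order_match M A B.
Proof.
case: p p1 M => [r|//|//] r1 M he cM nM.
  have er : good_sign r e.
    by case: he => [->|[-> /andP[]]]; [left|right].
  have := order_match_finite er fin1 fin2 cM nM.
  by apply.
have eN : e = -1 by case: he => // -[_ /andP[_]]; rewrite ltxx.
rewrite eN in nM; have := order_match_sup fin1 fin2 cM nM.
by apply.
Qed.

Section sphere_maps.
Context d1 (T1 : measurableType d1) d2 (T2 : measurableType d2) (R : realType).
Variables (mu1 : {measure set T1 -> \bar R}) (mu2 : {measure set T2 -> \bar R}).
Hypotheses (fin1 : mu1 setT \is a fin_num) (fin2 : mu2 setT \is a fin_num).
Variables (p : \bar R) (p1 : (1 <= p)%E).

Theorem sphere_map_extension (e : R) (D : cLp mu1 p1 -> cLp mu2 p1) :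
  e = -1 \/ (e = 1 /\ (1 < p < +oo)%E) ->
  surjection_between (@pos_unit _ _ _ mu1 _ p1) (@pos_unit _ _ _ mu2 _ p1) D ->
  (forall x y, pos_unit x -> pos_unit y ->
    cLp_norm (D x + e%:C *: D y) = cLp_norm (x + e%:C *: y)) ->
  exists2 Phi : cLp mu1 p1 -> cLp mu2 p1,
    isometric_order_iso (@cLp_norm _ _ _ _ _ _) (@cLp_norm _ _ _ _ _ _)
      (@cLp_pos _ _ _ _ _ _) (@cLp_pos _ _ _ _ _ _) Phi &
    forall f, pos_unit f -> Phi f = D f.
Proof.
move=> he [Dfun Dsurj] Dn.
pose M (x : cLp mu1 p1) (y : cLp mu2 p1) := pos_unit x /\ y = D x.
have cM : sphere_corr M.
  split=> [x _ [px ->]|x px|y /Dsurj[x px <-]].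
  - by split=> //; exact: Dfun.
  - by exists (D x).
  - by exists x.
have nM : norm_corr e M.
  by move=> x _ x' _ [px ->] [px' ->]; rewrite Dn.
have [||Phi isoPhi PM] := corr_isometric_extension cM.
- exact: order_match_exists he cM nM.
- exact: order_match_exists he (sphere_corr_swap cM) (norm_corr_swap nM).
by exists Phi => // f pf; exact: PM.
Qed.

End sphere_maps.

(** * Smooth plateaus *)

Section smooth_functions.
Context {R : realType}.
Implicit Types (f g : R -> R).

(** Unlike iterated derivability of the n-th derivative, this form allows
    inductions on n that generalize the function, as needed for sums, products
    and compositions. *)
Fixpoint diffn (n : nat) f : Prop :=
  if n is m.+1 then (forall x, derivable f x 1) /\ diffn m (derive1 f) else True.

Definition smooth f := forall n x, derivable (derive1n n f) x 1.

Lemma derive1nSr n f : derive1n n.+1 f = derive1n n (derive1 f).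
Proof. by rewrite /derive1n iterSr. Qed.

Lemma diffnP n f : (forall m, (m < n)%N -> forall x, derivable (derive1n m f) x 1) <->
  diffn n f.
Proof.
elim: n f => [|n IH] f /=; first by split.
split=> [H|[d /IH H]].
  split; first exact: (H 0%N).
  by apply/IH => m mn x; rewrite -derive1nSr; exact: H.
by case=> [_|m]; rewrite ?derive1nSr; [exact: d|rewrite ltnS; exact: H].
Qed.

Lemma smoothP f : smooth f <-> forall n, diffn n f.
Proof.
split=> [H n|H n x]; first by apply/diffnP => m _; exact: H.
by move/diffnP : (H n.+1); apply.
Qed.

Lemma smooth_derive f : smooth f -> smooth (derive1 f).
Proof. by move=> sf n x; rewrite -derive1nSr; exact: sf. Qed.

Lemma smooth_continuous f : smooth f -> continuous f.
Proof.
by move=> sf x; apply/differentiable_continuous/derivable1_diffP; exact: (sf 0%N).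
Qed.

Lemma diffnW n f : diffn n.+1 f -> diffn n f.
Proof.
by move=> /diffnP H; apply/diffnP => m mn; apply: H; rewrite ltnS ltnW.
Qed.

Lemma diffn_cst n (c : R) : diffn n (cst c).
Proof.
elim: n c => //= n IH c; split; first by move=> x; exact: derivable_cst.
rewrite (_ : derive1 _ = cst 0); first exact: IH.
by apply/funext => x; rewrite derive1_cst.
Qed.

Lemma diffnD n f g : diffn n f -> diffn n g -> diffn n (f \+ g).
Proof.
elim: n f g => //= n IH f g [df nf] [dg ng]; split.
  by move=> x; exact: derivableD.
rewrite (_ : derive1 _ = derive1 f \+ derive1 g); first exact: IH.
by apply/funext => x /=; rewrite !derive1E deriveD.
Qed.

Lemma diffnM n f g : diffn n f -> diffn n g -> diffn n (f \* g).
Proof.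
elim: n f g => // n IH f g F G; have nf := diffnW F; have ng := diffnW G.
case: F G => df nf' [dg ng']; split; first by move=> x; exact: derivableM.
rewrite (_ : derive1 _ = (f \* derive1 g) \+ (g \* derive1 f)).
  by apply: diffnD; exact: IH.
by apply/funext => x /=; rewrite !derive1E deriveM.
Qed.

Lemma diffn_affine n f (c d : R) : diffn n f -> diffn n (fun x => f (c * x + d)).
Proof.
elim: n f => // n IH f [df nf].
have dA (x : R) : is_derive x 1 (fun x : R => c * x + d) c.
  by apply: is_derive_eq; rewrite addr0 /GRing.scale/= mulr1.
have D (x : R) : is_derive x 1 (fun x => f (c * x + d)) (derive1 f (c * x + d) * c).
  apply: is_derive1_comp; rewrite derive1E; exact/derivableP.
split; first by move=> x; have [] := D x.
rewrite (_ : derive1 _ = (fun x => derive1 f (c * x + d)) \* cst c).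
  by apply: diffnM; [exact: IH|exact: diffn_cst].
by apply/funext => x; rewrite derive1E; have [_ ->] := D x.
Qed.

End smooth_functions.

Section flat_functions.
Context {R : realType}.
Implicit Types (q : {poly R}).

(** The functions q(1/x) exp(-1/x), extended by 0, form a family that is closed
    under differentiation; exp(-1/x) alone is not. *)
Definition flat q (x : R) : R := if 0 < x then q.[x^-1] * expR (- x^-1) else 0.

Lemma pow_expR_le (i : nat) (y : R) : 0 < y -> y ^+ i * expR (- y) <= i.+1`!%:R / y.
Proof.
move=> y0; have := expR_ge1Dxn i (ltW y0) => h.
have f0 : 0 < i.+1`!%:R :> R by rewrite ltr0n fact_gt0.
rewrite ler_pdivlMr// expRN mulrAC ler_pdivrMr ?expR_gt0// -exprSr.
rewrite -ler_pdivrMl// mulrC; apply: le_trans h; lra.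
Qed.

(** The bound C |x| gives the derivative 0 at the origin. *)
Lemma flat_bound q : exists2 C : R, 0 <= C & forall x, `|flat q x| <= C * `|x|.
Proof.
exists (\sum_(i < size q) `|q`_i| * i.+1`!%:R).
  by apply: sumr_ge0 => i _; rewrite mulr_ge0.
move=> x; rewrite /flat; case: ifPn => [x0|_]; last first.
  rewrite normr0 mulr_ge0//; by apply: sumr_ge0 => i _; rewrite mulr_ge0.
rewrite horner_coef mulr_suml mulr_suml.
rewrite (le_trans (ler_norm_sum _ _ _))//; apply: ler_sum => i _.
rewrite -mulrA normrM -mulrA ler_wpM2l//.
rewrite ger0_norm ?mulr_ge0 ?exprn_ge0 ?invr_ge0 ?expR_ge0 ?(ltW x0)//.
by have := @pow_expR_le i _ (eq_ind_r is_true x0 (invr_gt0 x)); rewrite invrK gtr0_norm.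
Qed.

Lemma flat_derive q (x : R) : is_derive x 1 (flat q) (flat ('X^2 * (q - q^`())) x).
Proof.
have [x0|x0|->] := ltgtP x 0.
- rewrite /flat ltNge (ltW x0)/=.
  apply: (@near_eq_is_derive _ _ _ (cst 0)).
    near=> z; rewrite ltNge ifF//=; apply/negbTE; rewrite negbK.
    by apply: ltW; near: z; exact: lt_nbhsl.
- rewrite [flat (_ * _) x]/flat x0.
  have x00 : x != 0 by rewrite gt_eqF.
  apply: (@near_eq_is_derive _ _ _ (fun y : R => q.[y^-1] * expR (- y^-1) : R)).
  + near=> z; rewrite /flat ifT//; near: z; exact: lt_nbhsr.
  have dV : is_derive x 1 (fun y : R => y^-1) (- x ^- 2).
    have := is_deriveV x00 (is_derive_id x 1).
    by rewrite /GRing.scale/= mulr1.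
  have d1 : is_derive x 1 (fun y : R => q.[y^-1]) (q^`().[x^-1] * - x ^- 2).
    exact: (@is_derive1_comp R (horner q) (fun y => y^-1)).
  have d2 : is_derive x 1 (fun y : R => expR (- y^-1)) (expR (- x^-1) * x ^- 2).
    apply: (@is_derive1_comp R expR (fun y => - y^-1)).
    by rewrite -[X in is_derive _ _ _ X]opprK; apply: is_deriveN.
  have /@is_derive_eq := is_deriveM d1 d2; apply.
  rewrite /GRing.scale/= !hornerE/= -exprVn; ring.
- rewrite [flat (_ * _) 0]/flat ltxx.
  have [C C0 HC] := flat_bound ('X * q).
  have H : h^-1 *: (flat q (h *: 1 + 0) - flat q 0) @[h --> 0^'] --> (0 : R).
    apply/cvgr0Pnorm_lt => e e0.
    have C1 : 0 < C + 1 by rewrite ltr_wpDl.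
    near=> h; have h0 : h != 0 by near: h; exact: nbhs_dnbhs_neq.
    rewrite [flat q 0]/flat ltxx subr0 addr0 /GRing.scale/= mulr1.
    have -> : h^-1 * flat q h = flat ('X * q) h.
      rewrite /flat; case: ifP => _; last by rewrite mulr0.
      by rewrite hornerM hornerX mulrA.
    apply: (le_lt_trans (HC h)); apply: (@le_lt_trans _ _ ((C + 1) * `|h|)).
      by rewrite ler_wpM2r// lerDl.
    rewrite mulrC -ltr_pdivlMr//; near: h; apply: dnbhs0_lt.
    by rewrite divr_gt0.
  by split; [apply/cvg_ex; exists 0; exact: H|apply/cvg_lim => //; exact: H].
Unshelve. all: by end_near. Qed.

Lemma flat_smooth q : smooth (flat q).
Proof.
apply/smoothP => n; elim: n q => //= n IH q; split.
  by move=> x; have [] := flat_derive q x.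
rewrite (_ : derive1 _ = flat ('X^2 * (q - q^`()))); first exact: IH.
by apply/funext => x; rewrite derive1E; have [_ ->] := flat_derive q x.
Qed.

Definition step (x : R) : R := flat 1 x.

Lemma stepE x : step x = if 0 < x then expR (- x^-1) else 0.
Proof. by rewrite /step /flat; case: ifP => // _; rewrite hornerC mul1r. Qed.

Lemma step_ge0 x : 0 <= step x.
Proof. by rewrite stepE; case: ifP => // _; exact: expR_ge0. Qed.

Lemma step_le1 x : step x <= 1.
Proof.
rewrite stepE; case: ifP => // x0; rewrite -expR0 ler_expR oppr_le0 invr_ge0.
exact: ltW.
Qed.

Lemma step_gt0 x : 0 < x -> 0 < step x.
Proof. by move=> x0; rewrite stepE x0 expR_gt0. Qed.

Lemma step_le0 x : x <= 0 -> step x = 0.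
Proof. by move=> x0; rewrite stepE ltNge x0. Qed.

(** As n grows these test functions increase to the indicator of ]c, d[, which
    lets test functions see the integral over intervals. *)
Definition plateau (n : nat) (c d x : R) : R :=
  step (n.+1%:R * (x - c)) * step (n.+1%:R * (d - x)).

Lemma plateau_smooth n c d : smooth (plateau n c d).
Proof.
have /smoothP S := @flat_smooth 1; apply/smoothP => m.
have h1 := diffn_affine n.+1%:R (- (n.+1%:R * c)) (S m).
have h2 := diffn_affine (- n.+1%:R) (n.+1%:R * d) (S m).
have := diffnM h1 h2; congr (diffn m _); apply/funext => x /=.
by rewrite /plateau /step; congr (flat _ _ * flat _ _); ring.
Qed.

Lemma plateau01 n c d x : 0 <= plateau n c d x <= 1.
Proof. by rewrite /plateau mulr_ge0 ?step_ge0//= mulr_ile1 ?step_ge0 ?step_le1. Qed.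

Lemma plateau_out n c d x : x <= c \/ d <= x -> plateau n c d x = 0.
Proof.
rewrite /plateau => -[h|h].
  by rewrite step_le0 ?mul0r// pmulr_rle0// subr_le0.
by rewrite [X in _ * X]step_le0 ?mulr0// pmulr_rle0// subr_le0.
Qed.

Lemma plateau_gt0 n c d x : c < x -> x < d -> 0 < plateau n c d x.
Proof. by move=> cx xd; rewrite mulr_gt0// step_gt0// mulr_gt0// subr_gt0. Qed.

Lemma step_cvg (x : R) : 0 < x -> step (n.+1%:R * x) @[n --> \oo] --> (1 : R).
Proof.
move=> x0.
rewrite (_ : (fun n => _) = expR \o (fun n => - ((n.+1%:R)^-1 * x^-1))); last first.
  by apply/funext => n /=; rewrite stepE pmulr_rgt0// x0 invfM.
rewrite -[X in _ --> X]expR0; apply: continuous_cvg; first exact: continuous_expR.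
rewrite -[X in _ --> X]oppr0; apply: cvgN.
have : (n.+1%:R^-1 : R) * x^-1 @[n --> \oo] --> 0 * x^-1.
  by apply: cvgMl; exact: cvg_harmonic.
by rewrite mul0r.
Qed.

Lemma plateau_cvg c d x : plateau n c d x @[n --> \oo] --> (\1_(`]c, d[%classic : set R) x : R).
Proof.
have [h|h] := boolP (x \in `]c, d[).
  rewrite indicE mem_set//=; move: h; rewrite in_itv/= => /andP[cx xd].
  by rewrite -[1%:R]mulr1; apply: cvgM; apply: step_cvg; rewrite subr_gt0.
rewrite indicE memNset/=; last exact/negP.
rewrite (_ : (fun n => _) = cst 0); first exact: cvg_cst.
apply/funext => n /=; apply: plateau_out.
move: h; rewrite in_itv/= negb_and -!leNgt => /orP[]; by [left|right].
Qed.

End flat_functions.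

(** * Primitives of integrable functions *)

Section primitives.
Context {R : realType}.
Notation mu := (@lebesgue_measure R).
Implicit Types (w g : R -> R).

Definition prim w (x : R) : R := \int[mu]_(t in `]-oo, x]) w t.

Lemma integrable_sub w (D : set R) : measurable D ->
  mu.-integrable setT (EFin \o w) -> mu.-integrable D (EFin \o w).
Proof. by move=> mD; apply: integrableS. Qed.

Lemma prim_diff w y z : mu.-integrable setT (EFin \o w) -> y <= z ->
  prim w z - prim w y = \int[mu]_(t in `]y, z]) w t.
Proof.
move=> iw yz; rewrite /prim Rintegral_itvB ?bnd_simp//.
by apply: integrable_sub.
Qed.

Lemma prim_diff_oo w y z : mu.-integrable setT (EFin \o w) -> y <= z ->
  prim w z - prim w y = \int[mu]_(t in `]y, z[) w t.
Proof.
move=> iw yz; rewrite prim_diff// Rintegral_itv_bndo_bndc//.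
exact: integrable_sub.
Qed.

Lemma prim_diff_cc w y z : mu.-integrable setT (EFin \o w) -> y <= z ->
  prim w z - prim w y = \int[mu]_(t in `[y, z]) w t.
Proof.
move=> iw yz; rewrite prim_diff// Rintegral_itv_obnd_cbnd//.
exact: integrable_sub.
Qed.

Lemma RintegralE w (D : set R) : measurable D ->
  mu.-integrable D (EFin \o w) ->
  (\int[mu]_(t in D) (w t)%:E)%E = (\int[mu]_(t in D) w t)%:E.
Proof. by move=> mD iw; rewrite /Rintegral fineK//; exact: integrable_fin_num. Qed.

Lemma Rintegral_indic (D : set R) w : measurable D ->
  \int[mu]_(t in D) w t = \int[mu]_t (\1_D t * w t).
Proof.
move=> mD; rewrite Rintegral_mkcond; apply: eq_Rintegral => t _.
rewrite patchE indicE; case: ifPn => _; by rewrite ?mul1r ?mul0r.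
Qed.

Lemma integrable_mul_bounded (h w : R -> R) (C : R) : measurable_fun setT h ->
  (forall x, `|h x| <= C) -> mu.-integrable setT (EFin \o w) ->
  mu.-integrable setT (EFin \o (fun x => h x * w x)).
Proof.
move=> mh hC iw; have [mw _] := integrableP _ _ _ iw.
have C0 : 0 <= C by exact: le_trans (hC 0).
have iCw := integrableZl_EFin C iw.
apply: le_integrable iCw => //.
  by apply/measurable_EFinP; apply: measurable_funM => //; exact/measurable_EFinP.
move=> x _ /=; rewrite lee_fin !normrM ler_wpM2r// (le_trans (hC x))//.
by rewrite ler_norm.
Qed.

Lemma integrable_indicM (D : set R) w : measurable D ->
  mu.-integrable setT (EFin \o w) ->
  mu.-integrable setT (EFin \o (fun x => \1_D x * w x)).
Proof.
move=> mD; apply: (@integrable_mul_bounded _ _ 1); first exact: measurable_indic.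
by move=> x; rewrite indicE; case: (_ \in _); rewrite ?normr1 ?normr0.
Qed.

(** Dominated convergence turns plateaus into indicators, so w has integral zero
    over all intervals; its primitive is then constant, and Lebesgue's
    differentiation theorem identifies w with the derivative. *)
Lemma fundamental_lemma (a b : R) w : mu.-integrable setT (EFin \o w) ->
  (forall n c d, a < c -> c < d -> d < b ->
    \int[mu]_x (plateau n c d x * w x) = 0) ->
  {ae mu, forall x, a < x < b -> w x = 0}.
Proof.
move=> iw H; have [mw _] := integrableP _ _ _ iw.
have mb n c d : measurable_fun setT (plateau n c d : R -> R).
  by apply: continuous_measurable_fun; apply/smooth_continuous/plateau_smooth.
have I0 c d : a < c -> c < d -> d < b -> \int[mu]_(x in `]c, d[) w x = 0.
  move=> ac cd db; rewrite Rintegral_indic// /Rintegral.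
  (* dominated by |w| since plateaus have values in [0, 1] *)
pose f_ n x := (plateau n c d x * w x)%:E.
  have [] := @dominated_convergence _ _ R mu setT measurableT f_
    (fun x => (\1_(`]c, d[%classic : set R) x * w x)%:E) (fun x => `|w x|%:E).
  - move=> n; apply/measurable_EFinP; apply: measurable_funM; first exact: mb.
    exact/measurable_EFinP.
  - apply/measurable_EFinP; apply: measurable_funM; first exact: measurable_indic.
    exact/measurable_EFinP.
  - apply: aeW => x _; rewrite /f_; apply: cvg_EFin; first by apply: nearW.
    by apply: cvgMl; exact: plateau_cvg.
  - exact: integrable_abse iw.
  - apply: aeW => x n _; rewrite /f_ /= lee_fin normrM ler_piMl//.
    by have /andP[h1 h2] := plateau01 n c d x; rewrite ger0_norm.
  move=> _ _ lim.
  have : [sequence (\int[mu]_x f_ n x)%E]_n = cst 0%E.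
    apply/funext => n /=; have := H n c d ac cd db; rewrite /Rintegral /f_ => h.
    rewrite -[LHS]fineK ?h//; apply: integrable_fin_num => //.
    apply: (@integrable_mul_bounded _ _ 1) => // x.
    by have /andP[h1 h2] := plateau01 n c d x; rewrite ger0_norm.
  move=> E; rewrite E in lim.
  by rewrite -(cvg_unique _ (cvg_cst _) lim).
have FTC := @FTC1Ny R w (fun y => integrable_sub (measurable_itv _) iw)
  (open_integrable_locally openT iw).
move: FTC; apply: filterS; first exact: (ae_filter_ringOfSetsType mu).
move=> x [dF Fx] /andP[ax xb]; rewrite -Fx derive1E.
rewrite (@near_eq_derive _ _ _ _ (cst (prim w x))); first by rewrite -derive1E derive1_cst.
near=> y; have ay : a < y by near: y; exact: lt_nbhsr.
have yb : y < b by near: y; exact: lt_nbhsl.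
have E u v : a < u -> u < v -> v < b -> prim w v = prim w u.
  by move=> au uv vb; apply/eqP; rewrite -subr_eq0 prim_diff_oo ?ltW// I0.
rewrite -/(prim w y) /cst; have [xy|yx|->] := ltgtP x y => //; [exact: E|exact/esym/E].
Unshelve. all: by end_near. Qed.

(** Integration by parts in its weakest form: Fubini on the triangle t <= s. *)
Lemma fubini_triangle g w : mu.-integrable setT (EFin \o g) ->
  mu.-integrable setT (EFin \o w) ->
  \int[mu]_s (g s * prim w s) = \int[mu]_t (w t * \int[mu]_(s in `[t, +oo[) g s).
Proof.
move=> ig iw; have [mg _] := integrableP _ _ _ ig; have [mw _] := integrableP _ _ _ iw.
have {}mg : measurable_fun setT g by exact/measurable_EFinP.
have {}mw : measurable_fun setT w by exact/measurable_EFinP.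
pose f (z : measurableTypeR R * measurableTypeR R) : \bar R :=
  (\1_[set z : R * R | z.2 <= z.1] z * (g z.1 * w z.2))%:E.
have mtri : measurable ([set z : measurableTypeR R * measurableTypeR R | z.2 <= z.1]).
  rewrite (_ : [set _ | _] = ~` [set z | z.1 < z.2]).
    apply: measurableC; apply: measurable_ltset;
      [exact: measurable_fst|exact: measurable_snd].
  by apply/seteqP; split=> z /=; rewrite leNgt => /negP.
have mf : measurable_fun setT f.
  apply/measurable_EFinP; apply: measurable_funM; first exact: measurable_indic.
  apply: measurable_funM.
    exact: (measurableT_comp mg measurable_fst).
  exact: (measurableT_comp mw measurable_snd).
have ifz : (mu \x mu)%E.-integrable setT f.
  apply/integrable12ltyP => //.
  apply: (@le_lt_trans _ _ (\int[mu]_s (`|g s|%:E * \int[mu]_t `|w t|%:E))%E).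
    apply: ge0_le_integral => //.
    - by move=> s _; apply: integral_ge0 => t _; exact: abse_ge0.
    - apply: (measurable_fun_fubini_tonelli_F (m2 := mu) (abse \o f)) => //.
        exact: measurableT_comp.
      by move=> z; exact: abse_ge0.
    - apply: emeasurable_funM => //; apply/measurable_EFinP; exact: measurableT_comp.
    - move=> s _; rewrite -ge0_integralZl//; last first.
        by apply/measurable_EFinP; exact: measurableT_comp.
      apply: ge0_le_integral => //.
      + apply: measurableT_comp => //; apply: (measurableT_comp mf).
        exact: measurable_pair1.
      + by apply: measurable_funeM; apply/measurable_EFinP; exact: measurableT_comp.
      + move=> t _; rewrite /f /= -EFinM lee_fin indicE !normrM.
        by case: (_ \in _); rewrite ?normr1 ?mul1r ?normr0 ?mul0r ?mulr_ge0.
  rewrite ge0_integralZr//; last 2 first.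
  - by apply/measurable_EFinP; exact: measurableT_comp.
  - by apply: integral_ge0.
  have [_ g1] := integrableP _ _ _ ig; have [_ w1] := integrableP _ _ _ iw.
  by apply: lte_mul_pinfty => //; [exact: integral_ge0|rewrite ge0_fin_numE//; exact: integral_ge0].
have tri1 s t : \1_[set z : R * R | z.2 <= z.1] (s, t) = (t <= s)%R%:R :> R.
  rewrite indicE; case: (boolP (t <= s)) => h; [by rewrite mem_set|].
  by rewrite memNset//=; exact/negP.
have tri2 (s t : R) : \1_(`]-oo, s]%classic : set R) t = (t <= s)%R%:R :> R.
  rewrite indicE; case: (boolP (t <= s)) => h; [by rewrite mem_set//= in_itv|].
  by rewrite memNset//= in_itv/=; exact/negP.
have tri3 (s t : R) : \1_(`[t, +oo[%classic : set R) s = (t <= s)%R%:R :> R.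
  rewrite indicE; case: (boolP (t <= s)) => h; [by rewrite mem_set//= in_itv/= andbT|].
  by rewrite memNset//= in_itv/= andbT; exact/negP.
have L s : (\int[mu]_t f (s, t) = (g s * prim w s)%:E)%E.
  have iw' := integrable_indicM (measurable_itv `]-oo, s]) iw.
  rewrite EFinM /prim Rintegral_indic// -RintegralE// -integralZl//.
  apply: eq_integral => t _; rewrite /f -EFinM; congr (_%:E).
  by rewrite tri1 tri2 mulrCA.
have RR t : (\int[mu]_s f (s, t) = (w t * \int[mu]_(s in `[t, +oo[) g s)%:E)%E.
  have ig' := integrable_indicM (measurable_itv `[t, +oo[) ig.
  rewrite EFinM Rintegral_indic// -RintegralE// -integralZl//.
  apply: eq_integral => s _; rewrite /f -EFinM; congr (_%:E).
  by rewrite tri1 tri3; ring.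
rewrite /Rintegral; congr fine.
under eq_integral do rewrite -L.
under [RHS]eq_integral do rewrite -RR.
exact: Fubini.
Qed.

End primitives.

(** * Test functions and the lemma of du Bois-Reymond *)

Section test_function_calculus.
Context {R : realType}.
Notation mu := (@lebesgue_measure R).
Implicit Types (w g phi : R -> R).

Lemma integrable_supported g (a b : R) : measurable_fun setT g ->
  (exists C, forall x, `|g x| <= C) -> (forall x, ~~ (a < x < b) -> g x = 0) ->
  mu.-integrable setT (EFin \o g).
Proof.
move=> mg [C gC] g0.
have mi : measurable (`]a, b[%classic : set R) by exact: measurable_itv.
have i1 : mu.-integrable setT (EFin \o (\1_(`]a, b[%classic : set R) : R -> R)).
  exact: integrable_indic_itv.
have := integrable_mul_bounded mg gC i1.
congr (mu.-integrable _ _); apply/funext => x /=; congr (_%:E).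
rewrite indicE; case: (boolP (x \in `]a, b[%classic)).
  by move=> _; rewrite mulr1.
rewrite notin_setE /= in_itv /= => /negP h; by rewrite g0// mul0r.
Qed.

Lemma prim_derive g : continuous g -> mu.-integrable setT (EFin \o g) ->
  forall x : R, is_derive x 1 (prim g) (g x).
Proof.
move=> cg ig x.
have ig' : mu.-integrable `]-oo, (x + 1)%R] (EFin \o g) by exact: integrable_sub.
have [|||d1 d2] := @continuous_FTC1 R g -oo%O x (x + 1) _ ig'.
- by rewrite ltrDl.
- by rewrite ltNyr.
- exact: cg.
apply: DeriveDef; first exact: d1.
by rewrite -derive1E; exact: d2.
Qed.

Lemma prim_left g (c x : R) : (forall y, y <= c -> g y = 0) -> x <= c -> prim g x = 0.
Proof.
move=> g0 xc; rewrite /prim; transitivity (\int[mu]_(t in `]-oo, x]) (0 * g t)).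
  apply: eq_Rintegral => t; rewrite inE/= in_itv/= => tx.
  by rewrite g0 ?mul0r// (le_trans tx).
rewrite /Rintegral; under eq_integral do rewrite mul0r.
by rewrite integral0.
Qed.

Lemma Rintegral_eq0 g (D : set R) : (forall x, D x -> g x = 0) ->
  \int[mu]_(x in D) g x = 0.
Proof.
move=> g0; rewrite (@eq_Rintegral _ _ _ mu D (cst 0)).
  by rewrite /Rintegral integral0.
by move=> x; rewrite inE => /g0.
Qed.

Lemma prim_right g (d x y : R) : mu.-integrable setT (EFin \o g) ->
  (forall y, d <= y -> g y = 0) -> d <= x -> x <= y -> prim g y = prim g x.
Proof.
move=> ig g0 dx xy; apply/eqP; rewrite -subr_eq0 prim_diff//.
rewrite Rintegral_eq0// => t /=; rewrite in_itv/= => /andP[xt _].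
by rewrite g0// (le_trans dx)// ltW.
Qed.

Lemma integral_prim g (d : R) : mu.-integrable setT (EFin \o g) ->
  (forall y, d <= y -> g y = 0) -> \int[mu]_x g x = prim g d.
Proof.
move=> ig g0; rewrite /prim [RHS]Rintegral_indic//; apply: eq_Rintegral => x _.
rewrite indicE; case: (boolP (x \in _)); first by rewrite mul1r.
rewrite notin_setE/= in_itv/= => /negP; rewrite -ltNge => dx.
by rewrite mul0r g0// ltW.
Qed.

(** The inner integral that Fubini produces is a difference of values of the
    primitive. *)
Lemma tail_prim g (d t : R) : mu.-integrable setT (EFin \o g) ->
  (forall y, d <= y -> g y = 0) ->
  \int[mu]_(s in `[t, +oo[) g s = prim g d - prim g t.
Proof.
move=> ig g0; have [td|dt] := leP t d; last first.
  rewrite (prim_right ig g0 (lexx d) (ltW dt)) subrr.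
  rewrite Rintegral_eq0// => s /=; rewrite in_itv/= andbT => ts.
  by rewrite g0// (le_trans _ ts)// ltW.
rewrite prim_diff_cc// [LHS]Rintegral_indic// [RHS]Rintegral_indic//; apply: eq_Rintegral => s _.
rewrite !indicE.
have [ds|sd] := leP d s; first by rewrite g0// !mulr0.
by congr (_%:R * _); congr nat_of_bool; apply/idP/idP; rewrite !inE /= !in_itv/= (ltW sd) ?andbT.
Qed.

Lemma test_functionP (a b c d : R) phi : smooth phi ->
  (forall x, x <= c \/ d <= x -> phi x = 0) -> a < c -> d < b ->
  test_function a b phi.
Proof.
move=> sphi phi0 ac db.
have sub : closure [set x | phi x != 0] `<=` `[c, d]%classic.
  have -> : `[c, d]%classic = closure `[c, d]%classic.
    by apply/closure_id; exact: interval_closed.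
  apply: closureS => x /= px; rewrite in_itv/= !leNgt; apply/andP.
  split; apply/negP => /ltW h; move: px; rewrite phi0 ?eqxx//; by [left|right].
split => //.
  apply: subclosed_compact sub; first exact: closed_closure.
  exact: segment_compact.
move=> x /sub; rewrite /= !in_itv/= => /andP[cx xd].
by rewrite (lt_le_trans ac)// (le_lt_trans xd).
Qed.

Lemma test_plateau (a b c d : R) n : a < c -> d < b ->
  test_function a b (plateau n c d).
Proof.
by apply: test_functionP; [exact: plateau_smooth|exact: plateau_out].
Qed.

Lemma test_out (a b : R) phi n x : test_function a b phi -> ~~ (a < x < b) ->
  derive1n n phi x = 0.
Proof.
move=> tphi xab; have [_ _ sub] := tphi.
apply: test_function_out => /sub.
by rewrite /= in_itv/=; exact/negP.
Qed.

Lemma test_bound (a b : R) phi n : test_function a b phi ->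
  exists C, forall x, `|derive1n n phi x| <= C.
Proof.
move=> tphi; have [M [Mr HM]] := test_function_bounded tphi n.
exists (M + 1) => x; have /HM : M < M + 1 by rewrite ltrDl.
by apply.
Qed.

Lemma test_integrable (a b : R) phi n : test_function a b phi ->
  mu.-integrable setT (EFin \o derive1n n phi).
Proof.
move=> tphi; apply: (@integrable_supported _ a b).
- exact: test_function_measurable tphi n.
- exact: test_bound tphi.
- by move=> x; exact: test_out tphi.
Qed.

Lemma test_derive (a b : R) phi : test_function a b phi ->
  test_function a b (derive1 phi).
Proof.
move=> [sphi cphi sub].
have cl : closure [set x | derive1 phi x != 0] `<=` closure [set x | phi x != 0].
  rewrite [X in _ `<=` X](_ : _ = closure (closure [set x | phi x != 0])); last first.
    by apply/closure_id; exact: closed_closure.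
  apply: closureS => x /= px; apply: contrapT => nx.
  by have := test_function_out 1%N nx; rewrite derive1n1 => h; rewrite h eqxx in px.
split.
- exact: smooth_derive.
- by apply: subclosed_compact cl => //; exact: closed_closure.
- exact: subset_trans cl sub.
Qed.

Lemma prim_test (a b : R) phi : a < b -> test_function a b phi ->
  prim (derive1 phi) = phi.
Proof.
move=> ab tphi; have [sphi _ _] := tphi.
have out n x : ~~ (a < x < b) -> derive1n n phi x = 0 by exact: test_out tphi.
have D (x : R) : is_derive x 1 (prim (derive1 phi) \- phi) 0.
  rewrite -(subrr (derive1 phi x)); apply: is_deriveB.
    apply: prim_derive; first exact/smooth_continuous/smooth_derive.
    by have := test_integrable 1%N tphi.
  by rewrite derive1E; apply/derivableP; exact: (sphi 0%N).
apply/funext => x; have := is_derive_0_is_cst x a D.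
rewrite /= (@prim_left _ a a)//; last first.
  by move=> y ya; apply: (out 1%N); rewrite negb_and -leNgt ya.
have -> : phi a = 0 by apply: (out 0%N); rewrite ltxx.
rewrite subrr => /eqP; rewrite subr_eq0 => /eqP.
exact.
Qed.

(** The primitive of an integrable function has it as weak derivative: this is
    Fubini on the triangle, the inner integral of the derivative of the test
    function being minus the test function. *)
Lemma weak_derivative_prim (a b : R) w phi : a < b -> mu.-integrable setT (EFin \o w) ->
  test_function a b phi ->
  \int[mu]_x (derive1 phi x * prim w x) = - \int[mu]_x (phi x * w x).
Proof.
move=> ab iw tphi; rewrite fubini_triangle//; last first.
  by have := test_integrable 1%N tphi.
have out n x : ~~ (a < x < b) -> derive1n n phi x = 0 by exact: test_out tphi.
rewrite -[RHS]mulN1r -RintegralZl//; last first.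
  have [C HC] := test_bound 0%N tphi.
  apply: integrable_mul_bounded HC iw.
  exact: test_function_measurable tphi 0%N.
apply: eq_Rintegral => t _; rewrite (@tail_prim _ b).
- have pb : phi b = 0 by apply: (out 0%N); rewrite ltxx andbF.
  by rewrite (prim_test ab tphi) pb sub0r; ring.
- by have := test_integrable 1%N tphi.
- by move=> y yb; apply: (out 1%N); rewrite negb_and -!leNgt yb orbT.
Qed.

(** A plateau minus the multiple of a fixed plateau of the same integral is the
    derivative of a test function.  Hence w minus a constant is orthogonal to
    all plateaus, and the fundamental lemma applies. *)
Lemma du_bois_reymond (a b : R) w : a < b -> mu.-integrable setT (EFin \o w) ->
  (forall phi, test_function a b phi -> \int[mu]_x (derive1 phi x * w x) = 0) ->
  exists C, {ae mu, forall x, a < x < b -> w x = C}.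
Proof.
move=> ab iw H.
(* any plateau supported in ]a, b[ would do as the reference test function *)
pose c0 := a + (b - a) / 3; pose d0 := a + (b - a) * 2 / 3.
have [ac0 cd0 db0] : [/\ a < c0, c0 < d0 & d0 < b] by split; rewrite /c0 /d0; lra.
pose rho := plateau 0 c0 d0.
have trho : test_function a b rho by exact: test_plateau.
have irho := test_integrable 0%N trho.
pose m := \int[mu]_x rho x.
have mul_int phi u : test_function a b phi -> mu.-integrable setT (EFin \o u) ->
    mu.-integrable setT (EFin \o (fun x => phi x * u x)).
  move=> tphi iu; have [C HC] := test_bound 0%N tphi.
  apply: integrable_mul_bounded HC iu.
  exact: test_function_measurable tphi 0%N.
have m0 : m != 0.
  apply/negP => /eqP m0.
  have D (x : R) : is_derive x 1 (prim rho) (rho x).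
    by apply: prim_derive => //; apply/smooth_continuous/plateau_smooth.
  have pd0 : prim rho d0 = 0.
    rewrite -m0 /m; apply/esym/integral_prim => // y dy.
    by apply: plateau_out; right.
  have pc0 : prim rho c0 = 0.
    by apply: (@prim_left _ c0) => // y dy; apply: plateau_out; left.
  have := @gtr0_derive1_lt_cc _ (prim rho) c0 d0 _ _ _ c0 d0.
  rewrite pd0 pc0 ltxx => F; have : false; last by [].
  apply: F => //.
  - move=> x; rewrite in_itv/= => /andP[cx xd].
    by rewrite derive1E; have [_ ->] := D x; exact: plateau_gt0.
  - by apply: derivable_within_continuous => x _; have [] := D x.
  - by rewrite in_itv/= lexx ltW.
  - by rewrite in_itv/= lexx ltW.
pose K := \int[mu]_x (rho x * w x) / m.
have test0 n c d : a < c -> c < d -> d < b ->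
    \int[mu]_x (plateau n c d x * w x) = K * \int[mu]_x plateau n c d x.
  move=> ac cd db; pose psi := plateau n c d.
  have tpsi : test_function a b psi by exact: test_plateau.
  have ipsi := test_integrable 0%N tpsi.
  pose l := (\int[mu]_x psi x) / m.
  (* [th] has integral zero, hence its primitive has compact support *)
pose th x := psi x + (- l) * rho x.
  have sth : smooth th.
    apply/smoothP => k; have /smoothP s1 := @plateau_smooth R n c d.
    have /smoothP s2 := @plateau_smooth R 0 c0 d0.
    exact: diffnD (s1 k) (diffnM (diffn_cst _ _) (s2 k)).
  have ith : mu.-integrable setT (EFin \o th).
    exact: integrableD_EFin ipsi (integrableZl_EFin (- l) irho).
  pose c1 := Num.min c c0; pose d1 := Num.max d d0.
  have thl y : y <= c1 -> th y = 0.
    rewrite /c1 le_min => /andP[h1 h2]; rewrite /th /psi /rho !plateau_out ?mulr0 ?addr0//.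
      by left.
    by left.
  have thr y : d1 <= y -> th y = 0.
    rewrite /d1 ge_max => /andP[h1 h2]; rewrite /th /psi /rho !plateau_out ?mulr0 ?addr0//.
      by right.
    by right.
  have intth : \int[mu]_x th x = 0.
    rewrite /th RintegralD// ?RintegralZl//; last exact: integrableZl_EFin.
    by rewrite -/m /l mulNr divfK// subrr.
  have D (x : R) : is_derive x 1 (prim th) (th x).
    by apply: prim_derive => //; exact: smooth_continuous.
  have dE : derive1 (prim th) = th.
    by apply/funext => x; rewrite derive1E; have [_ ->] := D x.
  have tphi : test_function a b (prim th).
    apply: (@test_functionP _ _ c1 d1).
    - case=> [|k] x; first by have [] := D x.
      by rewrite derive1nSr dE; exact: sth.
    - move=> x [xc|dx]; first exact: prim_left xc.
      rewrite (prim_right ith thr (lexx d1) dx) -intth.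
      exact/esym/integral_prim.
    - by rewrite lt_min ac.
    - by rewrite gt_max db.
  have := H _ tphi; rewrite dE /th => E.
  have i1 := mul_int _ _ tpsi iw; have i2 := mul_int _ _ trho iw.
  have {}E : \int[mu]_x (psi x * w x + (- l) * (rho x * w x)) = 0.
    by rewrite -[RHS]E; apply: eq_Rintegral => x _; rewrite mulrDl mulrA.
  move: E; rewrite RintegralD// ?RintegralZl//; last exact: integrableZl_EFin i2.
  move=> /eqP; rewrite mulNr subr_eq0 => /eqP ->.
  by rewrite /K /l; field.
exists K; pose w' x := w x + (- K) * \1_(`]a, b[%classic : set R) x.
have iw' : mu.-integrable setT (EFin \o w').
  apply: integrableD_EFin iw (integrableZl_EFin (- K) _).
  exact: integrable_indic_itv.
have : {ae mu, forall x, a < x < b -> w' x = 0}.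
  apply: fundamental_lemma iw' _ => n c d ac cd db.
  have tpsi : test_function a b (plateau n c d) by exact: test_plateau.
  have ipsi := test_integrable 0%N tpsi.
  rewrite (@eq_Rintegral _ _ _ mu _ (fun x => plateau n c d x * w x + (- K) * plateau n c d x)).
    rewrite RintegralD// ?RintegralZl//; last 2 first.
    - exact: mul_int.
    - exact: integrableZl_EFin.
    by rewrite test0// mulNr subrr.
  move=> x _; rewrite /w' mulrDr indicE; congr (_ + _).
  case: (boolP (x \in _)); first by rewrite mulr1 mulrC.
  rewrite notin_setE/= in_itv/= => /negP h.
  have -> : plateau n c d x = 0 := test_out 0%N tpsi h.
  by rewrite !mulr0 ?mul0r.
apply: filterS; first exact: (ae_filter_ringOfSetsType mu).
move=> x h xab; have := h xab.
rewrite /w' indicE mem_set/= ?in_itv//= mulr1 => /eqP; rewrite subr_eq0 => /eqP.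
exact.
Qed.

End test_function_calculus.

Lemma ae_lebesgue_and (R : realType) (P Q S : R -> Prop) :
  {ae @lebesgue_measure R, forall x, P x} ->
  {ae @lebesgue_measure R, forall x, Q x} -> (forall x, P x -> Q x -> S x) ->
  {ae @lebesgue_measure R, forall x, S x}.
Proof.
move=> h1 h2 h; apply: negligibleS (negligibleU h1 h2) => x /= nS.
by apply/not_andP => -[p q]; exact/nS/h.
Qed.

(** * Lebesgue measure on the interval and on the line *)

Section interval_measure_bridge.
Context {R : realType} (a b : R).
Notation mu := (@lebesgue_measure R).
Local Notation leb := (leb_itv a b).
Local Notation I := (`]a, b[%classic : set R).
Implicit Types (h w : R -> R).

Let mI : measurable (I : set (measurableTypeR R)). Proof. exact: measurable_itv. Qed.

(** The measure on the interval lives on the whole line; this passes to almost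
    every point of the interval for the usual Lebesgue measure. *)
Lemma ae_leb_itv (P : R -> Prop) :
  {ae leb, forall x, P x} <-> {ae mu, forall x, a < x < b -> P x}.
Proof.
have NI (N : set (measurableTypeR R)) : leb N = mu (N `&` I) by [].
split=> -[N [mN N0 sN]].
  exists (N `&` I); split; first exact: measurableI.
    by rewrite -NI.
  by move=> x /= /not_implyP[xab nP]; split; [exact: sN|rewrite /= in_itv].
have mcI : measurable (~` I : set (measurableTypeR R)) by exact: measurableC.
exists (N `|` ~` I); split; first exact: measurableU.
  rewrite NI setIUl setICl setU0.
  by apply: (subset_measure0 _ _ _ N0) => //; exact: measurableI.
move=> x /= nP; have [xI|] := pselect (I x); last by right.
by left; apply: sN => /=; apply/not_implyP; split=> //; move: xI; rewrite /= in_itv.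
Qed.

Lemma ge0_integral_leb (f : R -> \bar R) : measurable_fun setT f ->
  (forall x, (0 <= f x)%E) ->
  (\int[leb]_x f x = \int[mu]_(x in I) f x)%E.
Proof.
move=> mf f0.
have -> : (\int[mu]_(x in I) f x = \int[leb]_(x in I) f x)%E.
  apply: eq_measure_integral => A mA AI.
  by change (mu A = mu (A `&` I)); rewrite setIidl.
have mcI : measurable (~` I : set (measurableTypeR R)) by exact: measurableC.
rewrite -[in LHS](setUv I) ge0_integral_setU//; last 2 first.
- by rewrite setUv.
- exact/disj_setPCl.
rewrite [X in (_ + X)%E = _](_ : _ = 0%E) ?adde0//.
rewrite (null_set_integral mcI)//.
  exact: measurable_funTS.
change (mu (~` I `&` I) = 0%E); rewrite setICl; exact: measure0.
Qed.

(** Truncation to the interval, in a form to which integrals over the whole line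
    apply. *)
Definition cut h (x : R) : R := \1_I x * h x.

Lemma cut_in h x : a < x < b -> cut h x = h x.
Proof. by move=> xab; rewrite /cut indicE mem_set ?mul1r//= in_itv. Qed.

Lemma cut_out h x : ~~ (a < x < b) -> cut h x = 0.
Proof.
by move=> xab; rewrite /cut indicE memNset ?mul0r//= in_itv/=; exact/negP.
Qed.

Lemma measurable_cut h : measurable_fun setT h -> measurable_fun setT (cut h).
Proof. by move=> mh; apply: measurable_funM => //; exact: measurable_indic. Qed.

Lemma ge0_integral_cut (f : R -> \bar R) : measurable_fun setT f ->
  (forall x, (0 <= f x)%E) ->
  (\int[mu]_(x in I) f x = \int[mu]_x ((\1_I x)%:E * f x))%E.
Proof.
move=> mf f0; rewrite integral_mkcond; apply: eq_integral => x _.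
by rewrite patchE indicE; case: ifPn => _; rewrite ?mul1e ?mul0e.
Qed.

Lemma integrable_cut h : leb.-integrable setT (EFin \o h) ->
  mu.-integrable setT (EFin \o cut h).
Proof.
move=> /integrableP[mh ih]; apply/integrableP; split.
  have mh' : measurable_fun setT h by exact/measurable_EFinP.
  by apply/measurable_EFinP; exact: (measurable_cut mh').
rewrite ge0_integral_leb// in ih; last exact: measurableT_comp.
rewrite ge0_integral_cut// in ih; last exact: measurableT_comp.
apply: le_lt_trans ih; rewrite le_eqVlt; apply/orP; left; apply/eqP.
apply: eq_integral => x _ /=; rewrite -EFinM normrM ger0_norm//.
Qed.

Lemma Rintegral_leb h : leb.-integrable setT (EFin \o h) ->
  \int[leb]_x h x = \int[mu]_x cut h x.
Proof.
move=> /integrableP[mh _]; rewrite /Rintegral; congr fine.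
rewrite integralE [RHS]integralE; congr (_ - _)%E.
  rewrite ge0_integral_leb//; last exact: measurable_funepos.
  rewrite ge0_integral_cut//; last exact: measurable_funepos.
  apply: eq_integral => x _; rewrite /cut !funeposE /= indicE.
  by case: (_ \in _); rewrite ?mul1e ?mul1r// mul0e mul0r maxxx.
rewrite ge0_integral_leb//; last exact: measurable_funeneg.
rewrite ge0_integral_cut//; last exact: measurable_funeneg.
apply: eq_integral => x _; rewrite /cut !funenegE /= indicE.
by case: (_ \in _); rewrite ?mul1e ?mul1r// mul0e mul0r oppr0 maxxx.
Qed.

End interval_measure_bridge.

(** * Absolute continuity of primitives *)

Section absolute_continuity_of_primitives.
Context {R : realType}.
Notation mu := (@lebesgue_measure R).
Implicit Types (w : R -> R).

(** Absolute continuity of the integral, applied to the union of the intervals. *)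
Lemma prim_absolute_continuity w : mu.-integrable setT (EFin \o w) ->
  forall e : R, 0 < e -> exists2 d : R, 0 < d &
    forall (n : nat) (u v : 'I_n -> R), (forall i, u i <= v i) ->
      trivIset setT (fun i => `]u i, v i[%classic) ->
      \sum_(i < n) (v i - u i) < d ->
      \sum_(i < n) `|prim w (v i) - prim w (u i)| < e.
Proof.
move=> iw e e0; have [d [d0 H]] := integral_normr_continuous iw e0.
exists d => // n u v uv tI sd.
pose F i := `]u i, v i[%classic : set (measurableTypeR R).
have mF i : measurable (F i) by exact: measurable_itv.
pose A := \big[setU/set0]_(i < n) F i.
have mA : measurable A by exact: bigsetU_measurable.
have sz : mu A = (\sum_(i < n) (v i - u i))%:E.
  rewrite /A (measure_bigsetU_ord _ _ mF tI).
  rewrite -sumEFin; apply: eq_bigr => i _.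
  change (mu `]u i, v i[%classic = (v i - u i)%:E).
  rewrite lebesgue_measure_itv/= lte_fin; case: ltP => // h.
  have -> : v i = u i by apply/eqP; rewrite eq_le h uv.
  by rewrite subrr.
have iabs : mu.-integrable setT (EFin \o (fun x => `|w x|)).
  exact: integrable_norm.
have Ad : (mu A < d%:E)%E by rewrite sz lte_fin.
apply: le_lt_trans (H A mA Ad).
have -> : \int[mu]_(x in A) `|w x| = \sum_(i < n) \int[mu]_(x in F i) `|w x|.
  rewrite /Rintegral /A integral_bigsetU_EFin//.
  - rewrite -sum_fine// => i _; apply: integrable_fin_num => //.
    exact: (integrable_sub (mF i) iabs).
  - exact: index_enum_uniq.
  - by apply: sub_trivIset tI.
  - by apply: measurable_funTS; have [] := integrableP _ _ _ iabs.
apply: ler_sum => i _; rewrite prim_diff_oo//.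
by apply: le_normr_Rintegral => //; exact: integrable_sub.
Qed.

Lemma prim_continuous w : mu.-integrable setT (EFin \o w) -> continuous (prim w).
Proof.
move=> iw x; apply/cvgrPdist_lt => e e0.
have [d d0 H] := prim_absolute_continuity iw e0.
have H1 y z : y <= z -> z - y < d -> `|prim w z - prim w y| < e.
  move=> yz zyd; have := H 1%N (fun=> y) (fun=> z).
  rewrite !big_ord1; apply => //.
  by move=> i j _ _ _; rewrite !ord1.
near=> y; have : `|x - y| < d by near: y; exact: cvgr_dist_lt.
have [xy|yx] := leP x y.
  by rewrite distrC ger0_norm ?subr_ge0// => h; rewrite distrC; exact: H1.
by rewrite ger0_norm ?subr_ge0 ?ltW// => h; apply: H1 => //; exact: ltW.
Unshelve. all: by end_near. Qed.

Lemma prim_bounded w : mu.-integrable setT (EFin \o w) ->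
  exists C, forall x, `|prim w x| <= C.
Proof.
move=> iw; exists (\int[mu]_t `|w t|) => x; rewrite /prim.
have iabs : mu.-integrable setT (EFin \o (fun x => `|w x|)) by exact: integrable_norm.
rewrite (le_trans (le_normr_Rintegral _ _))//; first exact: integrable_sub.
rewrite [leLHS]Rintegral_indic//; apply: le_Rintegral => //.
  exact: integrable_indicM.
by move=> y _; rewrite indicE; case: (_ \in _); rewrite ?mul1r ?mul0r.
Qed.

Lemma measurable_prim w : mu.-integrable setT (EFin \o w) ->
  measurable_fun setT (prim w).
Proof. by move=> iw; apply: continuous_measurable_fun; exact: prim_continuous. Qed.

End absolute_continuity_of_primitives.

(** * Weak derivatives *)

Section weak_derivatives.
Context {R : realType} {p : \bar R} (p1 : (1 <= p)%E) (a b : R) (ab : a < b).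
Notation mu := (@lebesgue_measure R).
Local Notation leb := (leb_itv a b).
Local Notation L := (Lp p1 a b).
Local Notation cut := (cut a b).
Implicit Types (f g u : L) (phi : R -> R).

(** Treats real and imaginary parts at once: [true] selects the real part, [false]
    the imaginary part. *)
Definition reim (s : bool) (z : R[i]) : R := if s then complex.Re z else complex.Im z.

Lemma reimD s z z' : reim s (z + z') = reim s z + reim s z'.
Proof. by case: s; case: z z' => [? ?] [? ?]. Qed.

Lemma reimM s (r : R) z : reim s (r%:C * z) = r * reim s z.
Proof. by case: s; case: z => [? ?] /=; ring. Qed.

Lemma reim_inj z z' : (forall s, reim s z = reim s z') -> z = z'.
Proof.
by move=> h; have := h true; have := h false; case: z z' {h} => [? ?] [? ?] /= -> ->.
Qed.

Lemma measurable_reim s u : measurable_fun setT (fun x => reim s (u x)).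
Proof. by case: s; [exact: measurable_Re|exact: measurable_Im]. Qed.

Definition cut_reim s u : R -> R := cut (fun x => reim s (u x)).

Lemma integrable_reim s u : leb.-integrable setT (EFin \o (fun x => reim s (u x))).
Proof. by have [h1 h2] := cLp_cintegrable u (leb_itv_fin a b); case: s. Qed.

Lemma integrable_cut_reim s u : mu.-integrable setT (EFin \o cut_reim s u).
Proof. by apply: integrable_cut; exact: integrable_reim. Qed.

Lemma reim_cintegral s (f : R -> R[i]) :
  reim s (cintegral leb setT f) = \int[leb]_x reim s (f x).
Proof. by case: s. Qed.

Lemma integrable_test_reim s n phi u : test_function a b phi ->
  leb.-integrable setT (EFin \o (fun x => derive1n n phi x * reim s (u x))).
Proof.
move=> tphi; have [h1 h2] := Lp_cintegrableM u n tphi.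
case: s; [move: h1|move: h2]; congr (_.-integrable _ _); apply/funext => x /=;
  congr (_%:E); by rewrite ?Defs.ReM ?Defs.ImM/=; ring.
Qed.

Lemma reim_test_integral s n phi u : test_function a b phi ->
  reim s (cintegral leb setT (fun x => (derive1n n phi x)%:C * u x)) =
  \int[mu]_x (derive1n n phi x * cut_reim s u x).
Proof.
move=> tphi; rewrite reim_cintegral.
under eq_Rintegral do rewrite reimM.
rewrite Rintegral_leb; last exact: integrable_test_reim.
by apply: eq_Rintegral => x _; rewrite /cut_reim /cut mulrCA.
Qed.

(** Weak derivatives are a statement on two pairs of real functions on the line. *)
Lemma weak_derivativeP j f g : weak_derivative j f g <->
  forall s phi, test_function a b phi ->
    \int[mu]_x (derive1n j phi x * cut_reim s f x) =
    (-1) ^+ j * \int[mu]_x (phi x * cut_reim s g x).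
Proof.
have signM s (z : R[i]) : reim s ((-1) ^+ j * z) = (-1) ^+ j * reim s z.
  by rewrite -(reimM s) rmorphXn/= rmorphN1.
split=> [H s phi tphi|H phi tphi].
  have := congr1 (reim s) (H _ tphi).
  rewrite reim_test_integral// signM => ->; congr (_ * _).
  by have := @reim_test_integral s 0 phi g tphi.
apply: reim_inj => s; rewrite reim_test_integral// H// signM; congr (_ * _).
by have := @reim_test_integral s 0 phi g tphi => ->.
Qed.

Lemma integrable_test_cut_reim s n phi u : test_function a b phi ->
  mu.-integrable setT (EFin \o (fun x => derive1n n phi x * cut_reim s u x)).
Proof.
move=> tphi; have [C HC] := test_bound n tphi.
apply: integrable_mul_bounded HC (integrable_cut_reim s u).
exact: test_function_measurable tphi n.
Qed.

Lemma cut_reim_inj f g : (forall s, {ae mu, forall x, a < x < b -> cut_reim s f x = cut_reim s g x}) ->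
  f = g.
Proof.
move=> h; apply/cLp_eqP/ae_leb_itv.
apply: ae_lebesgue_and (h true) (h false) _ => x h1 h2 xab; apply: reim_inj => s.
have := h1 xab; have := h2 xab; rewrite /cut_reim !cut_in// => e1 e2.
by case: s.
Qed.

Lemma weak_derivative_unique j f g g' : weak_derivative j f g ->
  weak_derivative j f g' -> g = g'.
Proof.
move=> /weak_derivativeP H /weak_derivativeP H'; apply: cut_reim_inj => s.
pose w x := cut_reim s g x - cut_reim s g' x.
have : {ae mu, forall x, a < x < b -> w x = 0}.
  apply: fundamental_lemma.
    exact: integrableB_EFin (integrable_cut_reim s g) (integrable_cut_reim s g').
  move=> n c d ac cd db; have tphi := test_plateau n ac db.
  have i1 := integrable_test_cut_reim s 0 g tphi.
  have i2 := integrable_test_cut_reim s 0 g' tphi.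
  rewrite (@eq_Rintegral _ _ _ mu _ (fun x => plateau n c d x * cut_reim s g x - plateau n c d x * cut_reim s g' x)); last first.
    by move=> x _; rewrite /w mulrBr.
  rewrite RintegralB//; apply/eqP; rewrite subr_eq0; apply/eqP.
  have := H s _ tphi; rewrite H'// => /(congr1 (fun z => (-1) ^+ j * z)).
  by rewrite !mulrA -exprD addnn -mul2n exprM sqrrN !expr1n !mul1r.
by move=> w0; apply: (ae_lebesgue_and w0 w0) => x h _ xab; apply/eqP; rewrite -subr_eq0; apply/eqP; exact: h.
Qed.

(** The derivative of a test function is a test function, so a (j+1)-st weak
    derivative is a first weak derivative of the j-th one. *)
Lemma weak_derivative_next j f g h : weak_derivative j f g ->
  weak_derivative j.+1 f h -> weak_derivative 1 g h.
Proof.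
move=> /weak_derivativeP H /weak_derivativeP H'; apply/weak_derivativeP.
move=> s phi tphi; rewrite derive1n1.
have := H s _ (test_derive tphi); have := H' s _ tphi; rewrite derive1nSr => -> E.
have := congr1 (fun z => (-1) ^+ j * z) E.
rewrite !mulrA -exprD addnS -exprD addnn -mul2n exprS exprM sqrrN expr1n expr1n mulr1 mul1r expr1.
by move=> ->.
Qed.

Lemma weak_derivative_comp j f g h : weak_derivative j f g ->
  weak_derivative 1 g h -> weak_derivative j.+1 f h.
Proof.
move=> /weak_derivativeP H /weak_derivativeP H'; apply/weak_derivativeP.
move=> s phi tphi; rewrite derive1nSr H; last exact: test_derive.
have := H' s _ tphi; rewrite derive1n1 => ->.
by rewrite mulrA -exprSr.
Qed.

Lemma weak_derivative0 f : weak_derivative 0 f f.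
Proof. by move=> phi _; rewrite expr0 mul1r. Qed.

Definition cprim u (x : R) : R[i] := prim (cut_reim true u) x +i* prim (cut_reim false u) x.

Lemma reim_cprim s u x : reim s (cprim u x) = prim (cut_reim s u) x.
Proof. by case: s. Qed.

Lemma test_prim_integral s u phi : test_function a b phi ->
  \int[mu]_x (derive1 phi x * cut (prim (cut_reim s u)) x) =
  - \int[mu]_x (phi x * cut_reim s u x).
Proof.
move=> tphi; rewrite -(weak_derivative_prim ab (integrable_cut_reim s u) tphi).
apply: eq_Rintegral => x _; have [xab|xab] := boolP (a < x < b).
  by rewrite cut_in.
by have := test_out 1%N tphi xab; rewrite derive1n1 => ->; rewrite !mul0r.
Qed.

Lemma integrable_cut_prim s u :
  mu.-integrable setT (EFin \o cut (prim (cut_reim s u))).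
Proof.
have iu := integrable_cut_reim s u; have [C HC] := prim_bounded iu.
apply: (@integrable_supported _ _ a b).
- by apply: measurable_cut; exact: measurable_prim.
- exists C => x; rewrite /cut normrM (le_trans _ (HC x))// ler_piMl//.
  by rewrite indicE; case: (_ \in _); rewrite ?normr1 ?normr0.
- by move=> x; exact: cut_out.
Qed.

(** One implication is du Bois-Reymond applied to g minus the primitive of u, the
    other one is integration by parts against test functions. *)
Lemma weak_derivative_primP g u : weak_derivative 1 g u <->
  exists C : R[i], {ae leb, forall x, g x = C + cprim u x}.
Proof.
split=> [/weak_derivativeP H|[C HC]].
  have K s : exists C, {ae mu, forall x, a < x < b -> cut_reim s g x - cut (prim (cut_reim s u)) x = C}.
    apply: du_bois_reymond => //.
      exact: integrableB_EFin (integrable_cut_reim s g) (integrable_cut_prim s u).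
    move=> phi tphi.
    have i1 := integrable_test_cut_reim s 1 g tphi.
    have i2 : mu.-integrable setT (EFin \o (fun x => derive1 phi x * cut (prim (cut_reim s u)) x)).
      have [C HC] := test_bound 1%N tphi.
      apply: integrable_mul_bounded HC (integrable_cut_prim s u).
      exact: test_function_measurable tphi 1%N.
    rewrite (@eq_Rintegral _ _ _ mu _ (fun x => derive1 phi x * cut_reim s g x - derive1 phi x * cut (prim (cut_reim s u)) x)); last first.
      by move=> x _; rewrite mulrBr.
    rewrite RintegralB//; have := H s _ tphi; rewrite derive1n1 => ->.
    by rewrite test_prim_integral// expr1 mulN1r subrr.
  have [C1 H1] := K true; have [C2 H2] := K false.
  exists (C1 +i* C2); apply/ae_leb_itv.
  apply: ae_lebesgue_and H1 H2 _ => x h1 h2 xab.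
  apply: reim_inj => s; rewrite reimD reim_cprim.
  have := h1 xab; have := h2 xab; rewrite /cut_reim !cut_in//.
  by case: s => /= e2 e1; [rewrite -e1|rewrite -e2]; rewrite subrK.
apply/weak_derivativeP => s phi tphi; rewrite derive1n1 expr1 mulN1r.
have i2 : mu.-integrable setT (EFin \o (fun x => derive1 phi x * cut (prim (cut_reim s u)) x)).
  have [D HD] := test_bound 1%N tphi.
  apply: integrable_mul_bounded HD (integrable_cut_prim s u).
  exact: test_function_measurable tphi 1%N.
have i1 := test_integrable 1%N tphi.
rewrite -test_prim_integral//.
transitivity (\int[mu]_x (reim s C * derive1 phi x + derive1 phi x * cut (prim (cut_reim s u)) x)).
  rewrite /Rintegral; congr fine; apply: ae_eq_integral => //.
  - have [] := integrableP _ _ _ (integrable_test_cut_reim s 1 g tphi).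
    by rewrite derive1n1.
  - by have [] := integrableP _ _ _ (integrableD_EFin (integrableZl_EFin (reim s C) i1) i2).
  - move/ae_leb_itv : HC => HC; apply: (ae_lebesgue_and HC HC) => x h _ _.
    have [xab|xab] := boolP (a < x < b); last first.
      by have := test_out 1%N tphi xab; rewrite derive1n1 => ->; rewrite !mul0r mulr0 add0r.
    rewrite /cut_reim !cut_in// h// reimD reim_cprim; congr (_%:E).
    by rewrite mulrDr [_ * reim s C]mulrC.
rewrite RintegralD//; last exact: integrableZl_EFin.
rewrite RintegralZl// [X in _ * X](_ : _ = 0) ?mulr0 ?add0r//.
rewrite (integral_prim i1 (d := b)); last first.
  by move=> y yb; apply: (test_out 1%N tphi); rewrite negb_and -!leNgt yb orbT.
rewrite derive1n1 (prim_test ab tphi).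
by apply: (test_out 0%N tphi); rewrite ltxx andbF.
Qed.

End weak_derivatives.

(** * Absolutely continuous representatives *)

Section absolutely_continuous_representatives.
Context {R : realType} (a b : R).
Notation mu := (@lebesgue_measure R).
Local Notation leb := (leb_itv a b).
Local Notation AC := (absolutely_continuous_itv a b).
Implicit Types (g h : R -> R[i]).

Lemma ler_normcB (z w : R[i]) : normc (z - w) <= normc z + normc w.
Proof. by rewrite -(normcN w); exact: le_normcD. Qed.

Lemma normc_le_reim (z : R[i]) : normc z <= `|reim true z| + `|reim false z|.
Proof.
rewrite normcE2 /=.
rewrite -[leRHS]ger0_norm ?addr_ge0// -sqrtr_sqr ler_wsqrtr//.
rewrite sqrrD !real_normK ?num_real//.
by rewrite lerD2r lerDl mulrn_wge0// mulr_ge0.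
Qed.

Lemma ac_lin (c : R[i]) g h : AC g -> AC h -> AC (fun x => c * g x + h x).
Proof.
move=> acg ach e e0.
have c1 : 0 < normc c + 1 by rewrite ltr_wpDl ?normc_ge0.
have [d1 d10 H1] := acg (e / 2 / (normc c + 1)) ltac:(by rewrite divr_gt0// divr_gt0).
have [d2 d20 H2] := ach (e / 2) ltac:(by rewrite divr_gt0).
exists (Num.min d1 d2) => [|n u v uv tI]; first by rewrite lt_min d10.
rewrite lt_min => /andP[/(H1 _ _ _ uv tI) h1 /(H2 _ _ _ uv tI) h2].
have : \sum_(i < n) normc ((c * g (v i) + h (v i)) - (c * g (u i) + h (u i))) <=
    (normc c + 1) * (\sum_(i < n) normc (g (v i) - g (u i))) +
    \sum_(i < n) normc (h (v i) - h (u i)).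
  rewrite mulr_sumr -big_split/=; apply: ler_sum => i _.
  rewrite opprD addrACA -mulrBr (le_trans (le_normcD _ _))// lerD2r normcM.
  by rewrite ler_wpM2r ?normc_ge0// lerDl.
move/le_lt_trans; apply; rewrite [ltRHS](splitr e) ltrD//.
by move: h1; rewrite ltr_pdivlMr// mulrC.
Qed.

Lemma ac_dist g x : AC g -> a < x < b -> forall e : R, 0 < e ->
  exists2 d : R, 0 < d & forall y, a < y < b -> `|x - y| < d -> normc (g x - g y) < e.
Proof.
move=> acg /andP[ax xb] e e0; have [d d0 H] := acg e e0; exists d => // y /andP[ay yb].
have H1 s t : a < s -> s <= t -> t < b -> t - s < d -> normc (g t - g s) < e.
  move=> as_ st tb ts; have := H 1%N (fun=> s) (fun=> t).
  by rewrite !big_ord1; apply=> // i j _ _ _; rewrite !ord1.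
have [xy|yx] := leP x y.
  rewrite distrC ger0_norm ?subr_ge0// => h.
  by rewrite -normcN opprB; exact: H1.
by rewrite ger0_norm ?subr_ge0 ?ltW// => h; apply: H1 => //; exact: ltW.
Qed.

(** A property that holds almost everywhere holds somewhere in every
    subinterval. *)
Lemma ae_leb_exists (P : R -> Prop) (c d : R) : {ae leb, forall x, P x} ->
  a <= c -> c < d -> d <= b -> exists y, c < y < d /\ P y.
Proof.
move=> /ae_leb_itv [N [mN N0 sN]] ac cd db; apply: contrapT => nex.
have : (mu `]c, d[%classic <= mu N)%E.
  apply: le_measure; rewrite ?inE//.
  move=> x /=; rewrite in_itv/= => xcd; apply: sN => /= Px; apply: nex.
  exists x; split => //; apply: Px.
  by move/andP: xcd => [cx xd]; rewrite (le_lt_trans ac)// (lt_le_trans xd).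
rewrite N0 lebesgue_measure_itv/= lte_fin cd EFinN -EFinB lee_fin.
by rewrite subr_le0 leNgt cd.
Qed.

(** Two continuous functions that agree almost everywhere agree at points
    arbitrarily near x, hence at x. *)
Lemma ac_ae_eq g h x : AC g -> AC h -> {ae leb, forall x, g x = h x} ->
  a < x < b -> g x = h x.
Proof.
move=> acg ach gh xab; apply/eqP; rewrite -subr_eq0; apply/eqP/eq0_normc/eqP.
rewrite eq_le normc_ge0 andbT; apply/ler_addgt0Pr => e e0; rewrite add0r.
have [d1 d10 H1] := ac_dist acg xab (e := e / 2) ltac:(by rewrite divr_gt0).
have [d2 d20 H2] := ac_dist ach xab (e := e / 2) ltac:(by rewrite divr_gt0).
have /andP[ax xb] := xab.
pose d := Num.min (Num.min d1 d2) (b - x).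
have d0 : 0 < d by rewrite !lt_min d10 d20 subr_gt0.
have dd1 : d <= d1 by rewrite /d !ge_min lexx.
have dd2 : d <= d2 by rewrite /d !ge_min lexx orbT.
have dd3 : d <= b - x by rewrite /d !ge_min lexx orbT.
have [||| y [/andP[xy yd] ghy]] := ae_leb_exists gh (c := x) (d := x + d).
- exact: ltW.
- by rewrite ltrDl.
- by rewrite -lerBrDl.
have yab : a < y < b.
  by rewrite (lt_trans ax xy)/= (lt_le_trans yd)// -lerBrDl.
have xyd : `|x - y| < d.
  by rewrite distrC ger0_norm ?subr_ge0 ?ltW// ltrBlDl.
have -> : g x - h x = (g x - g y) - (h x - h y) by rewrite ghy; ring.
apply: ltW; apply: le_lt_trans (ler_normcB _ _) _.
by rewrite [ltRHS](splitr e) ltrD ?H1 ?H2// (lt_le_trans xyd).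
Qed.

End absolutely_continuous_representatives.

Section sobolev_representatives.
Context {R : realType} {p : \bar R} (p1 : (1 <= p)%E) (a b : R) (ab : a < b).
Notation mu := (@lebesgue_measure R).
Local Notation leb := (leb_itv a b).
Local Notation L := (Lp p1 a b).
Local Notation AC := (absolutely_continuous_itv a b).
Implicit Types (f u v : L) (g h : R -> R[i]).

Lemma ac_cprim (C : R[i]) u : AC (fun x => C + cprim u x).
Proof.
move=> e e0.
have e20 : 0 < e / 2 by rewrite divr_gt0.
have [d1 d10 H1] := prim_absolute_continuity (integrable_cut_reim true u) e20.
have [d2 d20 H2] := prim_absolute_continuity (integrable_cut_reim false u) e20.
exists (Num.min d1 d2) => [|n s t st tI]; first by rewrite lt_min d10.
have st' i : s i <= t i by have [] := st i.
rewrite lt_min => /andP[/(H1 _ _ _ st' tI) h1 /(H2 _ _ _ st' tI) h2].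
rewrite [ltRHS](splitr e); apply: le_lt_trans (ltrD h1 h2).
rewrite -big_split/=; apply: ler_sum => i _.
rewrite opprD addrACA subrr add0r (le_trans (normc_le_reim _))//.
Qed.

Lemma ac_reprE f g : AC g -> {ae leb, forall x, f x = g x} ->
  forall x, a < x < b -> ac_repr f x = g x.
Proof.
move=> acg fg x xab.
have [ach fh] : AC (ac_repr f) /\ {ae leb, forall x, f x = ac_repr f x}.
  by apply: (@xgetPex _ _ [set h | AC h /\ {ae leb, forall y, f y = h y}]); exists g.
apply: ac_ae_eq xab => //; apply: filterS2 fg fh => y <-.
by move=> ->.
Qed.

End sobolev_representatives.

(** * Integration by parts *)

Section integration_by_parts.
Context {R : realType}.
Notation mu := (@lebesgue_measure R).
Implicit Types (w g G h : R -> R).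

Lemma integrable_indic_continuousM (c d : R) h w : continuous h ->
  mu.-integrable setT (EFin \o w) ->
  mu.-integrable setT (EFin \o (fun x => \1_(`[c, d]%classic : set R) x * (h x * w x))).
Proof.
move=> ch iw; pose I := (`[c, d]%classic : set R).
have mI : measurable (I : set (measurableTypeR R)) by exact: measurable_itv.
have [D HD] : exists D, forall x, `|\1_I x * h x| <= D.
  have /compact_bounded [M [Mr HM]] : compact (h @` I).
    by apply: continuous_compact; [exact: continuous_subspaceT|exact: segment_compact].
  exists (Num.max 0 (M + 1)) => x; rewrite indicE.
  have [xI|_] := boolP (x \in I); last by rewrite mul0r normr0 le_max lexx.
  rewrite mul1r le_max; apply/orP; right; apply: (HM (M + 1)); first by rewrite ltrDl.
  by exists x => //; rewrite inE in xI.
have mh : measurable_fun setT (fun x => \1_I x * h x).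
  apply: measurable_funM; first exact: measurable_indic.
  exact: continuous_measurable_fun.
have := integrable_mul_bounded mh HD iw.
by congr (mu.-integrable _ _); apply/funext => x /=; rewrite mulrA.
Qed.

Lemma integrable_continuousM (c d : R) h w : continuous h ->
  mu.-integrable setT (EFin \o w) ->
  mu.-integrable `[c, d] (EFin \o (fun x => h x * w x)).
Proof.
move=> ch iw; have mI : measurable (`[c, d]%classic : set (measurableTypeR R)).
  exact: measurable_itv.
apply/(integrable_mkcond _ mI); have := integrable_indic_continuousM c d ch iw.
congr (mu.-integrable _ _); apply/funext => x /=.
by rewrite patchE indicE; case: (_ \in _); rewrite ?mul1r ?mul0r.
Qed.

(** Fubini on the triangle for the function g cut down to [c, d], whose tail
    integrals are G d - G c left of c and G d - G t on [c, d]. *)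
Lemma prim_by_parts (C c d : R) G g w : c <= d -> continuous g ->
  (forall x : R, is_derive x 1 G (g x)) -> mu.-integrable setT (EFin \o w) ->
  \int[mu]_(s in `[c, d]) (g s * (C + prim w s)) =
    G d * (C + prim w d) - G c * (C + prim w c) - \int[mu]_(s in `[c, d]) (G s * w s).
Proof.
move=> cd cg dG iw.
have cG : continuous G.
  by move=> x; apply/differentiable_continuous/derivable1_diffP; have [] := dG x.
pose I := (`[c, d]%classic : set R).
have mI : measurable (I : set (measurableTypeR R)) by exact: measurable_itv.
have iI : mu.-integrable setT (EFin \o (\1_I : R -> R)) by exact: integrable_indic_itv.
have iIhw (h : R -> R) : continuous h ->
    mu.-integrable setT (EFin \o (fun x => \1_I x * (h x * w x))).
  by move=> ch; exact: integrable_indic_continuousM.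
have iIh (h : R -> R) : continuous h -> mu.-integrable setT (EFin \o (fun x => \1_I x * h x)).
  move=> ch; have := integrable_indic_continuousM c d ch iI.
  congr (mu.-integrable _ _); apply/funext => x /=; congr (_%:E).
  by rewrite mulrC -mulrA -expr2 indicE -natrX; case: (_ \in _); rewrite mulrC.
have FTC s t : s <= t -> \int[mu]_(x in `[s, t]) g x = G t - G s.
  rewrite le_eqVlt => /orP[/eqP ->|st].
    by rewrite set_itv1 Rintegral_set1 subrr.
  rewrite /Rintegral (@continuous_FTC2 _ g G)//.
  - exact: continuous_subspaceT.
  - split.
    + by move=> x _; have [] := dG x.
    + exact/cvg_at_right_filter/cG.
    + exact/cvg_at_left_filter/cG.
  - by move=> x _; rewrite derive1E; have [_ ->] := dG x.
pose gc x := \1_I x * g x.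
have tail t : \int[mu]_(s in `[t, +oo[) gc s =
    \1_(`]-oo, c[%classic : set R) t * (G d - G c) + \1_I t * (G d - G t).
  rewrite [LHS]Rintegral_indic//.
  have [tc|ct] := ltP t c.
    rewrite indicE mem_set ?mul1r//= indicE memNset ?mul0r ?addr0; last first.
      by rewrite /I /= in_itv/= leNgt tc.
    rewrite -FTC// [RHS]Rintegral_indic//; apply: eq_Rintegral => s _.
    rewrite /gc !indicE; have [|sI] := boolP (s \in I); last by rewrite !mul0r mulr0.
    rewrite inE /I /= in_itv/= => /andP[cs sd].
    by rewrite mem_set ?mul1r//= in_itv/= andbT (le_trans (ltW tc) cs).
  rewrite indicE memNset ?mul0r ?add0r; last by rewrite /= in_itv/= ltNge ct.
  have [td|dt] := leP t d.
    rewrite indicE mem_set ?mul1r//=; last by rewrite /I/= in_itv/= ct.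
    rewrite -FTC// [RHS]Rintegral_indic//; apply: eq_Rintegral => s _.
    rewrite /gc mulrA; congr (_ * _); rewrite !indicE.
    rewrite -natrM mulnb; congr (nat_of_bool _)%:R.
    rewrite -in_setI; congr (_ \in _); apply/seteqP; split => x; rewrite /I /= !in_itv/= ?andbT.
      by move=> [tx /andP[_ xd]]; rewrite tx xd.
    by move=> /andP[tx xd]; split => //; rewrite xd (le_trans ct tx).
  rewrite indicE memNset ?mul0r; last by rewrite /I /= in_itv/= (leNgt t) dt andbF.
  rewrite (@eq_Rintegral _ _ _ mu _ (cst 0)); first by rewrite /Rintegral integral0.
  move=> s _; rewrite /gc !indicE; have [|] := boolP (s \in `[t, +oo[%classic); last by rewrite mul0r.
  rewrite inE/= in_itv/= andbT => ts; rewrite [s \in I]memNset ?mul0r ?mulr0//.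
  by rewrite /I/= in_itv/= [_ <= d]leNgt (lt_le_trans dt ts) andbF.
have E1 : \int[mu]_(s in I) (g s * prim w s) =
    (G d - G c) * prim w c + (G d * (prim w d - prim w c) - \int[mu]_(s in I) (G s * w s)).
  rewrite [LHS]Rintegral_indic//.
  rewrite (@eq_Rintegral _ _ _ mu _ (fun s => gc s * prim w s)); last first.
    by move=> s _; rewrite /gc mulrA.
  rewrite fubini_triangle//; last exact: iIh.
  have m1 : measurable (`]-oo, c[%classic : set (measurableTypeR R)) by exact: measurable_itv.
  have i1 := integrableZl_EFin (G d - G c) (integrable_indicM m1 iw).
  have i2 := integrableZl_EFin (G d) (integrable_indicM mI iw).
  have i3 := iIhw _ cG.
  have i23 := integrableB_EFin i2 i3.
  rewrite (@eq_Rintegral _ _ _ mu _ (fun t => (G d - G c) * (\1_(`]-oo, c[%classic : set R) t * w t)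
      + (G d * (\1_I t * w t) - \1_I t * (G t * w t)))); last first.
    by move=> t _; rewrite tail; ring.
  rewrite RintegralD// RintegralB// !RintegralZl//; try exact: integrable_indicM.
  rewrite -(Rintegral_indic w m1) -(Rintegral_indic w mI) -(Rintegral_indic (fun t => G t * w t) mI).
  rewrite prim_diff_cc//; congr (_ * _ + _).
  by rewrite Rintegral_itv_bndo_bndc//; exact: integrable_sub.
have ig : mu.-integrable I (EFin \o g).
  apply/(integrable_mkcond _ mI).
  have := iIh _ cg; congr (mu.-integrable _ _); apply/funext => x /=.
  by rewrite patchE indicE; case: (_ \in _); rewrite ?mul1r ?mul0r.
have igp : mu.-integrable I (EFin \o (fun s => g s * prim w s)).
  apply/(integrable_mkcond _ mI).
  have cgp : continuous (fun s => g s * prim w s).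
    by move=> x; apply: cvgM; [exact: cg|exact: (prim_continuous iw)].
  have := iIh _ cgp.
  congr (mu.-integrable _ _); apply/funext => x /=.
  by rewrite patchE indicE; case: (_ \in _); rewrite ?mul1r ?mul0r.
have iCg : mu.-integrable I (EFin \o (fun s => C * g s)).
  by have := integrableZl mI C ig.
rewrite (@eq_Rintegral _ _ _ mu I (fun s => C * g s + g s * prim w s)); last first.
  by move=> s _; ring.
rewrite RintegralD// RintegralZl// FTC// E1; ring.
Qed.

End integration_by_parts.

Section oriented_integrals.
Context {R : realType} {p : \bar R} (p1 : (1 <= p)%E) (a b : R).
Notation mu := (@lebesgue_measure R).
Local Notation leb := (leb_itv a b).
Local Notation L := (Lp p1 a b).
Implicit Types (f u v : L) (g h : R -> R) (s : bool).

(** The real counterpart of the oriented integral in the canonical form. *)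
Definition oint (c x : R) g : R :=
  if c <= x then \int[mu]_(t in `[c, x]) g t else - \int[mu]_(t in `[x, c]) g t.

Lemma reim_oriented s c x (f : R -> R[i]) :
  reim s (oriented_cintegral c x f) = oint c x (fun t => reim s (f t)).
Proof. by rewrite /oriented_cintegral /oint; case: ifPn => _; case: s. Qed.

Lemma oint_prim c x g : mu.-integrable setT (EFin \o g) ->
  oint c x g = prim g x - prim g c.
Proof.
move=> ig; rewrite /oint; case: leP => cx; first by rewrite prim_diff_cc.
by rewrite -(prim_diff_cc ig (ltW cx)) opprB.
Qed.

Lemma ae_eq_oint c x g h : a < c < b -> a < x < b ->
  measurable_fun setT g -> measurable_fun setT h ->
  {ae mu, forall t, a < t < b -> g t = h t} -> oint c x g = oint c x h.
Proof.
have K y z : a < y -> z < b -> measurable_fun setT g -> measurable_fun setT h ->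
    {ae mu, forall t, a < t < b -> g t = h t} ->
    \int[mu]_(t in `[y, z]) g t = \int[mu]_(t in `[y, z]) h t.
  move=> ay zb mg mh gh; rewrite /Rintegral; congr fine; apply: ae_eq_integral => //.
  - by apply: measurable_funTS; exact/measurable_EFinP.
  - by apply: measurable_funTS; exact/measurable_EFinP.
  - apply: (ae_lebesgue_and gh gh) => t H _ /=; rewrite in_itv/= => /andP[yt tz].
    by rewrite H// (lt_le_trans ay yt) (le_lt_trans tz zb).
move=> /andP[ac cb] /andP[ax xb] mg mh gh; rewrite /oint.
by case: ifPn => _; rewrite (K _ _ _ _ mg mh gh).
Qed.

Lemma oint_by_parts (C c x : R) G g w : continuous g ->
  (forall y : R, is_derive y 1 G (g y)) -> mu.-integrable setT (EFin \o w) ->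
  oint c x (fun t => g t * (C + prim w t)) =
    G x * (C + prim w x) - G c * (C + prim w c) - oint c x (fun t => G t * w t).
Proof.
move=> cg dG iw; rewrite /oint; case: leP => cx.
  by rewrite (prim_by_parts C cx cg dG iw).
by rewrite (prim_by_parts C (ltW cx) cg dG iw); ring.
Qed.

Lemma oint_scale k c x g : (forall y z : R, mu.-integrable `[y, z] (EFin \o g)) ->
  oint c x (fun t => k * g t) = k * oint c x g.
Proof. by move=> ig; rewrite /oint; case: ifPn => _; rewrite RintegralZl// mulrN. Qed.

Lemma measurable_kernel n (x : R) : continuous (fun t : R => (x - t) ^+ n).
Proof.
move=> t; apply: (@continuous_comp _ _ _ (fun t : R => x - t) (fun y : R => y ^+ n)).
  by apply: cvgB; [exact: cvg_cst|exact: cvg_id].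
exact: exprn_continuous.
Qed.

Lemma kernel_derive n (x t : R) :
  is_derive t 1 (fun s : R => - ((x - s) ^+ n.+1 / n.+1%:R)) ((x - t) ^+ n).
Proof.
have h1 : is_derive t 1 (fun s : R => x - s) (-1).
  by rewrite -(sub0r (1 : R)); apply: is_deriveB.
have h2 := is_deriveX n.+1 h1.
have h3 := is_deriveZ (- n.+1%:R^-1) h2.
have -> : (fun s : R => - ((x - s) ^+ n.+1 / n.+1%:R)) = - n.+1%:R^-1 \*: (fun s : R => x - s) ^+ n.+1.
  by apply/funext => s; rewrite /= exprfctE mulrC -mulNr.
apply: is_derive_eq h3 _; rewrite /GRing.scale /=.
by rewrite mulrN1 mulNr mulrN opprK mulKf// pnatr_eq0.
Qed.

(** One step of Taylor's formula: integration by parts against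
    -(x - t)^(n+1) / (n+1), which vanishes at t = x and has derivative
    (x - t)^n. *)
Lemma oriented_parts n u v C c x : a < c < b -> a < x < b ->
  {ae leb, forall t, v t = C + cprim u t} ->
  oriented_cintegral c x (fun t => ((x - t) ^+ n)%:C * v t) =
  ((x - c) ^+ n.+1 / n.+1%:R)%:C * (C + cprim u c) +
  (n.+1%:R^-1)%:C * oriented_cintegral c x (fun t => ((x - t) ^+ n.+1)%:C * u t).
Proof.
move=> cab xab /ae_leb_itv vE; apply: reim_inj => s.
have mk m : measurable_fun setT (fun t : R => (x - t) ^+ m).
  by apply: continuous_measurable_fun; exact: measurable_kernel.
have iw := integrable_cut_reim s u.
have mw : measurable_fun setT (cut_reim s u).
  by have [/measurable_EFinP] := integrableP _ _ _ iw.
rewrite reimD !reimM reimD reim_cprim !reim_oriented.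
have -> : (fun t => reim s (((x - t) ^+ n)%:C * v t)) = (fun t => (x - t) ^+ n * reim s (v t)).
  by apply/funext => t; rewrite reimM.
have -> : (fun t => reim s (((x - t) ^+ n.+1)%:C * u t)) = (fun t => (x - t) ^+ n.+1 * reim s (u t)).
  by apply/funext => t; rewrite reimM.
rewrite (@ae_eq_oint c x _ (fun t => (x - t) ^+ n * (reim s C + prim (cut_reim s u) t)) cab xab); last first.
- by apply: (ae_lebesgue_and vE vE) => t H _ tab; rewrite H// reimD reim_cprim.
- apply: measurable_funM; first exact: mk.
  by apply: measurable_funD => //; exact: measurable_prim.
- by apply: measurable_funM; [exact: mk|exact: measurable_reim].
rewrite (oint_by_parts _ _ _ (@measurable_kernel n x) (kernel_derive n x) iw).
rewrite subrr expr0n/= mul0r oppr0 mul0r add0r.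
rewrite [oint c x (fun t => (x - t) ^+ n.+1 * reim s (u t))](@ae_eq_oint c x _ (fun t => (x - t) ^+ n.+1 * cut_reim s u t) cab xab); last first.
- by apply: aeW => t tab; rewrite /cut_reim cut_in.
- by apply: measurable_funM; [exact: mk|exact: mw].
- by apply: measurable_funM; [exact: mk|exact: measurable_reim].
have -> : (fun t => - ((x - t) ^+ n.+1 / n.+1%:R) * cut_reim s u t) =
    (fun t => - n.+1%:R^-1 * ((x - t) ^+ n.+1 * cut_reim s u t)).
  by apply/funext => t; ring.
rewrite oint_scale; first by ring.
by move=> y z; apply: integrable_continuousM => //; exact: measurable_kernel.
Qed.

End oriented_integrals.

(** * Taylor's formula for Sobolev functions *)

Section sobolev_functions.
Context {R : realType} {p : \bar R} (p1 : (1 <= p)%E) (k : nat) (a b x0 : R).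
Hypothesis x0ab : a < x0 < b.
Notation mu := (@lebesgue_measure R).
Local Notation leb := (leb_itv a b).
Local Notation L := (Lp p1 a b).
Local Notation W := (sobolev p1 k a b).
Implicit Types (f g : W) (u v : L).

Let ab : a < b. Proof. by move: x0ab => /andP[]; exact: lt_trans. Qed.

Lemma wderivP f j : (j <= k)%N -> weak_derivative j f (wderiv j f).
Proof.
case: j => [_|j jk]; first exact: weak_derivative0.
rewrite /wderiv; apply: (@xgetPex _ _ [set g | weak_derivative j.+1 f g]).
by have := sobolev_valP f; rewrite inE; apply.
Qed.

Lemma wderiv_eq u v j : weak_derivative j u v -> wderiv j u = v.
Proof.
move=> uv; case: j uv => [|j] uv; last first.
  apply: xget_unique => // w uw; exact: weak_derivative_unique uw uv.
exact: weak_derivative_unique (weak_derivative0 u) uv.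
Qed.

Lemma wderiv_lin (c : R[i]) f g j : (j <= k)%N ->
  wderiv j (c *: f + g : W) = c *: wderiv j f + wderiv j g.
Proof.
move=> jk; apply: wderiv_eq => phi tphi.
have -> : (sobolev_val (c *: f + g) = c *: sobolev_val f + sobolev_val g) by [].
have E := @cintegral_Lp_linear _ _ p1 a b (wderiv j f) (wderiv j g) c phi 0 tphi.
rewrite cintegral_Lp_linear// (wderivP f jk tphi) (wderivP g jk tphi) E.
by rewrite mulrDr mulrCA.
Qed.

Lemma wderiv_next f j : (j < k)%N -> weak_derivative 1 (wderiv j f) (wderiv j.+1 f).
Proof.
by move=> jk; apply: weak_derivative_next (wderivP f (ltnW jk)) (wderivP f jk).
Qed.

(** The absolutely continuous representative is the constant plus primitive
    given by du Bois-Reymond, the constant being computed at the base point. *)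
Lemma ac_repr_prim u v : weak_derivative 1 u v ->
  {ae leb, forall x, u x = ac_repr u x0 - cprim v x0 + cprim v x} /\
  forall x, a < x < b -> ac_repr u x = ac_repr u x0 - cprim v x0 + cprim v x.
Proof.
move=> /(weak_derivative_primP ab)[C HC].
have E := ac_reprE (ac_cprim C v) HC.
have -> : ac_repr u x0 - cprim v x0 = C by rewrite E// addrK.
by [].
Qed.

Lemma anchor_lin (c : R[i]) f g j : (j < k)%N ->
  anchor x0 j (c *: f + g) = c * anchor x0 j f + anchor x0 j g.
Proof.
move=> jk; rewrite /anchor wderiv_lin ?(ltnW jk)//.
have [af _] := ac_repr_prim (wderiv_next f jk).
have [ag _] := ac_repr_prim (wderiv_next g jk).
have acf := ac_cprim (ac_repr (wderiv j f) x0 - cprim (wderiv j.+1 f) x0) (wderiv j.+1 f).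
have acg := ac_cprim (ac_repr (wderiv j g) x0 - cprim (wderiv j.+1 g) x0) (wderiv j.+1 g).
have /(ac_reprE (ac_lin c acf acg)) -> // : {ae leb, forall x, (c *: wderiv j f + wderiv j g : L) x =
    c * (ac_repr (wderiv j f) x0 - cprim (wderiv j.+1 f) x0 + cprim (wderiv j.+1 f) x) +
    (ac_repr (wderiv j g) x0 - cprim (wderiv j.+1 g) x0 + cprim (wderiv j.+1 g) x)}.
  have h3 := cLp_fun_lin c (wderiv j f) (wderiv j g).
  apply: filterS3 h3 af ag => x E1 E2 E3.
  exact: etrans E1 (congr2 (fun y z => c * y + z) E2 E3).
by congr (_ * _ + _); exact: subrK.
Qed.

(** Induction on n: the remainder involves the derivative of order n+1, which is
    a constant plus a primitive of the next one, and integration by parts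
    yields the next Taylor term. *)
Lemma taylor f n x : (n < k)%N -> a < x < b ->
  ac_repr f x = \sum_(j < n.+1) anchor x0 j f * ((x - x0) ^+ j / j`!%:R)%:C +
    (n`!%:R^-1)%:C * oriented_cintegral x0 x (fun t => ((x - t) ^+ n)%:C * wderiv n.+1 f t).
Proof.
move=> nk xab; elim: n nk => [|n IH] nk.
  rewrite big_ord1 expr0 fact0 divr1 mulr1 invr1 mul1r.
  have [_ ->//] := ac_repr_prim (wderiv_next f nk).
  rewrite -addrA; congr (_ + _); apply: reim_inj => s.
  rewrite reim_oriented reimD (_ : - cprim _ _ = (-1)%:C * cprim (wderiv 1 f) x0); last first.
    by rewrite rmorphN1 mulN1r.
  rewrite reimM !reim_cprim.
  rewrite (@ae_eq_oint _ a b x0 x _ (cut_reim s (wderiv 1 f)) x0ab xab).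
  - by rewrite oint_prim ?integrable_cut_reim//; ring.
  - have -> : (fun t => reim s (((x - t) ^+ 0)%:C * wderiv 1 f t)) = (fun t => reim s (wderiv 1 f t)).
      by apply/funext => t; rewrite reimM expr0 mul1r.
    exact: measurable_reim.
  - by have [/measurable_EFinP] := integrableP _ _ _ (integrable_cut_reim s (wderiv 1 f)).
  - by apply: aeW => t tab; rewrite reimM expr0 mul1r /cut_reim cut_in.
rewrite IH; last exact: ltn_trans nk.
have [vE _] := ac_repr_prim (wderiv_next f nk).
rewrite (oriented_parts n x0ab xab vE) subrK [in RHS]big_ord_recr/= -addrA; congr (_ + _).
rewrite mulrDr !mulrA; congr (_ + _).
  rewrite [RHS]mulrC; congr (_ * _); rewrite -rmorphM/=; congr (_ %:C).
  by rewrite factS natrM invfM; ring.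
congr (_ * _); rewrite -rmorphM/=; congr (_ %:C).
by rewrite factS natrM invfM mulrC.
Qed.

End sobolev_functions.

(** * Sobolev functions with prescribed jets *)

Section sobolev_coordinates.
Context {R : realType} {p : \bar R} (p1 : (1 <= p)%E) (k : nat) (a b x0 : R).
Hypothesis x0ab : a < x0 < b.
Notation mu := (@lebesgue_measure R).
Local Notation leb := (leb_itv a b).
Local Notation L := (Lp p1 a b).
Local Notation W := (sobolev p1 k a b).
Implicit Types (f g : W) (u v : L).

Let ab : a < b. Proof. by move: x0ab => /andP[]; exact: lt_trans. Qed.

Lemma antiderivative (c : R[i]) u :
  exists2 v : L, weak_derivative 1 v u & ac_repr v x0 = c.
Proof.
pose h x := (c - cprim u x0) + cprim u x.
have [C1 H1] := prim_bounded (integrable_cut_reim true u).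
have [C2 H2] := prim_bounded (integrable_cut_reim false u).
have mh : cmeasurable h.
  split.
    have -> : (fun x => complex.Re (h x)) = (fun x => reim true (c - cprim u x0) + prim (cut_reim true u) x).
      by apply/funext => x; rewrite -(reim_cprim true u) -reimD.
    by apply: measurable_funD => //; apply: measurable_prim; exact: integrable_cut_reim.
  have -> : (fun x => complex.Im (h x)) = (fun x => reim false (c - cprim u x0) + prim (cut_reim false u) x).
    by apply/funext => x; rewrite -(reim_cprim false u) -reimD.
  by apply: measurable_funD => //; apply: measurable_prim; exact: integrable_cut_reim.
have Lh : inLp leb p h.
  apply: (inLp_bounded (leb_itv_fin a b) p1 mh (C := normc (c - cprim u x0) + (C1 + C2))) => x.
  rewrite (le_trans (le_normcD _ _))// lerD2l (le_trans (normc_le_reim _))// !reim_cprim.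
  exact: lerD.
have hE := toLpE p1 Lh.
exists (toLp leb p1 h).
  by apply/(weak_derivative_primP ab); exists (c - cprim u x0).
by rewrite (ac_reprE (ac_cprim (c - cprim u x0) u) hE x0ab) subrK.
Qed.

(** A tower of successive antiderivatives with prescribed values at the base
    point, built downwards from u. *)
Lemma antiderivatives (c : nat -> R[i]) m u : exists G : nat -> L, G m = u /\
  forall j, (j < m)%N -> weak_derivative 1 (G j) (G j.+1) /\ ac_repr (G j) x0 = c j.
Proof.
elim: m u => [|m IH] u; first by exists (fun=> u).
have [v vu vc] := antiderivative (c m) u; have [G [Gm HG]] := IH v.
exists (fun j => if (j <= m)%N then G j else u); split; first by rewrite ltnn.
move=> j; rewrite ltnS => jm; rewrite jm; move: (jm); rewrite leq_eqVlt.
move=> /orP[/eqP jE|jm']; first by rewrite jE ltnn Gm.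
by rewrite jm'; exact: HG.
Qed.

Lemma sobolev_exists (c : nat -> R[i]) u : exists f : W,
  wderiv k f = u /\ forall j, (j < k)%N -> anchor x0 j f = c j.
Proof.
have [G [Gk HG]] := antiderivatives c k u.
have wG j : (j <= k)%N -> weak_derivative j (G 0%N) (G j).
  elim: j => [_|j IH jk]; first exact: weak_derivative0.
  by apply: weak_derivative_comp (IH (ltnW jk)) _; have [] := HG j jk.
have G0 : G 0%N \in @sobolev_pred R p p1 k a b.
  by rewrite inE => j /andP[_ jk]; exists (G j); exact: wG.
exists (Sobolev G0); split; first by rewrite -Gk; apply: wderiv_eq => //; exact: wG.
move=> j jk; have [_ <-] := HG j jk; rewrite /anchor.
by rewrite (wderiv_eq (wG j (ltnW jk))).
Qed.

(** Downwards from order k: the derivative of order j is determined by the next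
    one and by its value at the base point. *)
Lemma sobolev_inj f g : wderiv k f = wderiv k g ->
  (forall j, (j < k)%N -> anchor x0 j f = anchor x0 j g) -> f = g.
Proof.
move=> kE aE; apply: val_inj.
have H j : (j <= k)%N -> wderiv (k - j)%N f = wderiv (k - j)%N g.
  elim: j => [_|j IH jk]; first by rewrite subn0.
  have lt_k : (k - j.+1 < k)%N by rewrite ltn_subrL; case: (k) jk.
  have [fE _] := ac_repr_prim x0ab (wderiv_next f lt_k).
  have [gE _] := ac_repr_prim x0ab (wderiv_next g lt_k).
  have E : (k - j.+1).+1 = (k - j)%N by rewrite -subSn// subSS.
  have IHj := IH (ltnW jk); rewrite -E in IHj.
  apply/cLp_eqP; apply: filterS2 fE gE => x E1 E2.
  exact: (etrans E1 (etrans (congr2 (fun r w => r - cprim w x0 + cprim w x)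
    (aE _ lt_k) IHj) (esym E2))).
by have := H k (leqnn k); rewrite subnn.
Qed.

Lemma sobolev_real f : (forall j, (j < k)%N -> complex.Im (anchor x0 j f) = 0) ->
  {ae leb, forall x, complex.Im (wderiv k f x) = 0} ->
  {ae leb, forall x, complex.Im (f x) = 0}.
Proof.
move=> aE kE.
have H j : (j <= k)%N -> {ae leb, forall x, complex.Im (wderiv (k - j)%N f x) = 0}.
  elim: j => [_|j IH jk]; first by rewrite subn0.
  have lt_k : (k - j.+1 < k)%N by rewrite ltn_subrL; case: (k) jk.
  have [fE _] := ac_repr_prim x0ab (wderiv_next f lt_k).
  have E : (k - j.+1).+1 = (k - j)%N by rewrite -subSn// subSS.
  have IHj := IH (ltnW jk); rewrite -E in IHj.
  have Z x : prim (cut_reim false (wderiv (k - j.+1).+1 f)) x = 0.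
    rewrite /prim /Rintegral; rewrite (ae_eq_integral (cst 0%E)) ?integral0//.
    - by apply: measurable_funTS; have [] := integrableP _ _ _ (integrable_cut_reim false (wderiv (k - j.+1).+1 f)).
    - move/ae_leb_itv : IHj => IHj; apply: (ae_lebesgue_and IHj IHj) => y h _ _ /=.
      rewrite /cut_reim; have [yab|yab] := boolP (a < y < b); last by rewrite cut_out.
      by rewrite cut_in//= h.
  apply: filterS fE => x ->; rewrite -/(reim false _) !reimD.
  rewrite (_ : - cprim _ _ = (-1)%:C * cprim (wderiv (k - j.+1).+1 f) x0); last first.
    by rewrite rmorphN1 mulN1r.
  by rewrite reimM !reim_cprim !Z mulr0 !addr0; exact: aE lt_k.
by have := H k (leqnn k); rewrite subnn.
Qed.

(** The cone asks for a real-valued function, but a function with real jet is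
    automatically real, as are its derivatives of order k - 1, ..., 0 in turn. *)
Lemma sobolev_posE f : sobolev_pos x0 f <->
  cLp_pos (wderiv k f) /\ forall j, (j < k)%N -> 0 <= anchor x0 j f.
Proof.
split=> [[]//|[fk fa]]; split => //; apply: sobolev_real.
  by move=> j /fa; rewrite cge0P => /andP[/eqP].
by apply: filterS fk => x; rewrite cge0P => /andP[/eqP].
Qed.

End sobolev_coordinates.

Section finite_norms.
Context d (T : measurableType d) (R : realType).
Variable mu : {measure set T -> \bar R}.
Implicit Types (h : T -> R).

Lemma finite_norm_intP (r : R) h : 0 < r -> measurable_fun setT h ->
  finite_norm mu r%:E h <-> (\int[mu]_x (`|h x| `^ r)%:E < +oo)%E.
Proof.
move=> r0 mh; rewrite /finite_norm.
have E := @poweR_Lnorm _ _ _ mu (EFin \o h) r (lt0r_neq0 r0).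
have -> : (\int[mu]_x (`|h x| `^ r)%:E = 'N[mu]_(r%:E)[EFin \o h] `^ r)%E.
  by rewrite E; apply: eq_integral => x _; rewrite poweR_EFin.
split=> H; first exact: poweR_lty.
have /(poweR_lty r^-1) := H.
rewrite -poweRrM ?mulfV ?gt_eqF// ?poweRe1// ?Lnorm_ge0//.
Qed.

(** For the zero measure the norm is 0 by convention, whatever the function. *)
Lemma finite_norm_supP h : (0 < mu setT)%E ->
  finite_norm mu +oo%E h <-> exists C : R, {ae mu, forall x, `|h x| <= C}.
Proof.
move=> mu0; rewrite /finite_norm unlock mu0; split=> [H|[C HC]].
  exists (fine (ess_sup mu (fun x => `|h x|%:E))).
  have := @ess_sup_ge _ _ _ mu (fun x => `|h x|%:E).
  apply: filterS => x; move: H; rewrite /comp/=; case: (ess_sup _ _) => [r| |]//=.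
apply: (@le_lt_trans _ _ C%:E); last exact: ltry.
by apply/ess_supP; apply: filterS HC => x /=; rewrite lee_fin.
Qed.

End finite_norms.

(** * An interval with point masses *)

Section interval_with_atoms.
Context {R : realType} (k : nat) (a b : R) (ab : a < b).
Local Notation leb := (leb_itv a b).
Local Notation TR := (measurableTypeR R).
Local Notation I := (`]a, b[%classic : set R).

(** The point masses sit at b, b + 1, ..., outside the open interval, so that they
    do not interfere with Lebesgue measure on ]a, b[. *)
Definition atom (j : nat) : TR := b + j%:R.

(** Its L^p space is the l^p sum of L^p(]a, b[) and of k copies of the complex
    numbers, which is what the anchored norm describes. *)
Definition amu : {measure set TR -> \bar R} :=
  measure_add leb (msum (fun j => dirac (atom j)) k).

Lemma atom_out j : ~~ (a < atom j < b).
Proof. by rewrite /atom negb_and -!leNgt lerDl ler0n orbT. Qed.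

Lemma atom_inj i j : atom i = atom j -> i = j.
Proof. by move=> /addrI /eqP; rewrite eqr_nat => /eqP. Qed.

Lemma amuE (A : set TR) : amu A = (leb A + \sum_(j < k) \d_(atom j) A)%E.
Proof. exact: measure_addE. Qed.

Lemma amu_fin : amu setT \is a fin_num.
Proof.
rewrite amuE fin_numD leb_itv_fin /=; apply/sum_fin_numP => j _.
by rewrite diracT.
Qed.

Lemma leb_gt0 : (0 < leb setT)%E.
Proof.
rewrite /leb_itv /mrestr setTI lebesgue_measure_itv/= lte_fin ab.
by rewrite EFinN -EFinB lte_fin subr_gt0.
Qed.

Lemma amu_gt0 : (0 < amu setT)%E.
Proof.
rewrite amuE; apply: lt_le_trans leb_gt0 _.
by rewrite leeDl//; apply: sume_ge0 => j _.
Qed.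

(** Points of positive mass cannot be neglected: values at the atoms are well
    defined. *)
Lemma ae_amu (P : R -> Prop) : {ae amu, forall x, P x} <->
  {ae leb, forall x, P x} /\ forall j, (j < k)%N -> P (atom j).
Proof.
split=> [[N [mN N0 sN]]|[[N [mN N0 sN]] HP]].
  move: N0; rewrite amuE => /eqP; rewrite padde_eq0 ?measure_ge0 ?sume_ge0//.
  move=> /andP[/eqP l0 /eqP d0]; split; first by exists N.
  move=> j jk; apply: contrapT => nP.
  have : ((\d_(atom j) N : \bar R) <= \sum_(j < k) \d_(atom j) N)%E.
    by rewrite (bigD1 (Ordinal jk))//= leeDl// sume_ge0.
  rewrite d0 diracE mem_set; last exact: sN.
  by rewrite lee_fin ler10.
pose B : set TR := [set atom j | j in `I_k].
have mB : measurable B.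
  apply: countable_measurable; first by move=> t; exact: measurable_set1.
  exact: (@finite_set_countable TR _ (finite_image _ (finite_II k))).
exists (N `\` B); split; first exact: measurableD.
  rewrite amuE (_ : leb _ = 0%E) ?add0e; last first.
    by apply: (subset_measure0 _ _ _ N0) => //; exact: measurableD.
  apply: big1 => j _; rewrite diracE memNset// => -[_]; apply.
  by exists (nat_of_ord j) => /=.
move=> x /= nP; split; first exact: sN.
by move=> [j /= jk xE]; apply: nP; rewrite -xE; exact: HP.
Qed.

Lemma int_amu (f : TR -> \bar R) : measurable_fun setT f -> (forall x, (0 <= f x)%E) ->
  (\int[amu]_x f x = \int[leb]_x f x + \sum_(j < k) f (atom j))%E.
Proof.
move=> mf f0; rewrite ge0_integral_measure_add//; congr (_ + _)%E.
rewrite ge0_integral_measure_sum//; apply: eq_bigr => j _.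
by rewrite integral_dirac// diracT mul1e.
Qed.

Variables (p : \bar R) (p1 : (1 <= p)%E).
Local Notation L := (Lp p1 a b).
Local Notation A := (cLp amu p1).

(** Finitely many values do not affect integrability or boundedness. *)
Lemma inLp_amu (f : R -> R[i]) : inLp leb p f <-> inLp amu p f.
Proof.
suff H : cmeasurable f -> finite_norm leb p (normc \o f) <-> finite_norm amu p (normc \o f).
  by split=> -[mf /(H mf)].
move=> mf; have mn := measurable_normc mf.
have mr r : measurable_fun setT (fun x : TR => (`|(normc \o f) x| `^ r)%:E).
  apply/measurable_EFinP; apply: (@measurableT_comp _ _ _ _ _ _ (@powR R ^~ r)) => //.
  exact: measurableT_comp.
case: p p1 => [r| |]// r1.
  have r0 : 0 < r by move: r1; rewrite lee_fin; exact: lt_le_trans.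
  rewrite !finite_norm_intP//.
  rewrite int_amu//.
  rewrite -ge0_fin_numE ?integral_ge0// -ge0_fin_numE; last first.
    by rewrite adde_ge0 ?integral_ge0 ?sume_ge0.
  have sfin : (\sum_(j < k) (`|(normc \o f) (atom j)| `^ r)%:E)%E \is a fin_num by exact/sum_fin_numP.
  have K (x y : \bar R) : y \is a fin_num ->
      x \is a fin_num <-> (x + y)%E \is a fin_num.
    by move=> yf; rewrite fin_numD yf andbT.
  exact: K sfin.
rewrite (finite_norm_supP _ leb_gt0) (finite_norm_supP _ amu_gt0).
split=> -[C HC]; last by exists C; have /ae_amu[] := HC.
pose D := \big[Num.max/C]_(j < k) `|normc (f (atom j))|.
exists D; apply/ae_amu; split.
  apply: filterS HC => x /le_trans; apply.
  by rewrite /D; elim/big_rec: _ => // j y _ Cy; rewrite le_max Cy orbT.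
move=> j jk; rewrite /D.
exact: (@le_bigmax _ _ _ C (fun j : 'I_k => `|normc (f (atom j))|) (Ordinal jk)).
Qed.

(** The element with prescribed values at the atoms and prescribed restriction to
    the interval. *)
Definition pack (c : nat -> R[i]) (u : L) : A :=
  toLp amu p1 (fun x => (\1_I x)%:C * u x + \sum_(j < k) (\1_[set atom j] x)%:C * c j).

Lemma inLp_indicC (B : set TR) (z : R[i]) : measurable B -> inLp leb p (fun x => (\1_B x)%:C * z).
Proof.
move=> mB; apply: (inLp_bounded (leb_itv_fin a b) p1 (C := normc z)).
  have -> : (fun x => (\1_B x)%:C * z) = z *: (fun x => (\1_B x)%:C).
    by apply/funext => x /=; rewrite mulrC.
  by apply: cmeasurableZ; apply: cmeasurable_real; exact: measurable_indic.
by move=> x; exact: normc_indicM.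
Qed.

Lemma inLp_pack (c : nat -> R[i]) (u : L) :
  inLp amu p (fun x => (\1_I x)%:C * u x + \sum_(j < k) (\1_[set atom j] x)%:C * c j).
Proof.
apply/inLp_amu; apply: inLpD => //.
  apply: (inLp_le p1 _ (inLp_fun u)); last by move=> x; exact: normc_indicM.
  by apply: cmeasurableM; [exact: measurable_indic|exact: cLp_cmeasurable].
have -> : (fun x => \sum_(j < k) (\1_[set atom j] x)%:C * c j) =
    \sum_(j < k) (fun x => (\1_[set atom j] x)%:C * c j).
  by apply/funext => x; rewrite fct_sumE.
elim/big_ind: _ => [|f g|j _]; [exact: inLp0|exact: inLpD|exact: inLp_indicC].
Qed.

Lemma pack_leb c u : {ae leb, forall x, pack c u x = u x}.
Proof.
have /ae_amu[H _] := toLpE p1 (inLp_pack c u).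
have HI : {ae leb, forall x, a < x < b} by apply/ae_leb_itv; exact: aeW.
apply: filterS2 H HI => x -> xab; rewrite indicE mem_set ?in_itv//= mul1r.
rewrite big1 ?addr0// => j _; rewrite indicE memNset ?mul0r//= => xE.
by have := atom_out j; rewrite -xE xab.
Qed.

Lemma pack_atom c u j : (j < k)%N -> pack c u (atom j) = c j.
Proof.
move=> jk; have /ae_amu[_ ->//] := toLpE p1 (inLp_pack c u).
rewrite indicE memNset; last by rewrite /= in_itv/=; apply/negP; exact: atom_out.
rewrite mul0r add0r (bigD1 (Ordinal jk))//= indicE mem_set// mul1r big1 ?addr0//.
move=> i ij; rewrite indicE memNset ?mul0r//= => /atom_inj E.
by move/eqP: ij; apply; apply: val_inj.
Qed.

Lemma amu_eqP (y z : A) : y = z <-> {ae leb, forall x, y x = z x} /\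
  forall j, (j < k)%N -> y (atom j) = z (atom j).
Proof. by rewrite -ae_amu; exact: cLp_eqP. Qed.

Lemma amu_posP (y : A) : cLp_pos y <-> {ae leb, forall x, 0 <= y x} /\
  forall j, (j < k)%N -> 0 <= y (atom j).
Proof. by rewrite -ae_amu. Qed.

Definition res (y : A) : L := toLp leb p1 y.

Lemma resE y : {ae leb, forall x, res y x = y x}.
Proof. by apply: toLpE; apply/inLp_amu; exact: inLp_fun. Qed.

Lemma res_pack c u : res (pack c u) = u.
Proof. by apply/cLp_eqP; apply: filterS2 (resE (pack c u)) (pack_leb c u) => x -> ->. Qed.

Lemma pack_res (y : A) : pack (fun j => y (atom j)) (res y) = y.
Proof.
apply/amu_eqP; split; last by move=> j jk; rewrite pack_atom.
by apply: filterS2 (resE y) (pack_leb (fun j => y (atom j)) (res y)) => x E1 E2; rewrite E2.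
Qed.

End interval_with_atoms.

Section norm_with_atoms.
Context {R : realType} (k : nat) (a b : R) (ab : a < b).
Local Notation leb := (leb_itv a b).

Lemma norm_amu_pow (r : R) (p1 : (1 <= r%:E)%E) (y : cLp (amu k a b) p1) :
  cLp_norm y `^ r = \sum_(j < k) normc (y (atom b j)) `^ r + cLp_norm (res y) `^ r.
Proof.
have E : (\int[leb]_x (normc (res y x) `^ r)%:E = \int[leb]_x (normc (y x) `^ r)%:E)%E.
  apply: ae_eq_integral; [exact: measurableT|exact: measurable_npow|exact: (measurable_npow y)|].
  by apply: filterS (resE ab y) => x -> _.
apply: EFin_inj; rewrite EFinD -!int_npow E int_amu; last 2 first.
- exact: measurable_npow.
- by move=> x; rewrite lee_fin powR_ge0.
by rewrite addeC sumEFin.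
Qed.

(** Both sides have the same upper bounds. *)
Lemma norm_amu_sup (p1 : (1 <= +oo :> \bar R)%E) (y : cLp (amu k a b) p1) :
  cLp_norm y = Num.max (\big[Num.max/0]_(j < k) normc (y (atom b j))) (cLp_norm (res y)).
Proof.
set m := Num.max _ _.
have m0 : 0 <= m by rewrite le_max cLp_norm_ge0 orbT.
have n0 := cLp_norm_ge0 y.
have key (c : R) : 0 <= c -> cLp_norm y <= c <-> m <= c.
  move=> c0; rewrite sup_normP// ae_amu; split.
    move=> [H1 H2]; rewrite /m ge_max; apply/andP; split.
      by apply/bigmax_leP; split => // j _; exact: H2.
    by apply/sup_normP => //; apply: filterS2 H1 (resE ab y) => x h ->.
  rewrite /m ge_max => /andP[/bigmax_leP[_ H2] /sup_normP H1]; split.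
    by apply: filterS2 (H1 c0) (resE ab y) => x h <-.
  by move=> j jk; exact: (H2 (Ordinal jk)).
by apply/eqP; rewrite eq_le; apply/andP; split; [apply/key|apply/(key _ n0)].
Qed.

End norm_with_atoms.

Section packed_norms.
Context {R : realType} {p : \bar R} (p1 : (1 <= p)%E) (k : nat) (a b : R) (ab : a < b).
Implicit Types (c : nat -> R[i]) (u : Lp p1 a b).

(** The anchored norm as a function of the values at the base point and of the
    norm of the top derivative; jets have this norm by definition. *)
Definition mixed_norm (c : nat -> R[i]) (n : R) : R :=
  match p with
  | r%:E => (\sum_(j < k) normc (c j) `^ r + n `^ r) `^ r^-1
  | _ => Num.max (\big[Num.max/0]_(j < k) normc (c j)) n
  end.

Lemma norm_pack c u : cLp_norm (pack k c u) = mixed_norm c (cLp_norm u).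
Proof.
rewrite /mixed_norm; move: u; case: p p1 => [r| |]// p1' u.
  have r0 : 0 < r by apply: lt_le_trans (ltr01) _; rewrite -lee_fin.
  have E := norm_amu_pow ab (pack k c u).
  have -> : cLp_norm (pack k c u) = (cLp_norm (pack k c u) `^ r) `^ r^-1.
    by rewrite -powRrM mulfV ?gt_eqF// powRr1// cLp_norm_ge0.
  rewrite E (res_pack _ ab); congr ((_ + _) `^ _).
  by apply: eq_bigr => j _; rewrite (pack_atom ab).
rewrite (norm_amu_sup ab) (res_pack _ ab); congr (Num.max _ _).
by apply: eq_bigr => j _; rewrite (pack_atom ab).
Qed.

Lemma mixed_norm0 (n : R) : 0 <= n -> mixed_norm (fun=> 0) n = n.
Proof.
rewrite /mixed_norm; case: p p1 => [r| |]// p1' n0.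
  have r0 : 0 < r by apply: lt_le_trans (ltr01) _; rewrite -lee_fin.
  rewrite big1 ?add0r; last by move=> j _; rewrite normc0 powR0 ?gt_eqF.
  by rewrite -powRrM mulfV ?gt_eqF// powRr1.
rewrite (_ : \big[_/_]_(_ < _) _ = 0); first exact/max_idPr.
elim/big_ind: _ => //.
  by move=> x y -> ->; rewrite maxxx.
by move=> i _; rewrite normc0.
Qed.

Lemma mixed_norm_delta (i : 'I_k) : mixed_norm (fun j => (j == i)%:R) 0 = 1.
Proof.
rewrite /mixed_norm; case: p p1 => [r| |]// p1'.
  have r0 : 0 < r by apply: lt_le_trans (ltr01) _; rewrite -lee_fin.
  rewrite powR0 ?gt_eqF// addr0 (bigD1 i)//= eqxx normc1 powR1 big1 ?addr0 ?powR1//.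
  by move=> j ji; rewrite (negbTE (ji : nat_of_ord j != i)) normc0 powR0 ?gt_eqF.
apply/eqP; rewrite eq_le; apply/andP; split.
  rewrite ge_max ler01 andbT; apply/bigmax_leP; split=> // j _.
  by case: eqP => _; rewrite ?normc1// normc0.
rewrite le_max; apply/orP; left.
have := @le_bigmax _ _ _ 0 (fun j : 'I_k => normc ((j == i :> nat)%:R : R[i])) i.
by rewrite eqxx normc1.
Qed.

Lemma pack_lin (z : R[i]) c c' u u' :
  pack k (fun j => z * c j + c' j) (z *: u + u') = z *: pack k c u + pack k c' u'.
Proof.
have H := cLp_fun_lin z (pack k c u) (pack k c' u').
move: H => /ae_amu[Hl Ha]; apply/amu_eqP; split; last first.
  by move=> j jk; rewrite Ha// !(pack_atom ab).
have G := cLp_fun_lin z u u'.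
have P0 := pack_leb k ab (fun j => z * c j + c' j) (z *: u + u').
have P1 := pack_leb k ab c u; have P2 := pack_leb k ab c' u'.
have Q : {ae leb_itv a b, forall x, pack k (fun j => z * c j + c' j) (z *: u + u') x =
    z * u x + u' x}.
  by apply: filterS2 P0 G => x E1 E2; exact: etrans E1 E2.
apply: filterS2 Q (filterI Hl (filterI P1 P2)) => x E0 [E1 [E2 E3]].
apply: etrans E0 (esym (etrans E1 _)).
exact: (congr2 (fun y y' : R[i] => z * y + y') E2 E3).
Qed.

Lemma pack_inj c c' u u' : pack k c u = pack k c' u' ->
  u = u' /\ forall j, (j < k)%N -> c j = c' j.
Proof.
move=> E; split; first by rewrite -(res_pack k ab c u) E (res_pack _ ab).
by move=> j jk; rewrite -(pack_atom ab c u jk) E (pack_atom ab).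
Qed.

Lemma pack_pos c u : cLp_pos (pack k c u) <->
  cLp_pos u /\ forall j, (j < k)%N -> 0 <= c j.
Proof.
rewrite amu_posP; split=> -[H1 H2]; split.
- by apply: filterS2 (pack_leb k ab c u) H1 => x ->.
- by move=> j jk; rewrite -(pack_atom ab c u jk); exact: H2.
- by apply: filterS2 (pack_leb k ab c u) H1 => x ->.
- by move=> j jk; rewrite (pack_atom ab)//; exact: H2.
Qed.

Lemma pack_surj (y : cLp (amu k a b) p1) : exists c u, y = pack k c u.
Proof. by exists (fun j => y (atom b j)), (res y); rewrite (pack_res ab). Qed.

Lemma eq_pack c c' u : (forall j, (j < k)%N -> c j = c' j) -> pack k c u = pack k c' u.
Proof.
move=> cc'; apply/amu_eqP; split.
  by apply: filterS2 (pack_leb k ab c u) (pack_leb k ab c' u) => x -> ->.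
by move=> j jk; rewrite !(pack_atom ab)//; exact: cc'.
Qed.

End packed_norms.

(** * Sobolev spaces as L^p spaces *)

Section sobolev_as_Lp.
Context {R : realType} {p : \bar R} (p1 : (1 <= p)%E) (k : nat) (a b x0 : R).
Hypothesis x0ab : a < x0 < b.
Local Notation W := (sobolev p1 k a b).
Local Notation A := (cLp (amu k a b) p1).
Implicit Types (f g : W).

Let ab : a < b. Proof. by move: x0ab => /andP[]; exact: lt_trans. Qed.

(** The identification of the Sobolev space with an L^p space. *)
Definition jet f : A := pack k (fun j => anchor x0 j f) (wderiv k f).

Lemma jet_linear : linear jet.
Proof.
move=> z f g; rewrite /jet -(pack_lin _ ab) wderiv_lin//; apply: (eq_pack ab) => j jk.
exact: anchor_lin.
Qed.

Lemma jet_norm f : cLp_norm (jet f) = anchored_norm x0 f.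
Proof. exact: norm_pack. Qed.

Lemma jet_pos f : cLp_pos (jet f) <-> sobolev_pos x0 f.
Proof. by rewrite (sobolev_posE x0ab); exact: pack_pos. Qed.

Lemma jet_sphere f : pos_unit (jet f) <-> pos_sphere x0 f.
Proof. by rewrite /pos_unit jet_norm jet_pos. Qed.

Lemma jet_inj f g : jet f = jet g -> f = g.
Proof. by move=> /(pack_inj ab)[E1 E2]; exact: sobolev_inj E1 E2. Qed.

Lemma jet_surj (c : nat -> R[i]) (u : Lp p1 a b) : exists f, jet f = pack k c u.
Proof.
have [f [fk fc]] := sobolev_exists k x0ab c u.
by exists f; rewrite /jet fk; apply: (eq_pack ab).
Qed.

(** The inverse identification; the choice is unique since jets determine
    functions. *)
Definition unjet (y : A) : W := xget 0 [set f | jet f = y].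

Lemma unjetK : cancel unjet jet.
Proof.
move=> y; apply: (@xgetPex _ _ [set f | jet f = y]).
by have [c [u ->]] := pack_surj ab y; exact: jet_surj.
Qed.

Lemma jetK : cancel jet unjet.
Proof. by move=> f; apply: jet_inj; rewrite unjetK. Qed.

Lemma unjet_linear : linear unjet.
Proof. by move=> z x y; apply: jet_inj; rewrite jet_linear !unjetK. Qed.

End sobolev_as_Lp.

(** * Minimal elements of the cone *)

Section minimal_elements.
Context {R : realType} {p : \bar R} (p1 : (1 <= p)%E) (k : nat) (a b : R) (ab : a < b).
Local Notation L := (Lp p1 a b).
Local Notation leb := (leb_itv a b).
Local Notation A := (cLp (amu k a b) p1).
Implicit Types (c : nat -> R[i]) (u : L) (y z : A).

Definition delta (i : nat) : A := pack k (fun j => (j == i)%:R) 0.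

Lemma pack0 : pack k (fun=> 0) (0 : L) = 0.
Proof.
have := pack_lin k ab 1 (fun=> 0) (fun=> 0) (0 : L) 0.
have -> : (fun _ : nat => 1 * 0 + 0 : R[i]) = (fun=> 0) by apply/funext => j; rewrite mulr0 addr0.
rewrite scaler0 addr0 scale1r => E.
by apply: (addrI (pack k (fun=> 0) (0 : L))); rewrite addr0 -E.
Qed.

Lemma packZ (x : R[i]) c u : pack k (fun j => x * c j) (x *: u) = x *: pack k c u.
Proof.
rewrite -[RHS]addr0 -pack0 -pack_lin// addr0; congr pack.
by apply/funext => j; rewrite addr0.
Qed.

Lemma packB c c' u u' : pack k (fun j => c j - c' j) (u - u') = pack k c u - pack k c' u'.
Proof.
rewrite addrC -scaleN1r -[in RHS]scaleN1r [RHS]addrC -pack_lin//; congr pack.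
by apply/funext => j; rewrite mulN1r addrC.
Qed.

Lemma delta_pos i : cLp_pos (delta i).
Proof.
apply/pack_pos => //; split; first exact: cLp_pos0.
by move=> j _; case: eqP.
Qed.

Lemma norm_delta i : (i < k)%N -> cLp_norm (delta i) = 1.
Proof. by move=> ik; rewrite /delta norm_pack// cLp_norm0 (mixed_norm_delta p1 (Ordinal ik)). Qed.

Lemma delta_scale_inj (t : R[i]) i j : (j < k)%N -> delta j = t *: delta i -> j = i.
Proof.
move=> jk; rewrite /delta -packZ => /(pack_inj ab)[_ /(_ j jk)].
by rewrite eqxx; case: eqP => // _ /eqP; rewrite mulr0 oner_eq0.
Qed.

(** Atoms of the vector lattice: only multiples of y lie between 0 and y.  The
    property refers to the cone only, hence is preserved by order
    isomorphisms. *)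
Definition minimal y := [/\ cLp_pos y, y <> 0 &
  forall z, cLp_pos z -> cLp_pos (y - z) -> exists t : R[i], z = t *: y].

Lemma cge0_anti (z : R[i]) : 0 <= z -> 0 <= - z -> z = 0.
Proof. by move=> h; rewrite oppr_ge0 => h'; apply/eqP; rewrite eq_le h' h. Qed.

Lemma cLp_pos_anti u : cLp_pos u -> cLp_pos (- u) -> u = 0.
Proof.
move=> u0 nu0; apply/cLp_eqP; apply: filterS3 (filterI u0 nu0) (cLp_funN u) (cLp_fun0 leb p1).
by move=> x [h h'] E ->; apply: cge0_anti => //; rewrite -E.
Qed.

Lemma minimal_delta i : (i < k)%N -> minimal (delta i).
Proof.
move=> ik; split; first exact: delta_pos.
  by move=> E; have := norm_delta ik; rewrite E cLp_norm0 => /eqP; rewrite eq_sym oner_eq0.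
move=> z z0; have [c [u zE]] := pack_surj ab z.
move: z0; rewrite zE /delta -packB => /(pack_pos k ab)[u0 c0] /(pack_pos k ab)[nu0 nc0].
exists (c i); rewrite -packZ; rewrite sub0r in nu0; rewrite (cLp_pos_anti u0 nu0) scaler0.
apply: (eq_pack ab) => j jk; case: eqP => [->|/eqP ji]; first by rewrite mulr1.
rewrite mulr0; apply: cge0_anti; first exact: c0.
by have := nc0 j jk; rewrite (negbTE ji) sub0r.
Qed.

(** Lebesgue measure has no atom.  If x < y are two points outside the exceptional
    null sets, a rational cut between them forces u x = 0 or u y = 0; thus u
    vanishes almost everywhere except at one point at most. *)
Lemma rational_cuts_zero u : (forall q : rat,
    {ae leb, forall x, x <= ratr q -> u x = 0} \/
    {ae leb, forall x, ratr q < x -> u x = 0}) -> u = 0.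
Proof.
move=> H.
pose Z (q : rat) := {ae leb, forall x, x <= ratr q -> u x = 0}.
pose good (q : rat) x := (Z q -> x <= ratr q -> u x = 0) /\
  (~ Z q -> ratr q < x -> u x = 0).
have G1 q : {ae leb, forall x, good q x}.
  have [h|h] := pselect (Z q).
    by apply: negligibleS (h : Z q) => x /= ng hx; apply: ng; split.
  have [//|h'] := H q.
  by apply: negligibleS h' => x /= ng hx; apply: ng; split.
have G : {ae leb, forall x, forall q, good q x} by exact: ae_countable G1.
have one (x y : R) : x < y -> (forall q, good q x) -> (forall q, good q y) ->
    u x = 0 \/ u y = 0.
  move=> xy hx hy; have [q] := rat_in_itvoo xy; rewrite in_itv/= => /andP[xq qy].
  have [h|h] := pselect (Z q).
    by left; apply: (proj1 (hx q)) => //; exact: ltW.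
  by right; apply: (proj2 (hy q)).
have lebS (P Q S : R -> Prop) : {ae leb, forall x, P x} ->
    {ae leb, forall x, Q x} -> (forall x, P x -> Q x -> S x) -> {ae leb, forall x, S x}.
  move=> h1 h2 h; apply: negligibleS (negligibleU h1 h2) => x /= nS.
  by apply/not_andP => -[p' q']; exact/nS/h.
have pt (e : R) : {ae leb, forall x, x <> e}.
  apply/ae_leb_itv; exists [set e]; split; first exact: measurable_set1.
    exact: lebesgue_measure_set1.
  by move=> x /= nx; apply: contrapT => xe; apply: nx => _.
apply/cLp_eqP.
have [[e [Ge ue]]|nex] := pselect (exists x, (forall q, good q x) /\ u x <> 0).
  apply: lebS (cLp_fun0 leb p1) (lebS _ _ _ G (pt e) (fun x h h' => conj h h')) _.
  move=> x -> [Gx /eqP xe].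
  by case: (ltgtP x e) xe => // h _; have [] := one _ _ h _ _.
apply: lebS G (cLp_fun0 leb p1) _ => x Gx ->.
by apply: contrapT => ux; apply: nex; exists x.
Qed.

(** If y has a nonzero value at some point mass, the corresponding multiple of the
    indicator of that point is below y, so y is a multiple of it.  Otherwise y
    lives on the interval, and minimality applied to its restrictions to
    half-lines makes y vanish on one side of every cut. *)
Lemma minimal_is_delta y : minimal y -> exists2 i, (i < k)%N &
  exists2 t : R, 0 < t & y = t%:C *: delta i.
Proof.
move=> [y0 yn0 ymin]; have [c [u yE]] := pack_surj ab y.
have /(pack_pos k ab)[u0 c0] : cLp_pos (pack k c u) by rewrite -yE.
have [[i [ik ci]]|nc] := pselect (exists i, (i < k)%N /\ c i <> 0).
  have zE : c i *: delta i = pack k (fun j => c i * (j == i)%:R) (c i *: 0) by rewrite packZ.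
  have z0 : cLp_pos (c i *: delta i).
    rewrite zE; apply/pack_pos => //; split; first by rewrite scaler0; exact: cLp_pos0.
    by move=> j jk; rewrite mulr_ge0 ?c0//; case: eqP.
  have [|t tE] := ymin _ z0.
    rewrite zE yE -packB; apply/pack_pos => //; split; first by rewrite scaler0 subr0.
    move=> j jk; case: eqP => [->|_]; first by rewrite mulr1 subrr.
    by rewrite mulr0 subr0 c0.
  have tn0 : t <> 0.
    move=> t0; move: tE; rewrite t0 scale0r zE -pack0 => /(pack_inj ab)[_ /(_ i ik)].
    by rewrite eqxx mulr1.
  have yD : y = (t^-1 * c i) *: delta i.
    by rewrite -scalerA tE scalerA mulVf ?scale1r//; exact/eqP.
  have ciE : c i = t^-1 * c i.
    move: yD; rewrite yE /delta -packZ => /(pack_inj ab)[_ /(_ i ik)].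
    by rewrite eqxx mulr1.
  exists i => //; exists (complex.Re (c i)); last by rewrite -cge0E ?c0// ciE.
  rewrite lt_neqAle; have := c0 i ik; rewrite cge0P => /andP[/eqP im ->]; rewrite andbT eq_sym.
  by apply/eqP => re; apply: ci; rewrite [c i]cge0E ?c0// re.
have {c0}cE : pack k c u = pack k (fun=> 0) u.
  by apply: (eq_pack ab) => j jk; apply: contrapT => cj; apply: nc; exists j.
exfalso; apply: yn0; rewrite yE cE -pack0; congr (pack k (fun=> 0) _).
apply: rational_cuts_zero => q.
pose B : set (measurableTypeR R) := `]-oo, ratr q]%classic.
have mB : measurable B by exact: measurable_itv.
have [||t tE] := ymin (pack k (fun=> 0) (restr B u)).
- by apply/pack_pos => //; split=> //; exact: restr_ge0.
- rewrite yE cE -packB; apply/pack_pos => //; split; last by move=> j _; rewrite subrr.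
  rewrite [X in X - _](restrD u mB) addrAC subrr add0r; apply: restr_ge0 => //.
  exact: measurableC.
move: tE; rewrite yE cE -packZ => /(pack_inj ab)[tE _].
have [t0|tn0] := pselect (t = 0).
  left; rewrite t0 scale0r in tE; apply: filterS2 (restr_in u mB) (cLp_fun0 leb p1).
  by move=> x h h0 xq; rewrite -h ?tE//= /B/= in_itv.
right.
have := restr_out u mB; rewrite tE => H.
apply: filterS2 H (cLp_funZ t u) => x h E qx.
have /eqP : t * u x = 0 by rewrite -E h// /B/= in_itv/=; apply/negP; rewrite -ltNge.
by rewrite mulf_eq0 => /orP[/eqP//|/eqP].
Qed.

Lemma atom_linear j : (j < k)%N -> linear (fun y : A => y (atom b j) : R[i]^o).
Proof.
move=> jk z x y; have /ae_amu[_ /(_ j jk) E1] := cLp_funD (z *: x) y.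
by have /ae_amu[_ /(_ j jk) E2] := cLp_funZ z x; rewrite E1 E2.
Qed.

Lemma res_linear : linear (@res R k a b p p1).
Proof.
move=> z x y; have [c [u ->]] := pack_surj ab x; have [c' [u' ->]] := pack_surj ab y.
by rewrite -(pack_lin k ab) !(res_pack k ab).
Qed.

End minimal_elements.

(** * Isometric order isomorphisms *)

Section order_isomorphism_facts.
Context {R : realType} {V W : lmodType R[i]}.
Variables (nV : V -> R) (nW : W -> R) (pV : set V) (pW : set W) (Phi : V -> W).

Hypothesis iso : isometric_order_iso nV nW pV pW Phi.

Lemma iso_linear : linear Phi. Proof. by case: iso. Qed.

Lemma iso_surj y : exists x, Phi x = y.
Proof. by case: iso => _ /(_ y I)[x _ <-] _ _ _; exists x. Qed.

Lemma iso_norm x : nW (Phi x) = nV x.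
Proof.
case: iso => l _ /(_ x 0 I I) E _ _; move: E.
by rewrite lin0// !subr0.
Qed.

Lemma iso_pos x : pW (Phi x) <-> pV x.
Proof. by case: iso => _ _ _ _ E; rewrite -[in X in _ <-> X]E. Qed.

Lemma iso_inj : (forall v, nV v = 0 -> v = 0) -> nW 0 = 0 -> injective Phi.
Proof.
move=> nV0 nW0 x y xy; apply/eqP; rewrite -subr_eq0; apply/eqP/nV0.
by rewrite -iso_norm (linB iso_linear) xy subrr.
Qed.

End order_isomorphism_facts.

(** The defining properties in the form in which they are checked. *)
Lemma make_iso (R : realType) (V W : lmodType R[i]) (nV : V -> R) (nW : W -> R)
  (pV : set V) (pW : set W) (Phi : V -> W) : linear Phi ->
  (forall y, exists x, Phi x = y) -> (forall x, nW (Phi x) = nV x) ->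
  (forall x, pW (Phi x) <-> pV x) -> isometric_order_iso nV nW pV pW Phi.
Proof.
move=> l s n o; split => //.
- by move=> y _; have [x <-] := s y; exists x.
- by move=> x y _ _; rewrite -(linB l) n.
- apply/seteqP; split=> [_ [x px <-]|y py]; first exact/o.
  by have [x xy] := s y; exists x => //; apply/o; rewrite xy.
- by apply/seteqP; split=> x /(o x).
Qed.

(** * Isomorphisms of intervals with point masses *)

Section isomorphisms_respect_atoms.
Context {R : realType} {p : \bar R} (p1 : (1 <= p)%E) (k1 k2 : nat) (a1 b1 a2 b2 : R).
Hypotheses (ab1 : a1 < b1) (ab2 : a2 < b2).
Local Notation L1 := (Lp p1 a1 b1).
Local Notation L2 := (Lp p1 a2 b2).
Local Notation A1 := (cLp (amu k1 a1 b1) p1).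
Local Notation A2 := (cLp (amu k2 a2 b2) p1).
Local Notation delta1 := (@delta R p p1 k1 a1 b1).
Local Notation delta2 := (@delta R p p1 k2 a2 b2).
Variable Phi : A1 -> A2.
Hypothesis iso : isometric_order_iso (@cLp_norm _ _ _ _ _ p1) (@cLp_norm _ _ _ _ _ p1)
  (@cLp_pos _ _ _ _ _ p1) (@cLp_pos _ _ _ _ _ p1) Phi.

Let Phil := iso_linear iso.
Let PhiI : injective Phi.
Proof. by apply: (iso_inj iso); [exact: cLp_norm_eq0|exact: cLp_norm0]. Qed.

Lemma iso_minimal x : minimal (Phi x) <-> minimal x.
Proof.
split=> -[x0 xn0 xm]; split.
- exact/(iso_pos iso).
- by move=> E; apply: xn0; rewrite E (lin0 Phil).
- move=> z z0 xz; have [||t tE] := xm (Phi z).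
  + exact/(iso_pos iso).
  + by rewrite -(linB Phil); apply/(iso_pos iso).
  by exists t; apply: PhiI; rewrite tE (linZ Phil).
- exact/(iso_pos iso).
- by move=> E; apply: xn0; apply: PhiI; rewrite E (lin0 Phil).
move=> z; have [w <-] := iso_surj iso z => /(iso_pos iso) w0.
rewrite -(linB Phil) => /(iso_pos iso) xw; have [t ->] := xm w w0 xw.
by exists t; rewrite (linZ Phil).
Qed.

Lemma delta_preimage (i : 'I_k2) : exists j : 'I_k1, Phi (delta1 j) = delta2 i.
Proof.
have [w wE] := iso_surj iso (delta2 i).
have /iso_minimal/(minimal_is_delta ab1)[j jk [t t0 wt]] : minimal (Phi w).
  by rewrite wE; exact: minimal_delta.
have : cLp_norm w = 1 by rewrite -(iso_norm iso) wE norm_delta.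
rewrite wt cLp_normZ normc_real (norm_delta p1 ab1 jk) mulr1 gtr0_norm// => t1.
exists (Ordinal jk) => /=; rewrite -wE wt t1.
by rewrite (_ : 1%:C = 1)// scale1r.
Qed.

(** Minimal elements of norm 1 are the indicators of the point masses, and they
    are mapped to each other bijectively. *)
Lemma atom_matching : exists s : 'I_k2 -> 'I_k1,
  bijective s /\ forall i, Phi (delta1 (s i)) = delta2 i.
Proof.
have [s sE] := choice delta_preimage; exists s; split => //.
have sI : injective s.
  move=> i i' E; have := sE i; rewrite E sE => E2; apply: val_inj.
  have F : delta2 i' = 1 *: delta2 i by rewrite scale1r E2.
  exact: esym (delta_scale_inj ab2 (ltn_ord i') F).
have sS (j : 'I_k1) : exists i, s i = j.
  have /(minimal_is_delta ab2)[i ik [t t0 tE]] : minimal (Phi (delta1 j)).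
    by apply/iso_minimal; exact: minimal_delta.
  exists (Ordinal ik); apply: val_inj; apply/esym.
  have F : delta1 j = t%:C *: delta1 (s (Ordinal ik)).
    by apply: PhiI; rewrite (linZ Phil) sE tE.
  exact: (delta_scale_inj ab1 (ltn_ord j) F).
have [g gE] := choice sS.
by exists g => [i|j]; [apply: sI; rewrite gE|exact: gE].
Qed.

Variable s : 'I_k2 -> 'I_k1.
Hypotheses (sB : bijective s) (sE : forall i, Phi (delta1 (s i)) = delta2 i).

(** The value of y at a point mass is the largest multiple of its indicator below
    y. *)
Lemma above_delta k a b (ab : a < b) (y : cLp (amu k a b) p1) (t : R) i : (i < k)%N ->
  cLp_pos y -> cLp_pos (y - t%:C *: delta p1 k a b i) <-> t%:C <= y (atom b i).
Proof.
move=> ik y0; have [c [u yE]] := pack_surj ab y; move: y0; rewrite yE.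
move=> /(pack_pos k ab)[u0 c0]; rewrite (pack_atom ab)// /delta -packZ// -packB//.
rewrite (pack_pos k ab) scaler0 subr0; split=> [[_ /(_ i ik)]|h].
  by rewrite eqxx mulr1 subr_ge0.
split=> // j jk; case: eqP => [->|_]; first by rewrite mulr1 subr_ge0.
by rewrite mulr0 subr0 c0.
Qed.

(** By the order characterization of values at point masses, the two sides agree on
    the cone; both are linear. *)
Lemma iso_atom (y : A1) (i : 'I_k2) : Phi y (atom b2 i) = y (atom b1 (s i)).
Proof.
have l1 : linear (fun y : A1 => Phi y (atom b2 i) : R[i]^o).
  by move=> c x x'; rewrite Phil; exact: (@atom_linear _ _ p1 k2 a2 b2 i (ltn_ord i)).
have l2 : linear (fun y : A1 => y (atom b1 (s i)) : R[i]^o).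
  exact: (@atom_linear _ _ p1 k1 a1 b1 (s i) (ltn_ord (s i))).
apply: (linear_ext_sphere l1 l2) => {}y [y0 _].
have Py0 : cLp_pos (Phi y) by exact/(iso_pos iso).
have key (t : R) : t%:C <= Phi y (atom b2 i) <-> t%:C <= y (atom b1 (s i)).
  rewrite -(above_delta ab2 t (ltn_ord i) Py0) -(above_delta ab1 t (ltn_ord (s i)) y0).
  by rewrite -sE -(linZ Phil) -(linB Phil) (iso_pos iso).
have /amu_posP[_ /(_ _ (ltn_ord (s i))) yr] := y0.
have /amu_posP[_ /(_ _ (ltn_ord i)) Pr] := Py0.
apply/eqP; rewrite eq_le; apply/andP; split.
  by rewrite (cge0E Pr); apply/key; rewrite -(cge0E Pr).
by rewrite (cge0E yr); apply/key; rewrite -(cge0E yr).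
Qed.

(** What the isomorphism does on functions living on the interval. *)
Definition diffuse_part (u : L1) : L2 := res (Phi (pack k1 (fun=> 0) u)).

(** Functions living on the point masses are finite combinations of indicators,
    whose images are indicators. *)
Lemma res_iso_atoms (c : nat -> R[i]) : res (Phi (pack k1 c 0)) = 0.
Proof.
have H n : (n <= k1)%N -> res (Phi (pack k1 (fun j => if (j < n)%N then c j else 0) 0)) = 0.
  elim: n => [_|n IH nk]; first by rewrite pack0// (lin0 Phil) -pack0// res_pack.
  have -> : pack k1 (fun j => if (j < n.+1)%N then c j else 0) 0 =
      c n *: delta1 n + pack k1 (fun j => if (j < n)%N then c j else 0) 0.
    rewrite /delta -pack_lin// scaler0 addr0; apply: eq_pack => // j jk.
    rewrite ltnS leq_eqVlt; case: eqP => [->|_]; first by rewrite ltnn addr0 mulr1.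
    by rewrite mulr0 add0r.
  rewrite (linD Phil) (linZ Phil).
  have [g gK sK] := sB; have := sE (g (Ordinal nk)); rewrite sK /= => ->.
  have := @res_linear _ _ p1 k2 _ _ ab2 (c n) (delta2 (g (Ordinal nk)))
    (Phi (pack k1 (fun j => if (j < n)%N then c j else 0) 0)).
  by rewrite IH ?(ltnW nk)// addr0 /delta res_pack// scaler0.
have := H k1 (leqnn k1); congr (res (Phi _) = _).
by apply: eq_pack => // j ->.
Qed.

Lemma iso_pack (c : nat -> R[i]) u (c' : nat -> R[i]) : (forall i : 'I_k2, c' i = c (s i)) ->
  Phi (pack k1 c u) = pack k2 c' (diffuse_part u).
Proof.
move=> cc'.
have E : pack k1 c u = 1 *: pack k1 c 0 + pack k1 (fun=> 0) u.
  rewrite -pack_lin// scaler0 add0r; apply: eq_pack => // j _.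
  by rewrite mul1r addr0.
rewrite -[LHS](pack_res ab2).
have -> : res (Phi (pack k1 c u)) = diffuse_part u.
  rewrite E Phil; have := @res_linear _ _ p1 k2 _ _ ab2 1 (Phi (pack k1 c 0)) (Phi (pack k1 (fun=> 0) u)).
  by rewrite res_iso_atoms scaler0 add0r.
apply: eq_pack => // j jk.
by rewrite (iso_atom _ (Ordinal jk)) (pack_atom ab1)// -(cc' (Ordinal jk)).
Qed.

Lemma iso_diffuse : isometric_order_iso (@cLp_norm _ _ _ _ _ p1) (@cLp_norm _ _ _ _ _ p1)
  (@cLp_pos _ _ _ _ _ p1) (@cLp_pos _ _ _ _ _ p1) diffuse_part.
Proof.
have P0 u : Phi (pack k1 (fun=> 0) u) = pack k2 (fun=> 0) (diffuse_part u).
  exact: iso_pack.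
apply: make_iso.
- move=> z u v.
  have -> : diffuse_part (z *: u + v) = res (Phi (z *: pack k1 (fun=> 0) u + pack k1 (fun=> 0) v)).
    rewrite -pack_lin// /diffuse_part; congr (res (Phi _)); apply: eq_pack => // j _.
    by rewrite mulr0 addr0.
  by rewrite Phil; exact: res_linear.
- move=> v; have [y yE] := iso_surj iso (pack k2 (fun=> 0) v).
  have [c [u uE]] := pack_surj ab1 y; exists u.
  pose c' n := if insub n is Some i then c (s i) else 0.
  have := @iso_pack c u c'; rewrite -uE yE => E.
  have cc (i : 'I_k2) : c' i = c (s i) by rewrite /c' valK.
  by have [-> _] := pack_inj ab2 (E cc).
- move=> u; have := iso_norm iso (pack k1 (fun=> 0) u).
  by rewrite P0 !norm_pack// !mixed_norm0// ?cLp_norm_ge0.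
- move=> u; have := iso_pos iso (pack k1 (fun=> 0) u); rewrite P0 !pack_pos//.
  by move=> [h1 h2]; split=> h; [have [] := h1 (conj h (fun _ _ => lexx 0))|have [] := h2 (conj h (fun _ _ => lexx 0))].
Qed.

End isomorphisms_respect_atoms.

(** * Affine change of variables *)

Section affine_images_of_lebesgue_measure.
Context {R : realType}.
Notation mu := (@lebesgue_measure R).
Local Notation TR := (measurableTypeR R).
Variables (c d : R) (c0 : 0 < c).

Definition affine_fun (x : TR) : TR := c * x + d.

Lemma measurable_affine : measurable_fun setT affine_fun.
Proof. by apply: measurable_funD => //; apply: measurable_funM. Qed.

(** Uniqueness of Lebesgue measure: both sides agree on half-open intervals. *)
Lemma lebesgue_affine (A : set TR) : measurable A ->
  (mu A = c%:E * mu (affine_fun @^-1` A))%E.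
Proof.
move=> mA.
apply: (lebesgue_measure_unique (mu := mscale (NngNum (ltW c0)) (pushforward mu affine_fun)) _ mA).
  exact: measurable_affine.
move=> ? _ [[s t]] _ <-; change (mu `]s, t]%classic = c%:E * mu (affine_fun @^-1` `]s, t]))%E.
have -> : affine_fun @^-1` `]s, t]%classic = `](s - d) / c, (t - d) / c]%classic.
  apply/seteqP; split=> x /=; rewrite !in_itv/= /affine_fun ltr_pdivrMr// ler_pdivlMr//.
    by rewrite ltrBlDr lerBrDr mulrC.
  by rewrite ltrBlDr lerBrDr mulrC.
rewrite !lebesgue_measure_itv/= !lte_fin ltr_pM2r ?invr_gt0// ltrD2r.
case: ifPn => _; last by rewrite mule0.
rewrite -!EFinD -EFinM; congr (_%:E); field; exact: lt0r_neq0.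
Qed.

End affine_images_of_lebesgue_measure.

Section affine_map_between_intervals.
Context {R : realType}.
Notation mu := (@lebesgue_measure R).
Local Notation TR := (measurableTypeR R).

(** The increasing affine bijection of ]a', b'[ onto ]a, b[. *)
Definition affine (a b a' b' x : R) : R :=
  (b - a) / (b' - a') * x + (a - (b - a) / (b' - a') * a').

Lemma affineK a b a' b' : a < b -> a' < b' ->
  cancel (affine a b a' b') (affine a' b' a b).
Proof. by move=> ab ab' x; rewrite /affine; field; rewrite !subr_eq0 !gt_eqF. Qed.

Lemma affine_in a b a' b' x : a < b -> a' < b' ->
  (a < affine a b a' b' x < b) = (a' < x < b').
Proof.
move=> ab ab'; have r0 : 0 < (b - a) / (b' - a') by rewrite divr_gt0// subr_gt0.
have E1 : affine a b a' b' x - a = (b - a) / (b' - a') * (x - a').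
  by rewrite /affine; ring.
have E2 : b - affine a b a' b' x = (b - a) / (b' - a') * (b' - x).
  by rewrite /affine; field; rewrite subr_eq0 gt_eqF.
have -> : (a < affine a b a' b' x) = (a' < x).
  by rewrite -[LHS]subr_gt0 E1 (pmulr_rgt0 _ r0) subr_gt0.
by congr (_ && _); rewrite -[LHS]subr_gt0 E2 (pmulr_rgt0 _ r0) subr_gt0.
Qed.

Variables (a b a' b' : R) (ab : a < b) (ab' : a' < b').
Let rho := (b - a) / (b' - a').
Let phi : TR -> TR := affine a b a' b'.

Lemma scale_gt0 : 0 < rho. Proof. by rewrite divr_gt0// subr_gt0. Qed.

Lemma measurable_affine_map : measurable_fun setT (phi : TR -> TR).
Proof. exact: measurable_affine. Qed.

Lemma leb_affine (A : set TR) : measurable A ->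
  (leb_itv a b A = rho%:E * leb_itv a' b' (phi @^-1` A))%E.
Proof.
move=> mA; have mI : measurable (`]a, b[%classic : set TR) by exact: measurable_itv.
have := lebesgue_affine (a - rho * a') scale_gt0 (measurableI _ _ mA mI).
rewrite -[LHS]/(leb_itv a b A) => ->; congr (_ * _)%E.
change (mu (phi @^-1` (A `&` `]a, b[)) = mu (phi @^-1` A `&` `]a', b'[))%E.
congr (mu _); apply/seteqP; split=> x /=; rewrite !in_itv/=.
  by move=> [Ax]; rewrite affine_in.
by move=> [Ax xab]; split=> //; rewrite affine_in.
Qed.

Lemma ae_affine (P : R -> Prop) : {ae leb_itv a b, forall x, P x} ->
  {ae leb_itv a' b', forall x, P (phi x)}.
Proof.
move=> [N [mN N0 sN]]; exists (phi @^-1` N); split.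
- by rewrite -[X in measurable X]setTI; exact: measurable_affine_map.
- move: N0; rewrite leb_affine// => /eqP; rewrite mule_eq0 => /orP[|/eqP//].
  by rewrite eqe gt_eqF// scale_gt0.
- by move=> x nP; exact: sN.
Qed.

Lemma integral_affine (f : TR -> \bar R) : measurable_fun setT f ->
  (forall x, (0 <= f x)%E) ->
  (\int[leb_itv a b]_x f x = rho%:E * \int[leb_itv a' b']_x f (phi x))%E.
Proof.
move=> mf f0.
have f0' : {in setT, forall y, 0 <= f y}%E by move=> y _; exact: f0.
have E := ge0_integral_pushforward measurable_affine_map (leb_itv a' b') measurableT mf f0'.
apply: etrans _ (congr1 (fun z => rho%:E * z)%E E).
have E2 := ge0_integral_mscale _ measurableT (NngNum (ltW scale_gt0)) mf (fun x _ => f0 x).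
apply: etrans _ (E2 _); first exact: measurable_affine_map.
by move=> ?; apply: eq_measure_integral => A mA _; exact: leb_affine.
Qed.

Variables (p : \bar R) (p1 : (1 <= p)%E).

Lemma cmeasurable_affine (f : R -> R[i]) : cmeasurable (f : TR -> R[i]) ->
  cmeasurable ((f \o phi) : TR -> R[i]).
Proof.
by move=> [m1 m2]; split; [apply: (measurableT_comp m1)|apply: (measurableT_comp m2)];
  exact: measurable_affine_map.
Qed.

Lemma inLp_affine (f : R -> R[i]) : inLp (leb_itv a b) p f -> inLp (leb_itv a' b') p (f \o phi).
Proof.
move=> [mf nf]; have mf' := cmeasurable_affine mf; split=> //.
have mn := measurable_normc mf; have mn' := measurable_normc mf'.
move: nf; case: p p1 => [r| |]// r1.
  have r0 : 0 < r by apply: lt_le_trans (ltr01) _; rewrite -lee_fin.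
  move=> /(finite_norm_intP _ r0 mn); rewrite integral_affine; last 2 first.
  - apply/measurable_EFinP; apply: (@measurableT_comp _ _ _ _ _ _ (@powR R ^~ r)) => //.
    exact: measurableT_comp.
  - by move=> x; rewrite lee_fin powR_ge0.
  move=> H; apply/(finite_norm_intP _ r0 mn').
  move: H; set J := integral _ _ _; case: J => [x| |]//; rewrite ?ltry//.
  by rewrite gt0_muley ?lte_fin ?scale_gt0.
move=> /(finite_norm_supP _ (leb_gt0 ab))[C HC].
by apply/(finite_norm_supP _ (leb_gt0 ab')); exists C; exact: ae_affine HC.
Qed.

End affine_map_between_intervals.

Section affine_transfer.
Context {R : realType} {p : \bar R} (p1 : (1 <= p)%E) (a b a' b' : R).
Hypotheses (ab : a < b) (ab' : a' < b').
Local Notation leb := (leb_itv a b).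
Local Notation leb' := (leb_itv a' b').
Local Notation phi := (affine a b a' b').
Local Notation rho := ((b - a) / (b' - a')).

Lemma ae_affineP (P : R -> Prop) : {ae leb, forall x, P x} <->
  {ae leb', forall x, P (phi x)}.
Proof.
split=> [|/(ae_affine ab' ab)]; first exact: ae_affine.
by apply: negligibleS => x /= nP; rewrite affineK.
Qed.

(** Compensates the change of length of the interval in the p-th power norm; the
    sup norm needs no compensation. *)
Definition transfer_scale : R := if p is r%:E then rho `^ r^-1 else 1.

Lemma transfer_scale_gt0 : 0 < transfer_scale.
Proof.
by rewrite /transfer_scale; case: (p) => [r| |]//; rewrite powR_gt0 ?scale_gt0.
Qed.

Definition transfer (u : Lp p1 a b) : Lp p1 a' b' :=
  toLp leb' p1 (fun x => transfer_scale%:C * u (phi x)).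

Lemma transferE u : {ae leb', forall x, transfer u x = transfer_scale%:C * u (phi x)}.
Proof.
apply: toLpE; apply: inLpZ => //.
exact: inLp_affine (inLp_fun u).
Qed.

Lemma transfer_norm u : cLp_norm (transfer u) = cLp_norm u.
Proof.
have := transferE u; move: (transfer u); rewrite /transfer_scale.
move: u; case: p p1 => [r| |]// r1 u v vE.
  have r0 : 0 < r by apply: lt_le_trans (ltr01) _; rewrite -lee_fin.
  have powK (x : R) : 0 <= x -> x = (x `^ r) `^ r^-1.
    by move=> x0; rewrite -powRrM mulfV ?gt_eqF// powRr1.
  have CE : (rho `^ r^-1) `^ r = rho.
    by rewrite -powRrM mulVf ?gt_eqF// powRr1// ltW// scale_gt0.
  apply: etrans (powK _ (cLp_norm_ge0 v)) (etrans _ (esym (powK _ (cLp_norm_ge0 u)))).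
  congr (_ `^ _).
  apply: EFin_inj; rewrite -!int_npow (integral_affine ab ab'); last 2 first.
  - exact: measurable_npow.
  - by move=> x; rewrite lee_fin powR_ge0.
  have mu' : measurable_fun setT (fun x => (normc (u (phi x)) `^ r)%:E).
    apply: (@measurableT_comp _ _ _ _ _ _ (fun x => (normc (u x) `^ r)%:E) _ phi).
      exact: measurable_npow.
    exact: measurable_affine_map.
  rewrite -ge0_integralZl_EFin//; last 2 first.
  - by move=> x _; rewrite lee_fin powR_ge0.
  - by rewrite ltW// scale_gt0.
  apply: ae_eq_integral; [exact: measurableT|exact: measurable_npow| |].
    exact: measurable_funeM.
  apply: filterS vE => x -> _.
  rewrite normcM normc_real ger0_norm ?powR_ge0//.
  by rewrite (powRM _ (powR_ge0 _ _) (normc_ge0 _)) CE EFinM.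
(* for the sup norm, both norms have the same upper bounds *)
have key (c : R) : 0 <= c -> cLp_norm v <= c <-> cLp_norm u <= c.
  move=> c0; rewrite !sup_normP// [X in _ <-> X](ae_affineP (fun x => normc (u x) <= c)).
  split=> h.
    by apply: filterS2 h vE => x {}h E; move: h; rewrite E mul1r.
  by apply: filterS2 vE h => x ->; rewrite mul1r.
apply/eqP; rewrite eq_le; apply/andP.
by split; apply/key; rewrite ?cLp_norm_ge0.
Qed.

Lemma transfer_iso : isometric_order_iso (@cLp_norm _ _ _ _ _ p1) (@cLp_norm _ _ _ _ _ p1)
  (@cLp_pos _ _ _ _ _ p1) (@cLp_pos _ _ _ _ _ p1) transfer.
Proof.
have C0 := transfer_scale_gt0.
have Cn0 : transfer_scale%:C != 0 by rewrite realC_eq0 gt_eqF.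
apply: make_iso.
- move=> z u v; apply/cLp_eqP.
  have h := cLp_fun_lin z (transfer u) (transfer v).
  have /ae_affineP g := cLp_fun_lin z u v.
  apply: filterS3 (filterI (transferE (z *: u + v)) g) h
    (filterI (transferE u) (transferE v)) => x [E1 E2] E3 [E5 E6].
  rewrite E1 E2 E3 E5 E6 mulrDr; congr (_ + _).
  by rewrite mulrCA.
- move=> v; pose w y := transfer_scale^-1%:C * cLp_fun v (affine a' b' a b y).
  have Lw : inLp leb p w by apply: inLpZ => //; exact: inLp_affine (inLp_fun v).
  exists (toLp leb p1 w); apply/cLp_eqP.
  have /ae_affineP g := toLpE p1 Lw.
  apply: filterS2 (transferE (toLp leb p1 w)) g => x -> ->.
  by rewrite /w affineK// mulrA -rmorphM/= mulfV ?gt_eqF// mul1r.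
- exact: transfer_norm.
- move=> u; split=> [h|/ae_affineP h].
    apply/ae_affineP; apply: filterS2 h (transferE u) => x + E.
    rewrite E => h; rewrite -(mulKf Cn0 (cLp_fun u (phi x))) mulr_ge0//.
    by rewrite invr_ge0 lecR ltW.
  by apply: filterS2 (transferE u) h => x -> h'; rewrite mulr_ge0// lecR ltW.
Qed.

End affine_transfer.

(** * Phase-isometries *)

Section phases.
Context {R : realType}.

(** The distance to x is at least the difference of the moduli, which is attained
    without a phase. *)
Lemma normc_phase_le (x y al : R[i]) : 0 <= x -> 0 <= y -> normc al = 1 ->
  normc (x - y) <= normc (x - al * y).
Proof.
move=> x0 y0 al1.
have -> : normc (x - y) = `|normc x - normc y|.
  rewrite (normc_ge0E x0) (normc_ge0E y0) {1}(cge0E x0) {1}(cge0E y0).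
  have -> : (complex.Re x)%:C - (complex.Re y)%:C = (complex.Re x - complex.Re y)%:C.
    by rewrite rmorphB.
  exact: normc_real.
have -> : normc y = normc (al * y) by rewrite normcM al1 mul1r.
set z := al * y; rewrite ler_norml; apply/andP; split.
  rewrite lerNl opprB lerBlDr -(normcN (x - z)) opprB.
  by rewrite -{1}(subrK x z); exact: le_normcD.
by rewrite lerBlDr -{1}(subrK z x); exact: le_normcD.
Qed.

Lemma cLp_norm_phase_le d (T : measurableType d) (mu : {measure set T -> \bar R})
  (p : \bar R) (p1 : (1 <= p)%E) (x y : cLp mu p1) (al : R[i]) :
  cLp_pos x -> cLp_pos y -> normc al = 1 ->
  cLp_norm (x - y) <= cLp_norm (x - al *: y).
Proof.
move=> x0 y0 al1; apply: le_cLp_norm.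
apply: filterS3 (filterI x0 y0) (cLp_funB x y)
  (filterI (cLp_funB x (al *: y)) (cLp_funZ al y)) => t [xt yt] E1 [E2 E3].
by rewrite E1 E2 E3; exact: normc_phase_le.
Qed.

End phases.

(** * Maps between Sobolev spaces *)

Section sobolev_isomorphisms.
Context {R : realType} {p : \bar R} (p1 : (1 <= p)%E) (k1 k2 : nat).
Variables (a1 b1 x1 a2 b2 x2 : R).
Hypotheses (x1ab : a1 < x1 < b1) (x2ab : a2 < x2 < b2).
Local Notation W1 := (sobolev p1 k1 a1 b1).
Local Notation W2 := (sobolev p1 k2 a2 b2).
Local Notation A1 := (cLp (amu k1 a1 b1) p1).
Local Notation A2 := (cLp (amu k2 a2 b2) p1).
Local Notation N1 := (@anchored_norm R p p1 k1 a1 b1 x1).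
Local Notation N2 := (@anchored_norm R p p1 k2 a2 b2 x2).
Local Notation S1 := (@pos_sphere R p p1 k1 a1 b1 x1).
Local Notation S2 := (@pos_sphere R p p1 k2 a2 b2 x2).
Local Notation J1 := (@jet R p p1 k1 a1 b1 x1).
Local Notation J2 := (@jet R p p1 k2 a2 b2 x2).
Local Notation U1 := (@unjet R p p1 k1 a1 b1 x1).
Local Notation U2 := (@unjet R p p1 k2 a2 b2 x2).
Local Notation iso_W := (isometric_order_iso N1 N2 (@sobolev_pos R p p1 k1 a1 b1 x1)
  (@sobolev_pos R p p1 k2 a2 b2 x2)).
Local Notation iso_A := (isometric_order_iso (@cLp_norm _ _ _ (amu k1 a1 b1) _ p1)
  (@cLp_norm _ _ _ (amu k2 a2 b2) _ p1) (@cLp_pos _ _ _ (amu k1 a1 b1) _ p1)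
  (@cLp_pos _ _ _ (amu k2 a2 b2) _ p1)).

Let ab1 : a1 < b1. Proof. by move: x1ab => /andP[]; exact: lt_trans. Qed.
Let ab2 : a2 < b2. Proof. by move: x2ab => /andP[]; exact: lt_trans. Qed.

(** Isomorphisms of Sobolev spaces and of the associated L^p spaces are the same
    thing; this is one direction, the next lemma is the other. *)
Lemma jet_lower (Phi : W1 -> W2) : iso_W Phi -> iso_A (fun y => J2 (Phi (U1 y))).
Proof.
move=> iso; apply: make_iso.
- move=> z x y; rewrite (unjet_linear x1ab) (iso_linear iso).
  exact: (jet_linear x2ab).
- move=> y; have [f fE] := iso_surj iso (U2 y); exists (J1 f).
  by rewrite (jetK x1ab) fE (unjetK x2ab).
- by move=> y; rewrite (jet_norm x2ab) (iso_norm iso) -(jet_norm x1ab) (unjetK x1ab).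
- by move=> y; rewrite (jet_pos x2ab) (iso_pos iso) -(jet_pos x1ab) (unjetK x1ab).
Qed.

Lemma jet_lift (Psi : A1 -> A2) : iso_A Psi -> iso_W (fun f => U2 (Psi (J1 f))).
Proof.
move=> iso; apply: make_iso.
- move=> z x y; rewrite (jet_linear x1ab) (iso_linear iso).
  exact: (unjet_linear x2ab).
- move=> y; have [f fE] := iso_surj iso (J2 y); exists (U1 f).
  by rewrite (unjetK x1ab) fE (jetK x2ab).
- by move=> y; rewrite -(jet_norm x2ab) (unjetK x2ab) (iso_norm iso) (jet_norm x1ab).
- by move=> y; rewrite -(jet_pos x2ab) (unjetK x2ab) (iso_pos iso) (jet_pos x1ab).
Qed.

Lemma sobolev_sphere_extension (e : R) (D : W1 -> W2) :
  e = -1 \/ (e = 1 /\ (1 < p < +oo)%E) -> surjection_between S1 S2 D ->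
  (forall f g, S1 f -> S1 g -> N2 (D f + e%:C *: D g) = N1 (f + e%:C *: g)) ->
  exists2 Phi : W1 -> W2, iso_W Phi & forall f, S1 f -> Phi f = D f.
Proof.
move=> he [Dfun Dsurj] Dn.
have lc (k : nat) (a b x0 : R) (x0ab : a < x0 < b) (f g : sobolev p1 k a b) (c : R[i]) :
    jet x0 f + c *: jet x0 g = jet x0 (f + c *: g).
  by rewrite (linD (jet_linear x0ab)) (linZ (jet_linear x0ab)).
have [|| Phi iso PhiE] := sphere_map_extension (amu_fin k1 a1 b1) (amu_fin k2 a2 b2)
  (p1 := p1) (D := fun y => J2 (D (U1 y))) he.
- split=> [y py|z pz].
    apply/(jet_sphere x2ab); apply: Dfun; apply/(jet_sphere x1ab).
    by rewrite (unjetK x1ab).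
  have /Dsurj[f Sf fE] : S2 (U2 z) by apply/(jet_sphere x2ab); rewrite (unjetK x2ab).
  exists (J1 f); first exact/(jet_sphere x1ab).
  by rewrite (jetK x1ab) fE (unjetK x2ab).
- move=> x y px py; rewrite (lc _ _ _ _ x2ab) (jet_norm x2ab) Dn.
  + by rewrite -(jet_norm x1ab) -(lc _ _ _ _ x1ab) !(unjetK x1ab).
  + by apply/(jet_sphere x1ab); rewrite (unjetK x1ab).
  + by apply/(jet_sphere x1ab); rewrite (unjetK x1ab).
exists (fun f => U2 (Phi (J1 f))); first exact: jet_lift.
move=> f Sf; rewrite PhiE; last exact/(jet_sphere x1ab).
by rewrite (jetK x1ab) (jetK x2ab).
Qed.

Lemma isometry_extension (T : W1 -> W2) : surjection_between S1 S2 T ->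
  isometry_on N1 N2 S1 T ->
  exists2 Phi : W1 -> W2, iso_W Phi & forall f, S1 f -> Phi f = T f.
Proof.
move=> sT iT; apply: (sobolev_sphere_extension (or_introl (erefl (-1))) sT) => f g Sf Sg.
have E1 (v : W1) : (-1)%:C *: v = - v by rewrite rmorphN1 scaleN1r.
have E2 (v : W2) : (-1)%:C *: v = - v by rewrite rmorphN1 scaleN1r.
have H1 : N1 (f + (-1)%:C *: g) = N1 (f - g) by exact: (congr1 (fun v => N1 (f + v)) (E1 g)).
have H2 : N2 (T f + (-1)%:C *: T g) = N2 (T f - T g).
  exact: (congr1 (fun v => N2 (T f + v)) (E2 (T g))).
have H3 := iT f g Sf Sg.
exact: etrans H2 (etrans H3 (esym H1)).
Qed.

Lemma norm_additive_extension (T : W1 -> W2) : (1 < p < +oo)%E ->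
  surjection_between S1 S2 T -> norm_additive_on N1 N2 S1 T ->
  exists2 Phi : W1 -> W2, iso_W Phi & forall f, S1 f -> Phi f = T f.
Proof.
move=> pf sT aT.
apply: (sobolev_sphere_extension (or_intror (conj (erefl 1) pf)) sT) => f g Sf Sg.
have E1 (v : W1) : 1%:C *: v = v by rewrite scale1r.
have E2 (v : W2) : 1%:C *: v = v by rewrite scale1r.
have H1 : N1 (f + 1%:C *: g) = N1 (f + g) by exact: (congr1 (fun v => N1 (f + v)) (E1 g)).
have H2 : N2 (T f + 1%:C *: T g) = N2 (T f + T g).
  exact: (congr1 (fun v => N2 (T f + v)) (E2 (T g))).
have H3 := aT f g Sf Sg.
exact: etrans H2 (etrans (esym H3) (esym H1)).
Qed.

Lemma sobolev_extension_unique (Phi Phi' : W1 -> W2) : iso_W Phi -> iso_W Phi' ->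
  (forall f, S1 f -> Phi f = Phi' f) -> Phi = Phi'.
Proof.
move=> iso iso' E; apply/funext => f.
have lU (F : W1 -> W2) : linear F -> linear (fun y : A1 => F (U1 y)).
  by move=> l z x y; rewrite (unjet_linear x1ab) l.
have := linear_ext_sphere (lU _ (iso_linear iso)) (lU _ (iso_linear iso')).
move=> /(_ _ (J1 f)); rewrite (jetK x1ab); apply=> y py; apply: E.
by apply/(jet_sphere x1ab); rewrite (unjetK x1ab).
Qed.

Lemma iso_sphere (Phi : W1 -> W2) : iso_W Phi -> surjection_between S1 S2 Phi.
Proof.
move=> iso; split=> [f [f0 nf]|g [g0 ng]].
  by split; [exact/(iso_pos iso)|rewrite (iso_norm iso)].
have [f fE] := iso_surj iso g; exists f => //; split.
  by apply/(iso_pos iso); rewrite fE.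
by rewrite -(iso_norm iso) fE.
Qed.

(** On both sides the norm of the difference is the least element of the set
    occurring in the definition of a phase-isometry. *)
Lemma phase_isometry_sphere (T : W1 -> W2) : surjection_between S1 S2 T ->
  phase_isometry_on N1 N2 S1 T -> isometry_on N1 N2 S1 T.
Proof.
move=> [Tfun _] Tph f g Sf Sg.
have min (k : nat) (a b x0 : R) (x0ab : a < x0 < b) (u v : sobolev p1 k a b) (al : R[i]) :
    pos_sphere x0 u -> pos_sphere x0 v -> `|al| = 1 ->
    anchored_norm x0 (u - v) <= anchored_norm x0 (u - al *: v).
  move=> [u0 _] [v0 _] /normc_eq1 al1.
  have u0' : cLp_pos (jet x0 u) by exact/(jet_pos x0ab).
  have v0' : cLp_pos (jet x0 v) by exact/(jet_pos x0ab).
  rewrite -!(jet_norm x0ab) !(linB (jet_linear x0ab)) (linZ (jet_linear x0ab)).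
  exact: cLp_norm_phase_le.
have E := Tph f g Sf Sg.
have n1 : `|1 : R[i]| = 1 by exact: normr1.
apply/eqP; rewrite eq_le; apply/andP; split.
  have : [set N1 (f - al *: g) | al in [set z : R[i] | `|z| = 1]] (N1 (f - g)).
    by exists 1; [exact: n1|exact: (congr1 (fun v => N1 (f - v)) (scale1r g))].
  by rewrite E => -[be be1 <-]; apply: min => //; exact: Tfun.
have : [set N2 (T f - al *: T g) | al in [set z : R[i] | `|z| = 1]] (N2 (T f - T g)).
  by exists 1; [exact: n1|exact: (congr1 (fun v => N2 (T f - v)) (scale1r (T g)))].
by rewrite -E => -[be be1 <-]; exact: min.
Qed.

Lemma iso_phase_isometry (Phi : W1 -> W2) : iso_W Phi -> phase_isometry_on N1 N2 S1 Phi.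
Proof.
move=> iso f g _ _; apply: eq_imagel => al _.
by rewrite -(iso_norm iso) (linB (iso_linear iso)) (linZ (iso_linear iso)).
Qed.

(** In jet coordinates an isomorphism permutes the values at the base point and
    acts separately on the top derivative. *)
Lemma sobolev_iso_structure (Phi : W1 -> W2) : iso_W Phi ->
  exists (s : 'I_k2 -> 'I_k1) (Lam : Lp p1 a1 b1 -> Lp p1 a2 b2), [/\ bijective s,
    isometric_order_iso (@cLp_norm _ _ _ _ _ p1) (@cLp_norm _ _ _ _ _ p1)
      (@cLp_pos _ _ _ _ _ p1) (@cLp_pos _ _ _ _ _ p1) Lam &
    forall f, wderiv k2 (Phi f) = Lam (wderiv k1 f) /\
      forall i : 'I_k2, anchor x2 i (Phi f) = anchor x1 (s i) f].
Proof.
move=> /jet_lower iso; have [s [sB sE]] := atom_matching ab1 ab2 iso.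
exists s, (diffuse_part (fun y => J2 (Phi (U1 y)))); split=> //.
  exact: (iso_diffuse ab1 ab2 iso sB sE).
move=> f.
pose c' n := if insub n is Some i then anchor x1 (s i) f else 0.
have cc (i : 'I_k2) : c' i = anchor x1 (s i) f by rewrite /c' valK.
have := iso_pack ab1 ab2 iso sB sE (wderiv k1 f) (c := fun j => anchor x1 j f) cc.
rewrite -/(J1 f) (jetK x1ab) => /(pack_inj ab2)[-> H]; split=> // i.
by rewrite (H i (ltn_ord i)) cc.
Qed.

Lemma sobolev_iso_order (Phi : W1 -> W2) : iso_W Phi -> k1 = k2.
Proof.
move=> /sobolev_iso_structure[s [_ [sB _ _]]].
by have := bij_eq_card sB; rewrite !card_ord.
Qed.

End sobolev_isomorphisms.

Section same_order.
Context {R : realType} {p : \bar R} (p1 : (1 <= p)%E) (k : nat).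
Variables (a1 b1 x1 a2 b2 x2 : R).
Hypotheses (x1ab : a1 < x1 < b1) (x2ab : a2 < x2 < b2).
Local Notation W1 := (sobolev p1 k a1 b1).
Local Notation W2 := (sobolev p1 k a2 b2).
Local Notation N1 := (@anchored_norm R p p1 k a1 b1 x1).
Local Notation N2 := (@anchored_norm R p p1 k a2 b2 x2).
Local Notation iso_W := (isometric_order_iso N1 N2 (@sobolev_pos R p p1 k a1 b1 x1)
  (@sobolev_pos R p p1 k a2 b2 x2)).
Local Notation iso_L := (isometric_order_iso (@cLp_norm _ _ _ (leb_itv a1 b1) _ p1)
  (@cLp_norm _ _ _ (leb_itv a2 b2) _ p1) (@cLp_pos _ _ _ (leb_itv a1 b1) _ p1)
  (@cLp_pos _ _ _ (leb_itv a2 b2) _ p1)).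

Let ab1 : a1 < b1. Proof. by move: x1ab => /andP[]; exact: lt_trans. Qed.
Let ab2 : a2 < b2. Proof. by move: x2ab => /andP[]; exact: lt_trans. Qed.

(** The jet coordinates at the base points are kept and the top derivative is
    transferred by an affine change of variables. *)
Lemma sobolev_iso_exists : exists Phi : W1 -> W2, iso_W Phi.
Proof.
pose Psi (y : cLp (amu k a1 b1) p1) : cLp (amu k a2 b2) p1 :=
  pack k (fun j => y (atom b1 j)) (transfer a2 b2 (res y)).
have isoT := transfer_iso p1 ab1 ab2.
have PsiE c u : Psi (pack k c u) = pack k c (transfer a2 b2 u).
  rewrite /Psi (res_pack k ab1); apply: (eq_pack ab2) => j jk.
  by rewrite (pack_atom ab1).
exists (fun f => unjet x2 (Psi (jet x1 f))); apply: jet_lift => //.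
apply: make_iso.
- move=> z y y'; have [c [u ->]] := pack_surj ab1 y; have [c' [u' ->]] := pack_surj ab1 y'.
  by rewrite -(pack_lin k ab1) !PsiE (iso_linear isoT) (pack_lin k ab2).
- move=> y; have [c [u ->]] := pack_surj ab2 y; have [v vE] := iso_surj isoT u.
  by exists (pack k c v); rewrite PsiE vE.
- move=> y; have [c [u ->]] := pack_surj ab1 y.
  by rewrite PsiE !norm_pack// (iso_norm isoT).
- move=> y; have [c [u ->]] := pack_surj ab1 y.
  by rewrite PsiE !pack_pos// (iso_pos isoT).
Qed.

Lemma ac_repr_ae (a b x0 : R) (f : sobolev p1 k a b) : (0 < k)%N -> a < x0 < b ->
  {ae leb_itv a b, forall x, f x = ac_repr f x}.
Proof.
move=> k0 x0ab; have [fE aE] := ac_repr_prim x0ab (wderiv_next f k0).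
have HI : {ae leb_itv a b, forall x, a < x < b} by apply/ae_leb_itv; exact: aeW.
by apply: filterS2 fE HI => x -> xab; rewrite -aE.
Qed.

Lemma sobolev_eq (a b x0 : R) (f g : sobolev p1 k a b) : (0 < k)%N -> a < x0 < b ->
  (forall x, a < x < b -> ac_repr f x = ac_repr g x) -> f = g.
Proof.
move=> k0 x0ab fg; apply: val_inj; apply/cLp_eqP.
have HI : {ae leb_itv a b, forall x, a < x < b} by apply/ae_leb_itv; exact: aeW.
apply: filterS3 (ac_repr_ae f k0 x0ab) (ac_repr_ae g k0 x0ab) HI => x E1 E2 xab.
exact: etrans E1 (etrans (fg x xab) (esym E2)).
Qed.

(** The canonical form is Taylor's formula for a function with jet
    (f^(pi j)(x1), Lambda f^(k)); conversely, the function with this jet has the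
    same values as Phi f, so it is Phi f. *)
Lemma canonical_formP (pi : 'S_k) (Lam : Lp p1 a1 b1 -> Lp p1 a2 b2) (Phi : W1 -> W2) :
  (0 < k)%N -> has_canonical_form x1 x2 pi Lam Phi <->
  forall f, wderiv k (Phi f) = Lam (wderiv k f) /\
    forall i : 'I_k, anchor x2 i (Phi f) = anchor x1 (pi i) f.
Proof.
move=> k0; have kE : k.-1.+1 = k by rewrite prednK.
have k1k : (k.-1 < k)%N by rewrite kE.
have T (g : W2) x : a2 < x < b2 -> ac_repr g x =
    \sum_(j < k) anchor x2 j g * ((x - x2) ^+ j / j`!%:R)%:C +
    ((k.-1)`!%:R^-1)%:C *
      oriented_cintegral x2 x (fun t => ((x - t) ^+ k.-1)%:C * wderiv k g t).
  by move=> xab; have := taylor x2ab g k1k xab; rewrite kE.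
split=> [H f|H f x]; last first.
  rewrite in_itv/= => xab; have [fk fa] := H f; rewrite T// fk; congr (_ + _).
  by apply: eq_bigr => j _; rewrite fa.
pose c n := if insub n is Some i then anchor x1 (pi i) f else 0.
have [g [gk gc]] := sobolev_exists k x2ab c (Lam (wderiv k f)).
have gc' (i : 'I_k) : anchor x2 i g = anchor x1 (pi i) f.
  by rewrite gc// /c valK.
suff -> : Phi f = g by [].
apply: (sobolev_eq k0 x2ab) => x xab; rewrite H ?in_itv// (T g)// gk; congr (_ + _).
by apply: eq_bigr => j _; rewrite gc'.
Qed.

(** Uniqueness: the permutation is read off from a function whose derivatives at
    the base point are distinct numbers, and Lambda from the fact that every
    element of L^p is a top derivative. *)
Lemma sobolev_iso_canonical (Phi : W1 -> W2) : (0 < k)%N -> iso_W Phi ->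
  exists! piLam : 'S_k * (Lp p1 a1 b1 -> Lp p1 a2 b2),
    iso_L piLam.2 /\ has_canonical_form x1 x2 piLam.1 piLam.2 Phi.
Proof.
move=> k0 iso; have [s [Lam [sB isoL H]]] := sobolev_iso_structure x1ab x2ab iso.
exists (perm (bij_inj sB), Lam); split=> /=.
  split=> //; apply/(canonical_formP _ _ _ k0) => f; have [fk fa] := H f.
  by split=> // i; rewrite permE.
move=> [pi' Lam'] /= [_ /(canonical_formP _ _ _ k0) H']; congr pair.
  apply/permP => i; rewrite permE.
  have [f [_ fc]] := sobolev_exists k x1ab (fun j => j%:R) (0 : Lp p1 a1 b1).
  have [_ /(_ i) E] := H f; have [_ /(_ i) E'] := H' f.
  move: E; rewrite E' !fc// => /eqP; rewrite eqr_nat => /eqP E; exact: val_inj.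
apply/funext => u; have [f [<- _]] := sobolev_exists k x1ab (fun=> 0) u.
by have [<- _] := H f; have [<- _] := H' f.
Qed.

End same_order.

Theorem theorem3p1 (R : realType) (p : \bar R) (p_ge1 : (1 <= p)%E)
    (k1 k2 : nat) (k1_gt0 : (0 < k1)%N) (k2_gt0 : (0 < k2)%N)
    (a1 b1 x1 a2 b2 x2 : R)
    (x1_in : x1 \in `]a1, b1[) (x2_in : x2 \in `]a2, b2[) :
  let W1 := sobolev p_ge1 k1 a1 b1 in
  let W2 := sobolev p_ge1 k2 a2 b2 in
  let N1 : W1 -> R := anchored_norm x1 in
  let N2 : W2 -> R := anchored_norm x2 in
  let S1 : set W1 := pos_sphere x1 in
  let S2 : set W2 := pos_sphere x2 in
  let iso_W : (W1 -> W2) -> Prop :=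
    isometric_order_iso N1 N2 (sobolev_pos x1) (sobolev_pos x2) in
  let iso_L : (Lp p_ge1 a1 b1 -> Lp p_ge1 a2 b2) -> Prop :=
    isometric_order_iso (@cLp_norm _ _ _ _ _ _) (@cLp_norm _ _ _ _ _ _)
      (@cLp_pos _ _ _ _ _ _) (@cLp_pos _ _ _ _ _ _) in
  let as_in_3 : (W1 -> W2) -> Prop := fun Delta =>
    surjection_between S1 S2 Delta /\ isometry_on N1 N2 S1 Delta in
  let as_in_4 : (W1 -> W2) -> Prop := fun T =>
    surjection_between S1 S2 T /\ phase_isometry_on N1 N2 S1 T in
  let as_in_5 : (W1 -> W2) -> Prop := fun phi =>
    surjection_between S1 S2 phi /\ norm_additive_on N1 N2 S1 phi in
  [/\ [<-> k1 = k2;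
           exists Phi, iso_W Phi;
           exists Delta, as_in_3 Delta;
           exists T, as_in_4 T],
      (1 < p < +oo)%E -> (k1 = k2 <-> exists phi, as_in_5 phi) &
      forall T0 : W1 -> W2,
        [\/ as_in_3 T0, as_in_4 T0 | (1 < p < +oo)%E /\ as_in_5 T0] ->
        k1 = k2 /\
        exists Phi : W1 -> W2,
          [/\ iso_W Phi,
              forall f, S1 f -> Phi f = T0 f,
              forall Phi', iso_W Phi' -> (forall f, S1 f -> Phi' f = T0 f) ->
                Phi' = Phi &
              exists! piLam : 'S_k1 * (Lp p_ge1 a1 b1 -> Lp p_ge1 a2 b2),
                iso_L piLam.2 /\
                has_canonical_form x1 x2 piLam.1 piLam.2 Phi]].
Proof.
move=> W1 W2 N1 N2 S1 S2 iso_W iso_L as_in_3 as_in_4 as_in_5.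
have x1ab : a1 < x1 < b1 by move: x1_in; rewrite in_itv.
have x2ab : a2 < x2 < b2 by move: x2_in; rewrite in_itv.
have ext3 T : as_in_3 T -> exists2 Phi, iso_W Phi & forall f, S1 f -> Phi f = T f.
  by move=> [sT iT]; exact: isometry_extension.
have ext4 T : as_in_4 T -> exists2 Phi, iso_W Phi & forall f, S1 f -> Phi f = T f.
  move=> [sT pT]; apply: ext3; split=> //.
  exact: (phase_isometry_sphere x1ab x2ab sT pT).
have ext5 T : (1 < p < +oo)%E -> as_in_5 T ->
    exists2 Phi, iso_W Phi & forall f, S1 f -> Phi f = T f.
  by move=> p1 [sT aT]; exact: norm_additive_extension.
have order Phi : iso_W Phi -> k1 = k2 := sobolev_iso_order x1ab x2ab (Phi := Phi).
have exists_iso : k1 = k2 -> exists Phi, iso_W Phi.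
  by move=> k12; subst k2; exact: sobolev_iso_exists.
split.
- tfae.
  + exact: exists_iso.
  + move=> [Phi iso]; exists Phi; split; first exact: (iso_sphere iso).
    by case: iso => _ _ isom _ _ f g _ _; exact: isom.
  + move=> [Delta /ext3[Phi iso _]]; exists Phi; split; first exact: (iso_sphere iso).
    exact: (iso_phase_isometry iso).
  + by move=> [T /ext4[Phi /order]].
- move=> p1; split=> [/exists_iso[Phi iso]|[phi /(ext5 _ p1)[Phi /order]]//].
  exists Phi; split; first exact: (iso_sphere iso).
  by move=> f g _ _; rewrite -(linD (iso_linear iso)) (iso_norm iso).
move=> T0 hT0.
have [Phi iso PhiE] : exists2 Phi, iso_W Phi & forall f, S1 f -> Phi f = T0 f.
  by case: hT0 => [/ext3|/ext4|[p1 /(ext5 _ p1)]].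
have k12 := order _ iso; split=> //; exists Phi; split=> //.
  move=> Phi' iso' PhiE'; apply: (sobolev_extension_unique x1ab iso' iso) => f Sf.
  by rewrite PhiE'// PhiE.
move: Phi iso {PhiE hT0}; rewrite /iso_W /iso_L /N1 /N2 /W1 /W2; clear -x1ab x2ab k12 k1_gt0.
by subst k2 => Phi iso; exact: sobolev_iso_canonical.
Qed.
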